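(* Let $\Bbbk$ be a perfect field of characteristic $p>0$, and let $R(1),\ldots,R(n)$ be Noetherian standard graded rings over $\Bbbk$, each of dimension $\geq 2$. For each $i$ let $I(i)$ be a homogeneous ideal of $R(i)$ of finite colength. Let $\boxtimes_i I(i)=I(1)\boxtimes\cdots\boxtimes I(n)$ be the homogeneous ideal $$\sum_{i=1}^n R(1)\otimes\cdots\otimes R(i-1)\otimes I(i)\otimes R(i+1)\otimes\cdots\otimes R(n)$$ of $\bigotimes_{i} R(i)=R(1)\otimes_{\Bbbk}\cdots\otimes_{\Bbbk}R(n)$. Then $$e_{HK}\bigl(\otimes_i R(i),\boxtimes_i I(i)\bigr)=\prod_{i=1}^n e_{HK}\bigl(R(i),I(i)\bigr).$$
   Context: All tensor products are over $\Bbbk$. A standard graded ring over $\Bbbk$ is a commutative $\mathbb{N}$-graded ring $R=\bigoplus_{m\ge 0}R_m$ with $R_0=\Bbbk$, generated as a $\Bbbk$-algebra by finitely many elements of $R_1$. An ideal $I\subset R$ has finite colength if $R/I$ has finite length. For $q=p^n$, $I^{[q]}$ denotes the ideal generated by the $q$-th powers of the elements of $I$. For a Noetherian ring $R$ of prime characteristic $p$ and dimension $d$ and an ideal $I$ of finite colength, the Hilbert-Kunz multiplicity is $$e_{HK}(R,I)=\lim_{n\to\infty}\frac{\ell_R(R/I^{[q]})}{q^{d}},\qquad q=p^n,$$ where $\ell_R$ denotes length; the limit is known to exist (Monsky). *)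

(* Defs.v *)
From HB Require Import structures.
From mathcomp Require Import all_boot all_order all_algebra.
From mathcomp Require Import boolp classical_sets reals topology normedtype.
From mathcomp Require Import sequences.

Set Implicit Arguments.
Unset Strict Implicit.
Unset Printing Implicit Defensive.

Import Order.TTheory GRing.Theory Num.Theory numFieldNormedType.Exports.

Local Open Scope classical_set_scope.
Local Open Scope ring_scope.

Section Ideals.
Variable R : comNzRingType.
Implicit Types (I P : set R) (l : nat).

(* The unit ideal is allowed, unlike in [idealr_closed]. *)
Definition is_ideal I : Prop := GRing.submod_closed (mem (I : set R^o)).

Definition is_prime_ideal P : Prop :=
  idealr_closed (mem P) /\ prime_idealr_closed (mem P).

Definition ideal_generated (S : set R) : set R := smallest is_ideal S.

Definition noetherian : Prop :=
  forall I, is_ideal I -> exists s : seq R, I = ideal_generated [set` s].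

(* l such that there are primes P_0 < P_1 < ... < P_l *)
Definition prime_chain_lengths : set nat :=
  [set l | exists P : nat -> set R,
     (forall i, (i <= l)%N -> is_prime_ideal (P i)) /\
     (forall i, (i < l)%N -> P i `<` P i.+1)].

(* Junk value 0 if the chain lengths are unbounded. *)
Definition krull_dim : nat := supremum 0%N prime_chain_lengths.

(* l such that there are ideals I = J_0 < J_1 < ... < J_l = R; these are the
   lengths of the chains of submodules from 0 to R / I in the R-module R / I. *)
Definition quotient_chain_lengths I : set nat :=
  [set l | exists J : nat -> set R,
     [/\ J 0%N = I, J l = setT,
         forall i, (i <= l)%N -> is_ideal (J i)
       & forall i, (i < l)%N -> J i `<` J i.+1]].

Definition finite_colength I : Prop :=
  has_ubound (quotient_chain_lengths I).

(* The length of the R-module R / I; junk value 0 if it is infinite. *)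
Definition colength I : nat := supremum 0%N (quotient_chain_lengths I).

(* I^[q] *)
Definition frobenius_power I (q : nat) : set R :=
  ideal_generated [set x ^+ q | x in I].

End Ideals.

(* The limit is taken with the total operator [lim]; its existence, when R is
   Noetherian of characteristic p and I has finite colength, is a theorem of
   Monsky. *)
Definition hilbert_kunz (K : realType) (p : nat) (R : comNzRingType)
    (I : set R) : K :=
  lim ((fun n : nat => (colength (frobenius_power I (p ^ n)%N))%:R /
                       (p ^ n)%:R ^+ krull_dim R : K) @ \oo).

Arguments noetherian : clear implicits.
Arguments krull_dim : clear implicits.

Definition perfect_field (p : nat) (k : fieldType) : Prop :=
  p \in [pchar k] /\ forall x : k, exists y : k, y ^+ p = x.

Section Graded.
Variables (k : fieldType) (R : comAlgType k).

Record standard_graded (G : nat -> set R) : Prop := StandardGraded {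
  graded_submod : forall m, GRing.submod_closed (mem (G m));
  graded_span : forall x : R, exists (N : nat) (c : nat -> R),
    (forall m, G m (c m)) /\ x = \sum_(m < N) c m;
  graded_direct : forall (N : nat) (c : nat -> R), (forall m, G m (c m)) ->
    \sum_(m < N) c m = 0 -> forall m, (m < N)%N -> c m = 0;
  graded_mul : forall a b x y, G a x -> G b y -> G (a + b)%N (x * y);
  graded_zero : G 0%N = range (fun a : k => a%:A);
  graded_generated : exists s : seq R, [set` s] `<=` G 1%N /\
    smallest (fun S : set R => GRing.subalg_closed (mem S)) [set` s] = setT
}.

Definition homogeneous_ideal (G : nat -> set R) (I : set R) : Prop :=
  is_ideal I /\
  forall (N : nat) (c : nat -> R), (forall m, G m (c m)) ->
    I (\sum_(m < N) c m) -> forall m, (m < N)%N -> I (c m).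

End Graded.

Section Tensor.
Variables (k : fieldType) (n : nat) (R : 'I_n -> comAlgType k).

Definition multilinear (V : lmodType k) (phi : (forall i, R i) -> V) : Prop :=
  forall (i : 'I_n) (f : forall j, R j) (a : k) (x y : R i),
    phi (eqtype.dfwith f (a *: x + y)) =
    a *: phi (eqtype.dfwith f x) + phi (eqtype.dfwith f y).

(* T, with tens f in the role of f_1 (x) ... (x) f_n, is the tensor product
   over k of the k-modules R i, with componentwise multiplication. *)
Record is_tensor_product (T : comAlgType k) (tens : (forall i, R i) -> T) :
    Prop := IsTensorProduct {
  tensor_multilinear : multilinear tens;
  tensor_universal : forall (V : lmodType k) (phi : (forall i, R i) -> V),
    multilinear phi ->
    exists g : {linear T -> V}, (forall f, g (tens f) = phi f) /\
      forall h : {linear T -> V}, (forall f, h (tens f) = phi f) -> h =1 g;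
  tensor_one : tens (fun i => 1) = 1;
  tensor_mul : forall f g, tens (fun i => f i * g i) = tens f * tens g
}.

Variables (T : comAlgType k) (tens : (forall i, R i) -> T).

(* R_1 (x) ... (x) I_i (x) ... (x) R_n, as a k-subspace of T *)
Definition tensor_factor (I : forall i, set (R i)) (i : 'I_n) : set T :=
  smallest (fun S : set T => GRing.submod_closed (mem S))
           [set tens f | f in [set f | I i (f i)]].

Definition box_ideal (I : forall i, set (R i)) : set T :=
  [set x | exists s : 'I_n -> T,
     (forall i, tensor_factor I i (s i)) /\ x = \sum_(i < n) s i].

End Tensor.

(* Main.v *)
(* The quotients involved contain a power of the irrelevant ideal, so their
   lengths are dimensions over k, and dimensions multiply under tensor products:
   since box(I_i)^[q] = box(I_i^[q]), the length for the tensor product is the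
   product of the lengths of the R_i/I_i^[q].  The Krull dimension of a standard
   graded algebra is the growth exponent of dim R/R_(>=m), which is additive, so
   the normalized sequences multiply as well.

   It remains to see that every factor converges (the operator lim returns a
   junk value otherwise), which is Monsky's theorem.  It is proved for all
   homogeneous ideals J in place of 0, by noetherian induction, with
   phi_n(J) = dim R/(J + I^[q]) and d = dim R.  Ideals with dim R/J < d
   contribute O(q^(d-1)).  If t is homogeneous and dim R/((J:t) + (t)) < d, then
   phi_n(J) = phi_n(J:t) + phi_n(J + (t)) + O(q^(d-1)).  Such a t is available
   unless P^[p^e] is contained in J for some prime P with dim R/P = d; in that
   case R/J is, through the e-th Frobenius, a module of some rank r over R/P, and
   comparison with a free module gives
   phi_(n+e)(J) = r phi_n(P) + O(q^(d-1)).  For J = P and e = 1, the bounds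
   c q^d <= phi_n(P) <= C q^d force r <= p^d, so that phi_n(P)/q^d is decreasing
   up to a summable error. *)
Require Import Defs.
From HB Require Import structures.
From mathcomp Require Import all_boot all_order all_algebra.
From mathcomp Require Import boolp classical_sets reals topology normedtype.
From mathcomp Require Import sequences.
From mathcomp Require Import zify.

Set Implicit Arguments.
Unset Strict Implicit.
Unset Printing Implicit Defensive.

Import Order.TTheory GRing.Theory Num.Theory numFieldNormedType.Exports.

Local Open Scope classical_set_scope.
Local Open Scope ring_scope.

(** * Dimensions of quotients of subspaces *)

(** In the code [d] is one less than the dimension: lengths are compared with [(p ^ n) ^ d.+1] and
    errors with [(p ^ n) ^ d]. No quotient ring or module is formed. Monsky's filtrations of
    finitely generated modules are recast for cyclic modules R/J, with R/(J:t) in the role of the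
    submodule of R/J generated by t, and dimensions are taken between subspaces of R. Perfectness of
    k gives every scalar a q-th root; hence R is finite over R^q, and Frobenius images of ideals
    span k-subspaces whose dimensions are counted over the same k. Two-sided bounds by powers of m
    replace Hilbert polynomials: they pass through a noetherian induction and still determine the
    exponent. Two obstacles come from inhomogeneous elements. The Krull dimension involves all
    chains of primes, while the induction yields only homogeneous ones; arbitrary chains are bounded
    by counting independent products of powers. And the denominator c that compares a module with a
    free one has no reason to be homogeneous, so quotients of R/P by arbitrary nonzero elements must
    be estimated. *)

Section QuotientDimension.
Variables (k : fieldType) (E : lmodType k).
Implicit Types (U V W : set E).

Definition subspace V : Prop :=
  V 0 /\ forall a x y, V x -> V y -> V (a *: x + y).

Lemma submod_closedP V : GRing.submod_closed (mem V) <-> subspace V.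
Proof.
split=> [[V0 VL]|[V0 VL]]; split.
- by move: V0; rewrite in_setE.
- by move=> a x y Vx Vy; move: (VL a x y); rewrite !in_setE; apply.
- by rewrite in_setE.
- by move=> a x y; rewrite !in_setE; apply: VL.
Qed.

Lemma subspace0 V : subspace V -> V 0. Proof. by case. Qed.

Lemma subspaceD V x y : subspace V -> V x -> V y -> V (x + y).
Proof. by move=> [_ VL] Vx Vy; rewrite -[x]scale1r; apply: VL. Qed.

Lemma subspaceZ V a x : subspace V -> V x -> V (a *: x).
Proof. by move=> [V0 VL] Vx; rewrite -[_ *: _]addr0; apply: VL. Qed.

Lemma subspaceN V x : subspace V -> V x -> V (- x).
Proof. by move=> VS Vx; rewrite -scaleN1r; apply: subspaceZ. Qed.

Lemma subspaceB V x y : subspace V -> V x -> V y -> V (x - y).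
Proof. by move=> VS Vx Vy; apply: subspaceD => //; apply: subspaceN. Qed.

Lemma subspace_sum V (I : Type) (r : seq I) (P : pred I) (F : I -> E) :
  subspace V -> (forall i, P i -> V (F i)) -> V (\sum_(i <- r | P i) F i).
Proof.
move=> VS VF; elim/big_rec: _ => [|i x Pi Vx]; first exact: subspace0.
by apply: subspaceD => //; apply: VF.
Qed.

Definition sumsp U W : set E := [set x | exists u w, [/\ U u, W w & x = u + w]].

Lemma subspace_sumsp U W : subspace U -> subspace W -> subspace (sumsp U W).
Proof.
move=> US WS; split.
  by exists 0, 0; rewrite addr0; split=> //; exact: subspace0.
move=> a _ _ [u [w [Uu Ww ->]]] [u' [w' [Uu' Ww' ->]]].
exists (a *: u + u'), (a *: w + w'); split; [exact: US.2|exact: WS.2|].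
by rewrite scalerDr addrACA.
Qed.

Lemma sumsp_subl U W : W 0 -> U `<=` sumsp U W.
Proof. by move=> W0 x Ux; exists x, 0; rewrite addr0. Qed.

Lemma sumsp_subr U W : U 0 -> W `<=` sumsp U W.
Proof. by move=> U0 x Wx; exists 0, x; rewrite add0r. Qed.

Lemma sumsp_sub U W V : subspace V -> U `<=` V -> W `<=` V -> sumsp U W `<=` V.
Proof. by move=> VS UV WV _ [u [w [/UV ? /WV ? ->]]]; apply: subspaceD. Qed.

(** Independence, generation and bases for the image of [U] in E/V, stated on representatives; [V]
    is not assumed to lie in [U], nor a spanning family to lie in [U]. *)
Definition free_mod V (I : finType) (b : I -> E) : Prop :=
  forall l : I -> k, V (\sum_i l i *: b i) -> forall i, l i = 0.

Definition span_mod U V (I : finType) (b : I -> E) : Prop :=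
  forall x, U x -> exists l : I -> k, V (x - \sum_i l i *: b i).

Definition basis_mod U V (I : finType) (b : I -> E) : Prop :=
  [/\ forall i, U (b i), free_mod V b & span_mod U V b].

Definition findim U V : Prop := exists n (b : 'I_n -> E), basis_mod U V b.

(* dim (U + V) / V; junk value 0 if it is infinite *)
Definition qdim U V : nat := xget 0%N [set n | exists b : 'I_n -> E, basis_mod U V b].

(** If [c] were the smaller family, the coefficient matrix of [b] in terms of [c] would kill a
    nonzero row vector, which is a relation between the [b i] modulo [V]. *)
Lemma steinitz U V (I J : finType) (b : I -> E) (c : J -> E) : subspace V ->
  (forall i, U (b i)) -> free_mod V b -> span_mod U V c -> (#|I| <= #|J|)%N.
Proof.
move=> VS Ub bfree cspan; rewrite leqNgt; apply/negP => JI.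
have [l hl] := choice (fun i => cspan (b i) (Ub i)).
pose A := \matrix_(i < #|I|, j < #|J|) l (enum_val i) (enum_val j).
have : kermx A != 0.
  by rewrite kermx_eq0 /row_free; apply: contraTneq JI => <-; rewrite -leqNgt rank_leq_col.
case/rowV0Pn => v /sub_kermxP vA v0.
suff: v = 0 by move/eqP; rewrite (negPf v0).
apply/rowP => i; rewrite mxE -(enum_valK i).
apply: (bfree (fun i => v 0 (enum_rank i))).
have -> : \sum_i v 0 (enum_rank i) *: b i =
   \sum_i v 0 (enum_rank i) *: (b i - \sum_j l i j *: c j).
  under [RHS]eq_bigr do rewrite scalerBr.
  rewrite sumrB [X in _ - X](_ : _ = 0) ?subr0 //.
  under eq_bigr do rewrite scaler_sumr.
  rewrite exchange_big big1 //= => j _.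
  under eq_bigr do rewrite scalerA.
  rewrite -scaler_suml.
  have -> : \sum_i v 0 (enum_rank i) * l i j = (v *m A) 0 (enum_rank j).
    rewrite [RHS]mxE (reindex_onto enum_val enum_rank) => [|i' _]; last by rewrite enum_rankK.
    by apply: eq_big => [i'|i' _]; rewrite ?enum_valK ?eqxx // !mxE enum_rankK.
  by rewrite vA mxE scale0r.
by apply: subspace_sum => // i' _; apply: subspaceZ.
Qed.

Lemma basis_card U V (I J : finType) (b : I -> E) (c : J -> E) : subspace V ->
  basis_mod U V b -> basis_mod U V c -> #|I| = #|J|.
Proof.
move=> VS [Ub fb sb] [Uc fc sc]; apply/eqP; rewrite eqn_leq.
by rewrite (steinitz VS Ub fb sc) (steinitz VS Uc fc sb).
Qed.

Lemma sum_enum_val (I : finType) (b : I -> E) (l : 'I_#|I| -> k) :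
  \sum_i l i *: b (enum_val i) = \sum_i l (enum_rank i) *: b i.
Proof.
rewrite [RHS](reindex_onto enum_val enum_rank) => [|i _]; last by rewrite enum_rankK.
by apply: eq_big => [i|i _]; rewrite enum_valK ?eqxx.
Qed.

Lemma free_mod_enum V (I : finType) (b : I -> E) :
  free_mod V b -> free_mod V (fun i : 'I_#|I| => b (enum_val i)).
Proof. by move=> fb l; rewrite sum_enum_val => /fb l0 i; rewrite -(enum_valK i) l0. Qed.

Lemma basis_enum U V (I : finType) (b : I -> E) :
  basis_mod U V b -> basis_mod U V (fun i : 'I_#|I| => b (enum_val i)).
Proof.
move=> [Ub fb sb]; split=> // [|x Ux]; first exact: free_mod_enum.
have [l hl] := sb x Ux; exists (fun i => l (enum_val i)); rewrite sum_enum_val.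
by under eq_bigr do rewrite enum_rankK.
Qed.

Lemma basis_findim U V (I : finType) (b : I -> E) : basis_mod U V b -> findim U V.
Proof. by move/basis_enum => hb; exists #|I|, (fun i => b (enum_val i)). Qed.

Lemma findim_basis U V : findim U V -> exists b : 'I_(qdim U V) -> E, basis_mod U V b.
Proof.
move=> [n hn]; exact: (@xgetI _ 0%N [set n | exists b : 'I_n -> E, basis_mod U V b] n hn).
Qed.

Lemma basis_qdim U V (I : finType) (b : I -> E) : subspace V ->
  basis_mod U V b -> qdim U V = #|I|.
Proof.
move=> VS hb; have [c hc] := findim_basis (basis_findim hb).
by rewrite (basis_card VS hb hc) card_ord.
Qed.

(** A free family of maximal size spans: a further element of [U] creates a relation, whose
    coefficient at the new element is nonzero. *)
Lemma bounded_findim U V N : subspace V -> 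
  (forall n (b : 'I_n -> E), (forall i, U (b i)) -> free_mod V b -> (n <= N)%N) ->
  findim U V.
Proof.
move=> VS bound.
pose Q n := `[< exists b : 'I_n -> E, (forall i, U (b i)) /\ free_mod V b >].
have Q0 : exists n, Q n.
  by exists 0%N; apply/asboolP; exists (fun=> 0); split=> [[]|l _ []].
have QN n : Q n -> (n <= N)%N by move/asboolP => [b [? ?]]; apply: bound.
case: (ex_maxnP Q0 QN) => n /asboolP[b [Ub fb]] maxn.
exists n, b; split=> // x Ux.
pose c (o : option 'I_n) := if o is Some i then b i else x.
have [fc|] := pselect (free_mod V c).
  have Uc o : U (c o) by case: o.
  suff : Q n.+1 by move/maxn; rewrite ltnn.
  rewrite -[X in X.+1](card_ord n) -card_option.
  apply/asboolP; exists (fun i => c (enum_val i)); split=> [i|]; first exact: Uc.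
  exact: free_mod_enum.
move=> nfc.
have [l] : exists l : option 'I_n -> k, V (\sum_o l o *: c o) /\ exists o, l o != 0.
  apply: contrapT => nl; apply: nfc => l Vl o; apply/eqP/negPn/negP => lo.
  by apply: nl; exists l; split=> //; exists o.
have sumE (f : option 'I_n -> E) : \sum_o f o = f None + \sum_i f (Some i).
  rewrite (bigD1 None) //=; congr (_ + _).
  rewrite (reindex_omap Some id) => [|[]//].
  by apply: eq_bigl => i /=; rewrite eqxx.
rewrite sumE /= => -[Vl [o lo]].
have lN : l None != 0.
  apply/eqP => lN; move: Vl; rewrite lN scale0r add0r => /fb l0.
  by case: o lo => [i|]; rewrite ?l0 ?lN eqxx.
exists (fun i => - (l None)^-1 * l (Some i)).
suff -> : x - \sum_i (- (l None)^-1 * l (Some i)) *: b i =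
  (l None)^-1 *: (l None *: x + \sum_i l (Some i) *: b i) by apply: subspaceZ.
rewrite scalerDr scalerA mulVf // scale1r; congr (_ + _).
rewrite scaler_sumr -sumrN; apply: eq_bigr => i _.
by rewrite mulNr scaleNr opprK scalerA.
Qed.

Lemma span_findim U V (I : finType) (c : I -> E) : subspace V ->
  span_mod U V c -> findim U V.
Proof.
move=> VS sc; apply: (@bounded_findim _ _ #|I|) => // n b Ub fb.
by have := steinitz VS Ub fb sc; rewrite card_ord.
Qed.

Lemma span_qdim U V (I : finType) (c : I -> E) : subspace V ->
  span_mod U V c -> (qdim U V <= #|I|)%N.
Proof.
move=> VS sc; have [b [Ub fb _]] := findim_basis (span_findim VS sc).
by have := steinitz VS Ub fb sc; rewrite card_ord.
Qed.

Lemma free_qdim U V (I : finType) (c : I -> E) : subspace V -> findim U V ->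
  (forall i, U (c i)) -> free_mod V c -> (#|I| <= qdim U V)%N.
Proof.
move=> VS /findim_basis[b [_ _ sb]] Uc fc.
by have := steinitz VS Uc fc sb; rewrite card_ord.
Qed.

Lemma free_mod_sub V V' (I : finType) (c : I -> E) : V `<=` V' ->
  free_mod V' c -> free_mod V c.
Proof. by move=> VV fc l /VV/fc. Qed.

Lemma findimS U U' V V' : subspace V -> subspace V' -> U' `<=` U -> V `<=` V' ->
  findim U V -> findim U' V'.
Proof.
move=> VS VS' UU VV /findim_basis[b [Ub fb sb]].
apply: (@span_findim _ _ _ b) => // x /UU/sb[l Vl]; exists l; exact: VV.
Qed.

Lemma qdimS U U' V V' : subspace V -> subspace V' -> U' `<=` U -> V `<=` V' ->
  findim U V -> (qdim U' V' <= qdim U V)%N.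
Proof.
move=> VS VS' UU VV fd; have [b [Ub fb _]] := findim_basis (findimS VS VS' UU VV fd).
rewrite -[leqLHS]card_ord; apply: (@free_qdim _ _ _ b) => // [i|]; first exact: UU.
exact: free_mod_sub fb.
Qed.

Lemma basis_mod_cat U V W (I J : finType) (b : I -> E) (c : J -> E) :
  subspace U -> subspace W -> V `<=` W -> W `<=` U ->
  basis_mod U W b -> basis_mod W V c ->
  basis_mod U V (fun s : I + J => match s with inl i => b i | inr j => c j end).
Proof.
move=> US WS VW WU [Ub fb sb] [Wc fc sc]; split=> [[i|j]//|l|x Ux].
- exact: WU.
- rewrite big_sumType /= => Vl.
  have lb i : l (inl i) = 0.
    apply: (fb (fun i => l (inl i))).
    rewrite -[X in W X](addrK (\sum_j l (inr j) *: c j)).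
    by apply: subspaceB => //; [exact: VW|apply: subspace_sum => // j _; apply: subspaceZ].
  have lc : forall j, l (inr j) = 0.
    apply: fc; move: Vl; rewrite big1 ?add0r // => i _; by rewrite lb scale0r.
  by case.
- have [l /sc[m Vm]] := sb x Ux.
  exists (fun s => match s with inl i => l i | inr j => m j end).
  by rewrite big_sumType /= opprD addrA.
Qed.

Lemma qdim_add U V W : subspace U -> subspace V -> subspace W ->
  V `<=` W -> W `<=` U -> findim U V -> qdim U V = (qdim U W + qdim W V)%N.
Proof.
move=> US VS WS VW WU fd.
have [b hb] := findim_basis (findimS VS WS (@subset_refl _ U) VW fd).
have [c hc] := findim_basis (findimS VS VS WU (@subset_refl _ V) fd).
by rewrite (basis_qdim VS (basis_mod_cat US WS VW WU hb hc)) card_sum !card_ord.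
Qed.

Lemma basis_sumsp U V (I : finType) (b : I -> E) : subspace V ->
  basis_mod U V b -> basis_mod (sumsp U V) V b.
Proof.
move=> VS [Ub fb sb]; split=> // [i|_ [u [v [/sb[l Vl] Vv ->]]]].
  exact: (sumsp_subl (subspace0 VS)).
by exists l; rewrite addrAC; apply: subspaceD.
Qed.

Lemma qdim_sumsp U V : subspace V -> findim U V -> qdim (sumsp U V) V = qdim U V.
Proof.
move=> VS /findim_basis[b /basis_sumsp hb].
by rewrite (basis_qdim VS (hb VS)) card_ord.
Qed.

Lemma qdim_sub0 U V : subspace V -> U `<=` V -> qdim U V = 0%N.
Proof.
move=> VS UV; apply/eqP; rewrite -leqn0.
rewrite -[leqRHS](card_ord 0).
apply: (@span_qdim _ _ _ (fun i : 'I_0 => 0)) => // x Ux.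
by exists (fun=> 0); rewrite big_ord0 subr0; apply: UV.
Qed.

Lemma qdim0_sub U V : subspace V -> findim U V -> qdim U V = 0%N -> U `<=` V.
Proof.
move=> VS fd q0 x Ux; have [b [_ _ sb]] := findim_basis fd.
have [l] := sb x Ux; rewrite big1 ?subr0 // => i _.
by suff: (i < 0)%N by []; rewrite -[X in (_ < X)%N]q0.
Qed.

End QuotientDimension.

(** * Images and preimages under linear maps *)

Section LinearImage.
Variables (k : fieldType) (E F : lmodType k) (f : E -> F).
Hypothesis f_lin : linear f.

Lemma linearX (I : finType) (l : I -> k) (b : I -> E) :
  f (\sum_i l i *: b i) = \sum_i l i *: f (b i).
Proof.
pose g := GRing.isLinear.Build _ _ _ _ f f_lin.
pose fl : {linear E -> F} := HB.pack f g.
by rewrite -[f]/(fl : E -> F) linear_sum; apply: eq_bigr => i _; rewrite linearZ.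
Qed.

Lemma linearBX x y : f (x - y) = f x - f y.
Proof. by rewrite addrC -scaleN1r f_lin scaleN1r addrC. Qed.

Lemma linear0X : f 0 = 0.
Proof. by rewrite -(subrr 0) linearBX subrr. Qed.

Lemma subspace_preimage V : subspace V -> subspace (f @^-1` V).
Proof.
move=> VS; split=> [|a x y]; rewrite /preimage /= ?linear0X; first exact: subspace0.
by rewrite f_lin; apply: VS.2.
Qed.

Lemma subspace_image U : subspace U -> subspace (f @` U).
Proof.
move=> US; split; first by exists 0; [exact: subspace0|exact: linear0X].
by move=> a _ _ [x Ux <-] [y Uy <-]; exists (a *: x + y); [exact: US.2|exact: f_lin].
Qed.

Lemma basis_image U V (I : finType) (b : I -> E) :
  basis_mod U (f @^-1` V) b -> basis_mod (f @` U) V (f \o b).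
Proof.
move=> [Ub fb sb]; split=> [i|l|_ [x Ux <-]]; first by exists (b i).
  by rewrite /= -linearX; apply: fb.
by have [l Vl] := sb x Ux; exists l; move: Vl; rewrite /preimage /= linearBX linearX.
Qed.

Lemma findim_image U V : findim U (f @^-1` V) -> findim (f @` U) V.
Proof. by move=> [n [b /basis_image/basis_findim]]. Qed.

Lemma qdim_image U V : subspace V ->
  findim U (f @^-1` V) -> qdim (f @` U) V = qdim U (f @^-1` V).
Proof.
by move=> VS /findim_basis[b /basis_image/(basis_qdim VS) ->]; rewrite card_ord.
Qed.

End LinearImage.

(** * Ideals *)

Section IdealTheory.
Variable R : comNzRingType.
Implicit Types (I J A B : set R).

Lemma is_idealP J :
  is_ideal J <-> J 0 /\ forall a x y, J x -> J y -> J (a * x + y).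
Proof.
split=> [[J0 JL]|[J0 JL]]; split.
- by move: J0; rewrite in_setE.
- by move=> a x y Jx Jy; move: (JL a x y); rewrite !in_setE; apply.
- by rewrite in_setE.
- by move=> a x y; rewrite !in_setE; apply: JL.
Qed.

Lemma ideal0 J : is_ideal J -> J 0. Proof. by move/is_idealP => []. Qed.

Lemma idealD J x y : is_ideal J -> J x -> J y -> J (x + y).
Proof. by move/is_idealP => [_ JL] Jx Jy; rewrite -[x]mul1r; apply: JL. Qed.

Lemma idealM J a x : is_ideal J -> J x -> J (a * x).
Proof. by move/is_idealP => [J0 JL] Jx; rewrite -[_ * _]addr0; apply: JL. Qed.

Lemma idealMr J a x : is_ideal J -> J x -> J (x * a).
Proof. by rewrite mulrC; apply: idealM. Qed.

Lemma idealN J x : is_ideal J -> J x -> J (- x).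
Proof. by move=> JI Jx; rewrite -mulN1r; apply: idealM. Qed.

Lemma idealB J x y : is_ideal J -> J x -> J y -> J (x - y).
Proof. by move=> JI Jx Jy; apply: idealD => //; apply: idealN. Qed.

Lemma ideal_sum J (T : Type) (r : seq T) (P : pred T) (F : T -> R) :
  is_ideal J -> (forall i, P i -> J (F i)) -> J (\sum_(i <- r | P i) F i).
Proof.
move=> JI JF; elim/big_rec: _ => [|i x Pi Jx]; first exact: ideal0.
by apply: idealD => //; apply: JF.
Qed.

Lemma idealX J x n : is_ideal J -> (0 < n)%N -> J x -> J (x ^+ n).
Proof. by case: n => // n JI _ Jx; rewrite exprS; apply: idealMr. Qed.

Lemma ideal1 J : is_ideal J -> J 1 -> J = setT.
Proof. by move=> JI J1; apply/seteqP; split=> // x _; rewrite -[x]mulr1; apply: idealM. Qed.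

Lemma is_idealT : is_ideal [set: R].
Proof. exact/is_idealP. Qed.

Definition idsum J a : set R := [set x | exists j r, J j /\ x = j + a * r].

Lemma ideal_idsum J a : is_ideal J -> is_ideal (idsum J a).
Proof.
move=> JI; apply/is_idealP; split; first by exists 0, 0; rewrite mulr0 addr0; split=> //; exact: ideal0.
move=> b _ _ [j [r [Jj ->]]] [j' [r' [Jj' ->]]].
exists (b * j + j'), (b * r + r'); split; first by apply: idealD => //; apply: idealM.
by rewrite !mulrDr addrACA; congr (_ + (_ + _)); rewrite mulrCA.
Qed.

Lemma idsum_sub J a : J `<=` idsum J a.
Proof. by move=> x Jx; exists x, 0; rewrite mulr0 addr0. Qed.

Lemma idsum_mem J a r : is_ideal J -> idsum J a (a * r).
Proof. by move=> JI; exists 0, r; rewrite add0r; split=> //; apply: ideal0. Qed.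

Lemma idsum_gen J a : is_ideal J -> idsum J a a.
Proof. by move=> JI; rewrite -[X in idsum _ _ X]mulr1; apply: idsum_mem. Qed.

Lemma idsum_min J a A : is_ideal A -> J `<=` A -> A a -> idsum J a `<=` A.
Proof. by move=> AI JA Aa _ [j [r [/JA Jj ->]]]; apply: idealD => //; apply: idealMr. Qed.

Lemma idsum_proper J a : is_ideal J -> ~ J a -> J `<` idsum J a.
Proof.
move=> JI nJa; split; first exact: idsum_sub.
by move=> /(_ _ (idsum_gen a JI)).
Qed.

Definition colon J a : set R := [set x | J (a * x)].

Lemma ideal_colon J a : is_ideal J -> is_ideal (colon J a).
Proof.
move=> JI; apply/is_idealP; rewrite /colon /=; split; first by rewrite mulr0; apply: ideal0.
by move=> b x y Jx Jy; rewrite mulrDr mulrCA; apply: idealD => //; apply: idealM.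
Qed.

Lemma colon_sub J a : is_ideal J -> J `<=` colon J a.
Proof. by move=> JI x Jx; apply: idealM. Qed.

Definition idadd A B : set R := [set x | exists a b, [/\ A a, B b & x = a + b]].

Lemma ideal_idadd A B : is_ideal A -> is_ideal B -> is_ideal (idadd A B).
Proof.
move=> AI BI; apply/is_idealP; split.
  by exists 0, 0; rewrite addr0; split=> //; exact: ideal0.
move=> c _ _ [a [b [Aa Bb ->]]] [a' [b' [Aa' Bb' ->]]].
exists (c * a + a'), (c * b + b'); split; last by rewrite mulrDr addrACA.
  by apply: idealD => //; apply: idealM.
by apply: idealD => //; apply: idealM.
Qed.

Lemma idadd_subl A B : is_ideal B -> A `<=` idadd A B.
Proof. by move=> BI x Ax; exists x, 0; rewrite addr0; split=> //; apply: ideal0. Qed.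

Lemma idadd_subr A B : is_ideal A -> B `<=` idadd A B.
Proof. by move=> AI x Bx; exists 0, x; rewrite add0r; split=> //; apply: ideal0. Qed.

Lemma idadd_min A B C : is_ideal C -> A `<=` C -> B `<=` C -> idadd A B `<=` C.
Proof. by move=> CI AC BC _ [a [b [/AC ? /BC ? ->]]]; apply: idealD. Qed.

Lemma ideal_gen (S : set R) : is_ideal (ideal_generated S).
Proof.
apply/is_idealP; split; first by move=> A [AI _]; apply: ideal0.
move=> a x y Sx Sy A AS; have AI := AS.1.
by apply: idealD => //; [apply: idealM => //; apply: Sx|apply: Sy].
Qed.

Lemma gen_sub (S : set R) : S `<=` ideal_generated S.
Proof. by move=> x Sx A [_]; apply. Qed.

Lemma gen_min (S : set R) A : is_ideal A -> S `<=` A -> ideal_generated S `<=` A.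
Proof. by move=> AI SA x; apply. Qed.

Lemma ideal_bigcup (F : nat -> set R) : (forall i, is_ideal (F i)) ->
  (forall i, F i `<=` F i.+1) -> is_ideal [set x | exists i, F i x].
Proof.
move=> FI FS.
have Fle i j : (i <= j)%N -> F i `<=` F j.
  move/subnK <-; elim: (j - i)%N => // d IH; apply: subset_trans IH _; exact: FS.
apply/is_idealP; split; first by exists 0%N; apply: ideal0.
move=> a x y [i Fx] [j Fy]; exists (maxn i j).
apply: idealD => //; last exact: Fle (leq_maxr _ _) _ Fy.
by apply: idealM => //; apply: Fle (leq_maxl _ _) _ Fx.
Qed.

(** Otherwise every bad ideal has a bad one strictly above it. The union of the resulting chain is
    finitely generated, so its generators already lie in some member and the chain stops there. *)
Lemma noetherian_ind (Q : set R -> Prop) : noetherian R ->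
  (forall J, is_ideal J -> (forall J', is_ideal J' -> J `<` J' -> Q J') -> Q J) ->
  forall J, is_ideal J -> Q J.
Proof.
move=> RN step J JI; apply: contrapT => nQJ.
pose bad := {A : set R | is_ideal A /\ ~ Q A}.
have next (A : bad) : exists B : bad, sval A `<` sval B.
  apply: contrapT => nB; have [AI nQA] := svalP A.
  apply: nQA; apply: step => // J' J'I AJ'; apply: contrapT => nQJ'.
  by apply: nB; exists (exist _ J' (conj J'I nQJ')).
have [f hf] := choice next.
pose F n := sval (iter n f (exist _ J (conj JI nQJ))).
have FI n : is_ideal (F n) by have [] := svalP (iter n f (exist _ J (conj JI nQJ))).
have FS n : F n `<` F n.+1 by apply: hf.
have Fle i j : (i <= j)%N -> F i `<=` F j.
  move/subnK <-; elim: (j - i)%N => // d IH; apply: subset_trans IH _.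
  by have [] := FS (d + i)%N.
have UI := ideal_bigcup FI (fun n => (FS n).1).
have [s sE] := RN _ UI.
have sF : forall x, x \in s -> exists i, F i x.
  by move=> x xs; have : ideal_generated [set` s] x by [apply: gen_sub]; rewrite -sE.
have [N sN] : exists N, forall x, x \in s -> F N x.
  elim: s sF {sE} => [|y s IH] sF; first by exists 0%N.
  have [N sN] := IH (fun x xs => sF x (mem_behead (s := y :: s) xs)).
  have [i Fy] := sF y (mem_head _ _).
  exists (maxn i N) => x; rewrite inE => /orP[/eqP->|xs].
    exact: Fle (leq_maxl _ _) _ Fy.
  exact: Fle (leq_maxr _ _) _ (sN x xs).
have [_ []] := FS N; move=> x Fx.
suff : ideal_generated [set` s] x by apply: gen_min => // y; apply: sN.
by rewrite -sE; exists N.+1.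
Qed.

(** * Additivity of Frobenius and Frobenius powers of ideals *)

Section Frobenius.
Variable p : nat.
Hypothesis pR : p \in [pchar R].

Lemma frobD e (x y : R) : (x + y) ^+ (p ^ e) = x ^+ (p ^ e) + y ^+ (p ^ e).
Proof. by apply: exprDn_pchar; rewrite (eq_pnat _ (pcharf_eq pR)) pnatX pnat_id ?(pcharf_prime pR). Qed.

Lemma frob_gt0 e : (0 < p ^ e)%N.
Proof. by rewrite expn_gt0 prime_gt0 // (pcharf_prime pR). Qed.

Lemma frob0 e : (0 : R) ^+ (p ^ e) = 0.
Proof. by rewrite expr0n; have := frob_gt0 e; case: (p ^ e)%N. Qed.

Lemma frob_sum e (T : Type) (r : seq T) (P : pred T) (F : T -> R) :
  (\sum_(i <- r | P i) F i) ^+ (p ^ e) = \sum_(i <- r | P i) F i ^+ (p ^ e).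
Proof. by elim/big_rec2: _ => [|i y x _ <-]; rewrite ?frob0 ?frobD. Qed.

Lemma frobN e (x : R) : (- x) ^+ (p ^ e) = - x ^+ (p ^ e).
Proof. by apply/eqP; rewrite -addr_eq0 -frobD addNr frob0. Qed.

Lemma ideal_frob_preimage J e : is_ideal J -> is_ideal [set x | J (x ^+ (p ^ e))].
Proof.
move=> JI; apply/is_idealP; split=> /=; first by rewrite frob0; apply: ideal0.
by move=> a x y Jx Jy; rewrite frobD exprMn; apply: idealD => //; apply: idealM.
Qed.

Lemma frobenius_power_exp J q e x :
  frobenius_power J q x -> frobenius_power J (q * p ^ e) (x ^+ (p ^ e)).
Proof.
have JI := ideal_frob_preimage e (ideal_gen [set x ^+ (q * p ^ e) | x in J]).
apply: (gen_min JI) => _ [y Jy <-] /=; rewrite -exprM.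
by apply: gen_sub; exists y.
Qed.

End Frobenius.

Lemma ideal_frobenius_power J q : is_ideal (frobenius_power J q).
Proof. exact: ideal_gen. Qed.

Lemma frobenius_power_mem J q x : J x -> frobenius_power J q (x ^+ q).
Proof. by move=> Jx; apply: gen_sub; exists x. Qed.

End IdealTheory.

Section IdealSubspace.
Variables (k : fieldType) (R : comAlgType k).

Lemma ideal_subspace (J : set R) : is_ideal J -> subspace J.
Proof.
move=> JI; split=> [|a x y Jx Jy]; first exact: ideal0.
by rewrite -mulr_algl; apply: idealD => //; apply: idealM.
Qed.

Lemma pchar_alg p : p \in [pchar k] -> p \in [pchar R].
Proof. by rewrite pchar_lalg. Qed.

End IdealSubspace.

(** * Standard graded algebras *)

Section GradedTheory.
Variables (k : fieldType) (R : comAlgType k) (G : nat -> set R).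

Definition decomposition (c : nat -> R) (x : R) : Prop :=
  (forall m, G m (c m)) /\
  exists N, (forall m, (N <= m)%N -> c m = 0) /\ x = \sum_(m < N) c m.

(** The homogeneous components of [x]. The default value is never taken when [G] is a standard
    grading, by [decomposition_exists]. *)
Definition comp (x : R) : nat -> R :=
  if pselect (exists c, decomposition c x) is left e then sval (cid e) else fun=> 0.

Definition ge (m : nat) : set R := [set x | forall i, (i < m)%N -> comp x i = 0].

(* For J homogeneous, this is J + R_m + R_(m+1) + ... *)
Definition cutoff (J : set R) (m : nat) : set R :=
  [set x | forall i, (i < m)%N -> J (comp x i)].

Definition hom (J : set R) : Prop := is_ideal J /\ forall x i, J x -> J (comp x i).

Definition mono r (x : 'I_r -> R) (a : 'I_r -> nat) : R := \prod_i x i ^+ a i.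

Hypothesis HG : standard_graded G.

Lemma G_subspace m : subspace (G m).
Proof. exact/submod_closedP/(graded_submod HG). Qed.

Lemma decomposition_exists x : exists c, decomposition c x.
Proof.
have [N [c [Gc xE]]] := graded_span HG x.
exists (fun m => if (m < N)%N then c m else 0); split=> [m|].
  by case: ifP => // _; apply: subspace0 (G_subspace m).
exists N; split=> [m|]; first by rewrite leqNgt => /negPf->.
by rewrite xE; apply: eq_bigr => i _; rewrite ltn_ord.
Qed.

Lemma compP x : decomposition (comp x) x.
Proof.
rewrite /comp; case: pselect => [e|[]]; last exact: decomposition_exists.
by case: cid.
Qed.

Lemma compG x m : G m (comp x m). Proof. exact: (compP x).1. Qed.

Lemma sum_widen (c : nat -> R) N M : (forall m, (N <= m)%N -> c m = 0) -> (N <= M)%N ->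
  \sum_(m < N) c m = \sum_(m < M) c m.
Proof.
move=> cN NM; rewrite -!(big_mkord xpredT) (big_cat_nat (leq0n N) NM) //= [X in _ = _ + X]big1_seq ?addr0 //.
by move=> i /andP[_]; rewrite mem_index_iota => /andP[/cN].
Qed.

Lemma decomposition_uniq c c' x : decomposition c x -> decomposition c' x -> c =1 c'.
Proof.
move=> [Gc [N [cN xE]]] [Gc' [N' [cN' xE']]] m.
pose M := maxn m.+1 (maxn N N').
have NM : (N <= M)%N by rewrite !leq_max leqnn orbT.
have NM' : (N' <= M)%N by rewrite !leq_max leqnn !orbT.
apply/eqP; rewrite -subr_eq0; apply/eqP.
apply: (@graded_direct _ _ _ HG M (fun m => c m - c' m)).
- by move=> i; apply: subspaceB => //; apply: G_subspace.
- by rewrite sumrB -(sum_widen cN NM) -(sum_widen cN' NM') -xE -xE' subrr.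
- by rewrite leq_max leqnn.
Qed.

Lemma comp_eq c x : decomposition c x -> comp x =1 c.
Proof. exact: decomposition_uniq (compP x). Qed.

Lemma comp_sum x : exists N, forall M, (N <= M)%N -> x = \sum_(m < M) comp x m.
Proof.
have [_ [N [cN xE]]] := compP x; exists N => M NM.
by rewrite [LHS]xE (sum_widen cN NM).
Qed.

Lemma decomposition_lin a c c' x x' : decomposition c x -> decomposition c' x' ->
  decomposition (fun m => a *: c m + c' m) (a *: x + x').
Proof.
move=> [Gc [N [cN xE]]] [Gc' [N' [cN' xE']]]; split.
  by move=> m; apply: (G_subspace m).2.
have NM := leq_maxl N N'; have NM' := leq_maxr N N'.
exists (maxn N N'); split=> [m|].
  by rewrite geq_max => /andP[/cN-> /cN'->]; rewrite scaler0 addr0.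
by rewrite big_split /= -scaler_sumr -(sum_widen cN NM) -(sum_widen cN' NM') -xE -xE'.
Qed.

Lemma comp_lin a x y m : comp (a *: x + y) m = a *: comp x m + comp y m.
Proof. exact: (comp_eq (decomposition_lin a (compP x) (compP y))). Qed.

Lemma comp_linear m : linear (comp ^~ m).
Proof. by move=> a x y; apply: comp_lin. Qed.

Lemma comp0 m : comp 0 m = 0. Proof. exact: linear0X (comp_linear m). Qed.

Lemma compD x y m : comp (x + y) m = comp x m + comp y m.
Proof. by rewrite -[x]scale1r comp_lin !scale1r. Qed.

Lemma compB x y m : comp (x - y) m = comp x m - comp y m.
Proof. exact: (linearBX (comp_linear m)). Qed.

Lemma comp_homog a x m : G a x -> comp x m = if m == a then x else 0.
Proof.
move=> Ga; apply: (@comp_eq (fun m => if m == a then x else 0)); split=> [i|].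
  by case: eqP => [->|_] //; apply: subspace0 (G_subspace i).
exists a.+1; split=> [i|]; first by rewrite ltnNge leq_eqVlt negb_or eq_sym => /andP[/negPf->].
rewrite (bigD1 ord_max) //= eqxx big1 ?addr0 // => i.
by rewrite -val_eqE /= => /negPf->.
Qed.

Lemma decomposition_mul s a r : G s a ->
  decomposition (fun i => if (s <= i)%N then a * comp r (i - s) else 0) (a * r).
Proof.
move=> Ga; split=> [m|].
  case: leqP => [sm|_]; last exact: subspace0 (G_subspace m).
  by rewrite -{1}(subnKC sm); apply: (graded_mul HG) => //; apply: compG.
have [_ [N [cN rE]]] := compP r; exists (s + N)%N; split=> [m sNm|].
  have sm : (s <= m)%N by apply: leq_trans sNm; apply: leq_addr.
  by rewrite sm cN ?mulr0 // leq_subRL.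
rewrite [in LHS]rE mulr_sumr big_split_ord /= [X in _ = X + _]big1 ?add0r.
  by apply: eq_bigr => i _; rewrite leq_addr addKn.
by move=> i _; rewrite leqNgt ltn_ord.
Qed.

Lemma comp_mul s a r i : G s a -> comp (a * r) (s + i)%N = a * comp r i.
Proof. by move=> Ga; rewrite (comp_eq (decomposition_mul r Ga)) leq_addr addKn. Qed.

Lemma comp_mul0 s a r i : G s a -> (i < s)%N -> comp (a * r) i = 0.
Proof. by move=> Ga; rewrite (comp_eq (decomposition_mul r Ga)) ltnNge => /negPf->. Qed.

Lemma G1_one : G 0%N 1.
Proof. by rewrite (graded_zero HG); exists 1 => //; rewrite scale1r. Qed.

Lemma homI J : homogeneous_ideal G J -> hom J.
Proof.
move=> [JI JH]; split=> // x i Jx.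
have [N xE] := comp_sum x.
pose M := maxn N i.+1.
apply: (JH M (comp x)); first exact: compG.
  by rewrite -xE // leq_maxl.
by rewrite leq_maxr.
Qed.

Lemma hom_ideal J : hom J -> is_ideal J. Proof. by case. Qed.

Lemma hom0 : hom [set 0].
Proof.
split=> [|x i ->]; last by rewrite comp0.
by apply/is_idealP; split=> //= a x y -> ->; rewrite mulr0 addr0.
Qed.

Lemma hom_idsum J s a : G s a -> hom J -> hom (idsum J a).
Proof.
move=> Ga [JI JH]; split=> [|_ i [j [r [Jj ->]]]]; first exact: ideal_idsum.
have [is_|si] := ltnP i s.
  by apply: idsum_sub; rewrite compD (comp_mul0 _ Ga) // addr0; apply: JH.
exists (comp j i), (comp r (i - s)); split; first exact: JH.
by rewrite compD -[in LHS](subnKC si) comp_mul // subnKC.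
Qed.

Lemma hom_colon J s a : G s a -> hom J -> hom (colon J a).
Proof.
move=> Ga [JI JH]; split=> [|x i Jx]; first exact: ideal_colon.
by rewrite /colon /= -(comp_mul x i Ga); apply: JH.
Qed.

Lemma hom_sub J : hom J -> forall x, (forall i, J (comp x i)) -> J x.
Proof.
move=> [JI _] x Jc; have [N xE] := comp_sum x; rewrite (xE N) //.
exact: ideal_sum.
Qed.

Lemma subspace_ge m : subspace (ge m).
Proof.
split=> [i _|a x y gx gy i im]; first exact: comp0.
by rewrite comp_lin gx // gy // scaler0 addr0.
Qed.

Lemma ge0 : ge 0 = setT.
Proof. by apply/seteqP; split. Qed.

Lemma G_ge a m x : G a x -> (m <= a)%N -> ge m x.
Proof.
move=> Ga ma i im; rewrite (comp_homog i Ga); case: eqP => // ia.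
by move: im; rewrite ia ltnNge ma.
Qed.

Lemma ge_leq m n : (m <= n)%N -> ge n `<=` ge m.
Proof. by move=> mn x gx i im; apply: gx; apply: leq_trans mn. Qed.

Lemma ge_mul m n x y : ge m x -> ge n y -> ge (m + n) (x * y).
Proof.
move=> gx gy; have [N xE] := comp_sum x; have [M yE] := comp_sum y.
rewrite (xE N) // (yE M) // mulr_suml; apply: subspace_sum => [|i _]; first exact: subspace_ge.
rewrite mulr_sumr; apply: subspace_sum => [|j _]; first exact: subspace_ge.
have [im|mi] := ltnP i m; first by rewrite gx // mul0r; apply: subspace0 (subspace_ge _).
have [jn|nj] := ltnP j n; first by rewrite gy // mulr0; apply: subspace0 (subspace_ge _).
by apply: (@G_ge (i + j)%N); [apply: (graded_mul HG); apply: compG|apply: leq_add].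
Qed.

Lemma ideal_ge m : is_ideal (ge m).
Proof.
have S := subspace_ge m; apply/is_idealP; split; first exact: subspace0.
by move=> a x y gx gy; apply: (subspaceD S) => //; rewrite -[m]add0n; apply: ge_mul => //; rewrite ge0.
Qed.

Lemma cutoffE J m x : hom J -> cutoff J m x <-> idadd J (ge m) x.
Proof.
move=> [JI JH]; split=> [tx|[j [g [Jj gg ->]]] i im]; last first.
  by rewrite compD gg // addr0; apply: JH.
exists (\sum_(i < m) comp x i), (x - \sum_(i < m) comp x i); split.
- by apply: ideal_sum => // i _; apply: tx.
- have [N xE] := comp_sum x.
  rewrite {1}(xE (m + N)%N (leq_addl _ _)) big_split_ord /= addrAC subrr add0r.
  apply: subspace_sum => [|i _]; first exact: subspace_ge.
  by apply: G_ge (compG _ _) _; apply: leq_addr.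
- by rewrite addrCA subrr addr0.
Qed.

Lemma cutoffEset J m : hom J -> cutoff J m = idadd J (ge m).
Proof. by move=> JH; apply/seteqP; split=> x /(cutoffE _ _ JH). Qed.

Lemma ideal_cutoff J m : hom J -> is_ideal (cutoff J m).
Proof.
move=> JH; rewrite cutoffEset //; apply: ideal_idadd; [exact: hom_ideal|exact: ideal_ge].
Qed.

Lemma subspace_cutoff J m : hom J -> subspace (cutoff J m).
Proof. by move=> JH; apply/ideal_subspace/ideal_cutoff. Qed.

Lemma cutoff_sub J m : hom J -> J `<=` cutoff J m.
Proof. by move=> [_ JH] x Jx i _; apply: JH. Qed.

Lemma ge_cutoff J m : hom J -> ge m `<=` cutoff J m.
Proof. by move=> [JI _] x gx i im; rewrite gx //; apply: ideal0. Qed.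

Lemma cutoff0 J : cutoff J 0 = setT.
Proof. by apply/seteqP; split. Qed.

Lemma cutoff_leq J m n : (m <= n)%N -> cutoff J n `<=` cutoff J m.
Proof. by move=> mn x tx i im; apply: tx; apply: leq_trans mn. Qed.

Lemma cutoffS J J' m : J `<=` J' -> cutoff J m `<=` cutoff J' m.
Proof. by move=> JJ x tx i im; apply: JJ; apply: tx. Qed.

Lemma cutoff_mul J m n x y : hom J -> cutoff J m x -> cutoff J n y -> cutoff J (m + n) (x * y).
Proof.
move=> JH /(cutoffE _ _ JH)[j [g [Jj gg ->]]] /(cutoffE _ _ JH)[j' [g' [Jj' gg' ->]]].
have JI := hom_ideal JH.
rewrite mulrDl mulrDr -addrA; apply/(cutoffE _ _ JH).
exists (j * j' + (j * g' + g * j')), (g * g').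
split; last by rewrite mulrDr !addrA.
- by apply: idealD => //; [apply: idealM|apply: idealD => //; [apply: idealMr|apply: idealM]].
- exact: ge_mul.
Qed.

(** [m] is the order of [x] in the graded ring R/J, the degree of its lowest nonzero component
    there. *)
Lemma cutoff_order J x : hom J -> ~ J x -> exists m, cutoff J m x /\ ~ cutoff J m.+1 x.
Proof.
move=> JH nJx; apply: contrapT => nm; apply: nJx; apply: hom_sub => // i.
suff : cutoff J i.+1 x by apply.
elim: i.+1 => [|m IH]; first by rewrite cutoff0.
by apply: contrapT => nt; apply: nm; exists m.
Qed.

Lemma cutoff_homog J m a x : G a x -> (a < m)%N -> cutoff J m x -> J x.
Proof. by move=> Ga am /(_ a am); rewrite (comp_homog _ Ga) eqxx. Qed.

Lemma cutoff_idsum J s a m : G s a -> hom J -> cutoff (idsum J a) m = idsum (cutoff J m) a.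
Proof.
move=> Ga JH; have aH := hom_idsum Ga JH; have JI := hom_ideal JH.
apply/seteqP; split=> x.
  move/(cutoffE _ _ aH) => [_ [g [[j [r [Jj ->]]] gg ->]]].
  exists (j + g), r; split; last by rewrite addrAC.
  by apply/(cutoffE _ _ JH); exists j, g.
have TI := ideal_cutoff m aH.
apply: idsum_min => //; first by apply: cutoffS; apply: idsum_sub.
by apply: cutoff_sub => //; apply: idsum_gen.
Qed.

(** * Monomials in the generators of degree one *)

Section Generators.
Variables (r : nat) (x : 'I_r -> R).

Lemma mono_ord0 : mono x (fun=> 0%N) = 1.
Proof. by rewrite /mono big1. Qed.

Lemma mono_add a b : mono x a * mono x b = mono x (fun i => (a i + b i)%N).
Proof. by rewrite /mono -big_split; apply: eq_bigr => i _; rewrite exprD. Qed.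

Lemma G_exp y n : G 1%N y -> G n (y ^+ n).
Proof.
move=> Gy; elim: n => [|n IH]; first exact: G1_one.
by rewrite exprS -add1n; apply: (graded_mul HG).
Qed.

Lemma G_mono a : (forall i, G 1%N (x i)) -> G (\sum_i a i)%N (mono x a).
Proof.
move=> Gx; rewrite /mono; elim/big_rec2: _ => [|i d y _ Gy]; first exact: G1_one.
by apply: (graded_mul HG) => //; apply: G_exp.
Qed.

Lemma mono_factor a i t : (t <= a i)%N -> exists y, mono x a = x i ^+ t * y.
Proof.
move=> ta; exists (x i ^+ (a i - t) * \prod_(j | j != i) x j ^+ a j).
by rewrite mulrA -exprD subnKC // /mono (bigD1 i).
Qed.

End Generators.

(** Generation is expressed by monomials and k-linear span, as an induction principle on the
    elements of R. *)
Definition generators r (x : 'I_r -> R) : Prop :=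
  (forall i, G 1%N (x i)) /\
  forall W, subspace W -> (forall a, W (mono x a)) -> forall y, W y.

Lemma generators_exist : exists r (x : 'I_r -> R), generators x.
Proof.
have [s [sG sE]] := graded_generated HG.
exists (size s), (fun i => s`_i); split=> [i|W WS Wm y].
  by apply: sG; rewrite /= mem_nth.
set x := fun i : 'I_(size s) => s`_i in Wm.
pose S : set R := [set y | forall W, subspace W -> (forall a, W (mono x a)) -> W y].
suff : S y by apply.
have SS : subspace S.
  split=> [V VS _|a u v Su Sv V VS Vm]; first exact: subspace0.
  by apply: VS.2; [exact: Su|exact: Sv].
have Sm a : S (mono x a) by move=> V _; apply.
have SmM a v : S v -> S (mono x a * v).
  move=> Sv; apply: (Sv [set w | S (mono x a * w)]).
    split=> [|b u w Su Sw]; rewrite /= ?mulr0; first exact: subspace0.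
    by rewrite mulrDr -scalerAr; apply: SS.2.
  by move=> b /=; rewrite mono_add.
have SM u v : S u -> S v -> S (u * v).
  move=> Su Sv; apply: (Su [set u | S (u * v)]); first split=> [|b w w' Sw Sw'] /=.
  - by rewrite mul0r; apply: subspace0.
  - by rewrite mulrDl -scalerAl; apply: SS.2.
  - by move=> a; apply: SmM.
suff -> : S = setT by [].
apply/seteqP; split=> // z _.
have : (smallest (fun S : set R => GRing.subalg_closed (mem S)) [set` s]) z by rewrite sE.
apply; split=> [|t /= ts].
  split=> [|a u v|u v]; rewrite !in_setE.
  - by rewrite -(mono_ord0 x).
  - exact: SS.2.
  - exact: SM.
have [i ->] : exists i : 'I_(size s), t = x i.
  by move: ts; rewrite -index_mem => it; exists (Ordinal it); rewrite /x /= nth_index // -index_mem.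
suff -> : x i = mono x (fun j => (j == i) : nat) by [].
by rewrite /mono (bigD1 i) //= eqxx expr1 big1 ?mulr1 // => j /negPf->.
Qed.

Section WithGenerators.
Variables (r : nat) (x : 'I_r -> R).
Hypothesis gx : generators x.

(** A monomial in [r] variables of degree above r(t-1) has an exponent that is at least [t]. *)
Lemma ge_pigeonhole B t : is_ideal B -> (forall j, B (x j ^+ t)) ->
  ge (r * t.-1).+1 `<=` B.
Proof.
move=> BI Bx; have [Gx xW] := gx.
have Bc : forall y i, (r * t.-1 < i)%N -> B (comp y i).
  apply: (xW [set y | forall i, (r * t.-1 < i)%N -> B (comp y i)]).
    split=> [i _|a u v Bu Bv i ti]; first by rewrite comp0; apply: ideal0.
    by rewrite comp_lin; apply: (ideal_subspace BI).2; [exact: Bu|exact: Bv].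
  move=> a i ti; rewrite (comp_homog i (G_mono a Gx)).
  case: eqP => [iE|_]; last exact: ideal0.
  have [/existsP[j tj]|] := boolP [exists j, (t <= a j)%N].
    by have [y ->] := mono_factor x tj; apply: idealMr.
  rewrite negb_exists => /forallP at_; exfalso.
  move: ti; rewrite ltnNge iE => /negP; apply.
  rewrite -[X in (X * _)%N]card_ord -sum_nat_const; apply: leq_sum => j _.
  by have := at_ j; rewrite -ltnNge; case: (t).
move=> y gy; have [N yE] := comp_sum y; rewrite (yE N) //.
apply: ideal_sum => // i _.
have [it|ti] := leqP i (r * t.-1)%N; last exact: Bc.
by rewrite gy //; apply: ideal0.
Qed.

Lemma span_ge m : span_mod setT (ge m) (fun a : {ffun 'I_r -> 'I_m} => mono x (fun i => a i : nat)).
Proof.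
have [Gx xW] := gx; have gS := subspace_ge m.
suff : forall y, [set y | exists l : {ffun 'I_r -> 'I_m} -> k,
    ge m (y - \sum_a l a *: mono x (fun i => a i : nat))] y.
  by move=> h y _; exact: h.
apply: xW => [|a /=].
  split=> [|b u v [l lu] [l' lv]] /=.
    by exists (fun=> 0); rewrite big1 ?subr0 => [|i _]; [exact: subspace0|rewrite scale0r].
  exists (fun a => b * l a + l' a).
  under eq_bigr do rewrite scalerDl -scalerA.
  rewrite big_split /= -scaler_sumr opprD addrACA -scalerBr.
  exact: gS.2.
have [/forallP am|] := boolP [forall i, (a i < m)%N].
  pose b : {ffun 'I_r -> 'I_m} := [ffun i => Ordinal (am i)].
  exists (fun c => (c == b)%:R); rewrite (bigD1 b) //= eqxx scale1r.
  rewrite big1 => [|c /negPf->]; last by rewrite scale0r.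
  rewrite addr0 (_ : mono x a = mono x (fun i => b i : nat)) ?subrr; first exact: subspace0.
  by apply: eq_bigr => i _; rewrite ffunE.
rewrite negb_forall => /existsP[i]; rewrite -leqNgt => mi.
exists (fun=> 0); rewrite big1 ?subr0 => [|c _]; last by rewrite scale0r.
apply: G_ge (G_mono a Gx) _; rewrite (bigD1 i) //=.
by apply: leq_trans mi _; apply: leq_addr.
Qed.

End WithGenerators.

Lemma findim_ge m : findim setT (ge m).
Proof.
have [r [x gx]] := generators_exist.
exact: span_findim (subspace_ge m) (span_ge gx m).
Qed.

Lemma findim_sub_ge U V m : subspace V -> ge m `<=` V -> findim U V.
Proof.
move=> VS gV; exact: findimS (subspace_ge m) VS (@subsetT _ U) gV (findim_ge m).
Qed.

End GradedTheory.

(** * Hilbert functions and Krull dimension *)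

Lemma properset_subset_trans (T : Type) (A B C : set T) :
  A `<` B -> B `<=` C -> A `<` C.
Proof.
by move=> [AB nBA] BC; split=> [|CA]; [apply: subset_trans BC|apply: nBA; apply: subset_trans CA].
Qed.

Lemma subset_properset_trans (T : Type) (A B C : set T) :
  A `<=` B -> B `<` C -> A `<` C.
Proof.
by move=> AB [BC nCB]; split=> [|CA]; [apply: subset_trans BC|apply: nCB; apply: subset_trans AB].
Qed.

Section PrimeIdeals.
Variable R : comNzRingType.

Lemma is_primeP (P : set R) :
  is_prime_ideal P <-> [/\ is_ideal P, ~ P 1 & forall u v, P (u * v) -> P u \/ P v].
Proof.
split=> [[[P0 P1 PL] PP]|[PI P1 PP]].
  split=> [||u v].
  - apply/is_idealP; split; first by move: P0; rewrite in_setE.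
    by move=> a x y Px Py; have := PL a x y; rewrite !in_setE; apply.
  - by move: P1; rewrite notin_setE.
  - by have := PP u v; rewrite in_setE => h /h /orP[]; rewrite in_setE; [left|right].
split; first split.
- by rewrite in_setE; apply: ideal0.
- by rewrite notin_setE.
- by move=> a u v; rewrite !in_setE => Pu Pv; apply: idealD => //; apply: idealM.
- by move=> u v; rewrite in_setE => /PP[] h; apply/orP; [left|right]; rewrite in_setE.
Qed.

Lemma prime_exp (P : set R) x n : is_prime_ideal P -> P (x ^+ n) -> P x.
Proof.
move=> /is_primeP[PI P1 PP]; elim: n => [|n IH]; first by rewrite expr0.
by rewrite exprS => /PP[].
Qed.

End PrimeIdeals.

Section QuotientColon.
Variables (k : fieldType) (R : comAlgType k).

Lemma mulr_linear (a : R) : linear ( *%R a).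
Proof. by move=> b x y; rewrite mulrDr scalerAr. Qed.

Lemma idsumE (V : set R) a : idsum V a = sumsp (( *%R a) @` setT) V.
Proof.
apply/seteqP; split=> [_ [j [r [Vj ->]]]|_ [_ [j [[r _ <-] Vj ->]]]].
  by exists (a * r), j; rewrite addrC; split=> //; exists r.
by exists j, r; rewrite addrC.
Qed.

(** Multiplication by [a] identifies R/(V:a) with (V+(a))/V. *)
Lemma qdim_colon (V : set R) a : is_ideal V -> findim setT V ->
  qdim setT V = (qdim setT (idsum V a) + qdim setT (colon V a))%N.
Proof.
move=> VI fd; have VS := ideal_subspace VI.
have CS : subspace (colon V a) by apply/ideal_subspace/ideal_colon.
have AS : subspace (idsum V a) by apply/ideal_subspace/ideal_idsum.
have fC : findim setT (colon V a).
  by apply: findimS fd => //; apply: colon_sub.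
rewrite (@qdim_add _ _ setT V (idsum V a)) //; last exact: idsum_sub.
congr addn; rewrite idsumE qdim_sumsp //.
  exact: (qdim_image (@mulr_linear a) VS fC).
exact: (findim_image (@mulr_linear a) fC).
Qed.

End QuotientColon.

Lemma supremum_max (A : set nat) m :
  A m -> (forall n, A n -> (n <= m)%N) -> supremum 0%N A = m.
Proof.
move=> Am Amax; rewrite /supremum ifF; last by apply/negP => /eqP A0; move: Am; rewrite A0.
apply: xget_subset1; last exact: is_subset1_supremums.
split=> [n An|n ubn]; first by rewrite leEnat; apply: Amax.
exact: ubn.
Qed.

Lemma expn_leq_exponent a b K :
  (forall m, (0 < m)%N -> (m ^ a <= K * m ^ b)%N) -> (a <= b)%N.
Proof.
move=> h; rewrite leqNgt; apply/negP => ba.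
(* At m = K+1 one extra factor m already exceeds the constant K. *)
have := h K.+1 isT; rewrite leqNgt => /negP; apply.
apply: (@leq_trans (K.+1 ^ b.+1)%N); last by rewrite leq_pexp2l.
by rewrite expnS ltn_pmul2r // expn_gt0.
Qed.

(** A discrete integral of x^d: the increment (m+1)^(d+1) - m^(d+1) is a sum of d+1 terms, each at
    most (m+1)^d. *)
Lemma expn_sum_bound d m : (m ^ d.+1 <= d.+1 * \sum_(i < m) i.+1 ^ d)%N.
Proof.
elim: m => [|m IH]; first by rewrite exp0n.
rewrite big_ord_recr /= mulnDr -leq_subLR.
apply: leq_trans (_ : m.+1 ^ d.+1 - m ^ d.+1 <= _)%N; first by rewrite leq_sub2l.
rewrite subn_exp subSnn mul1n -[X in (X * _)%N]card_ord -sum_nat_const.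
apply: leq_sum => i _; rewrite /= -[X in (_ <= m.+1 ^ X)%N](@subnK i d); last by rewrite -ltnS.
by rewrite expnD leq_mul //; case: (nat_of_ord i) => // e; rewrite leq_exp2r.
Qed.

Section Growth.
Variables (k : fieldType) (R : comAlgType k) (G : nat -> set R).
Hypothesis HG : standard_graded G.
Implicit Types (J P : set R).

Local Notation comp := (comp G).
Local Notation cutoff := (cutoff G).
Local Notation hom := (hom G).

(** For homogeneous [J] this is dim R/(J + R_(>=m)), the sum of the first [m] values of the Hilbert
    function of R/J. The bounds below start at m = 1 because [hil J 0] is 0 while 0^0 = 1. *)
Definition hil J m := qdim setT (cutoff J m).
Definition upper d J := exists C, forall m, (0 < m)%N -> (hil J m <= C * m ^ d)%N.
Definition lower d J := exists c, forall m, (0 < m)%N -> (m ^ d <= c * hil J m)%N.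
Definition hprime P := hom P /\ is_prime_ideal P.

Lemma findim_cutoff J m : hom J -> findim setT (cutoff J m).
Proof. by move=> JH; exact: (findim_sub_ge HG setT (subspace_cutoff HG m JH) (ge_cutoff JH)). Qed.

Lemma hil0 J : hil J 0 = 0%N.
Proof. by rewrite /hil cutoff0; apply: qdim_sub0. Qed.

Lemma hil_gt0 J m : hom J -> ~ J 1 -> (0 < m)%N -> (0 < hil J m)%N.
Proof.
move=> JH J1 m0; rewrite lt0n; apply/eqP => h0; apply: J1.
apply: (cutoff_homog HG (G1_one HG) m0).
exact: (qdim0_sub (subspace_cutoff HG m JH) (findim_cutoff m JH) h0).
Qed.

Lemma hilS J J' m : hom J -> hom J' -> J `<=` J' -> (hil J' m <= hil J m)%N.
Proof.
move=> JH JH' JJ; apply: qdimS => //; try exact: subspace_cutoff; last exact: findim_cutoff.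
exact: cutoffS.
Qed.

Lemma hil_leq J m n : hom J -> (m <= n)%N -> (hil J m <= hil J n)%N.
Proof.
move=> JH mn; apply: qdimS => //; try exact: subspace_cutoff; last exact: findim_cutoff.
exact: cutoff_leq.
Qed.

Lemma cutoff_split J m u : hom J -> cutoff J m u -> cutoff J m.+1 (u - comp u m).
Proof.
move=> JH tu i im; rewrite (compB HG) (comp_homog HG _ (compG HG u m)).
case: eqP => [->|/eqP im']; first by rewrite subrr; apply: ideal0; apply: hom_ideal JH.
by rewrite subr0; apply: tu; rewrite ltn_neqAle im'.
Qed.

Lemma cutoff_comp J m u : hom J -> cutoff J m (comp u m).
Proof. by move=> JH; apply: ge_cutoff => //; apply: (G_ge HG (compG HG u m)). Qed.

Lemma lead_mul J m n u v : hom J -> cutoff J m u -> cutoff J n v ->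
  cutoff J (m + n).+1 (u * v) -> J (comp u m * comp v n).
Proof.
move=> JH tu tv tuv.
have GG : G (m + n)%N (comp u m * comp v n) by apply: (graded_mul HG); apply: compG.
apply: (cutoff_homog HG GG (leqnn _)).
have TI := ideal_cutoff HG (m + n).+1 JH.
have -> : comp u m * comp v n =
    u * v - (comp u m * (v - comp v n) + (u - comp u m) * v).
  by rewrite mulrBr mulrBl [X in _ - X]addrC addrA subrK opprB addrCA subrr addr0.
apply: (idealB TI) => //; apply: (idealD TI).
  by rewrite -addnS; apply: cutoff_mul => //; [exact: cutoff_comp|exact: cutoff_split].
by rewrite -addSn; apply: cutoff_mul => //; exact: cutoff_split.
Qed.

Lemma cutoff_lead J m u : ~ cutoff J m.+1 u -> cutoff J m u -> ~ J (comp u m).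
Proof.
move=> ntu tu Ju; apply: ntu => i; rewrite ltnS leq_eqVlt => /orP[/eqP->//|].
exact: tu.
Qed.

(** If [u] and [v] lie outside [P], their lowest components outside [P] multiply, modulo [P], to a
    component of [u * v]; this reduces primality to homogeneous elements. *)
Lemma hprimeP P : hom P -> ~ P 1 ->
  (forall s t a b, G s a -> G t b -> P (a * b) -> P a \/ P b) -> hprime P.
Proof.
move=> PH P1 PP; split=> //; apply/is_primeP; split=> // [|u v Puv]; first exact: hom_ideal PH.
apply: contrapT => /not_orP[/(cutoff_order HG PH)[m [tu ntu]] /(cutoff_order HG PH)[n [tv ntv]]].
have := lead_mul PH tu tv (@cutoff_sub _ _ _ _ (m + n).+1 PH _ Puv).
case/(PP _ _ _ _ (compG HG u m) (compG HG v n)); exact: cutoff_lead.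
Qed.

Lemma not_hprime J : hom J -> ~ J 1 -> ~ hprime J ->
  exists s t a b, [/\ G s a, G t b, ~ J a, ~ J b & J (a * b)].
Proof.
move=> JH J1 nJ; apply: contrapT => h; apply: nJ; apply: hprimeP => // s t a b Ga Gb Jab.
apply: contrapT => /not_orP[Ja Jb]; apply: h; by exists s, t, a, b.
Qed.

(** The lowest component of [c] is a nonzerodivisor modulo [P], so multiplication by [c],
    homogeneous or not, raises orders modulo [P] by exactly [a]. *)
Lemma colon_cutoff P a m c : hprime P -> cutoff P a c -> ~ cutoff P a.+1 c ->
  colon (cutoff P (a + m)) c = cutoff P m.
Proof.
move=> [PH /is_primeP[PI P1 PP]] tc ntc; apply/seteqP; split=> x; last first.
  by move=> tx; apply: cutoff_mul.
rewrite /colon /= => tcx.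
suff : forall n, (n <= m)%N -> cutoff P n x by apply.
elim=> [|n IH] nm; first by rewrite cutoff0.
apply: contrapT => ntx.
have tx := IH (ltnW nm).
have tcx' : cutoff P (a + n).+1 (c * x) by apply: cutoff_leq tcx; rewrite -addnS leq_add2l.
have /PP[] := lead_mul PH tc tx tcx'; exact: cutoff_lead.
Qed.

Lemma hil_prime_quot P a m c : hprime P -> cutoff P a c -> ~ cutoff P a.+1 c ->
  (qdim setT (idsum (cutoff P (a + m)) c) + hil P m)%N = hil P (a + m).
Proof.
move=> PP tc ntc; have [PH _] := PP.
rewrite /hil -(colon_cutoff m PP tc ntc); apply/esym/qdim_colon; last exact: findim_cutoff.
exact: ideal_cutoff.
Qed.

Lemma hil_idsum J s a m : G s a -> hom J ->
  qdim setT (idsum (cutoff J m) a) = hil (idsum J a) m.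
Proof. by move=> Ga JH; rewrite /hil (cutoff_idsum HG m Ga JH). Qed.

(** The colon of J + R_(>=m) by [a] is the cutoff of J:a in degree m-s; ignoring the shift only
    enlarges the bound. *)
Lemma hil_nonprime J s a m : G s a -> hom J ->
  (hil J m <= hil (idsum J a) m + hil (colon J a) m)%N.
Proof.
move=> Ga JH; have cH := hom_colon HG Ga JH.
rewrite {1}/hil (qdim_colon a) ?(hil_idsum _ Ga JH) ?leq_add2l; last 2 first.
- exact: ideal_cutoff.
- exact: findim_cutoff.
apply: qdimS => //; try exact: subspace_cutoff; last exact: findim_cutoff.
  by apply/ideal_subspace/ideal_colon/ideal_cutoff.
move=> x tx i im; have [is_|si] := ltnP i s.
  by rewrite (comp_mul0 HG _ Ga) //; apply: ideal0; apply: hom_ideal JH.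
by rewrite -(subnKC si) (comp_mul HG _ _ Ga); apply: tx; apply: leq_ltn_trans im; apply: leq_subr.
Qed.

Lemma hil_colon J s a m : G s a -> hom J -> (hil (colon J a) m <= hil J (s + m))%N.
Proof.
move=> Ga JH; have cH := hom_colon HG Ga JH.
have TI := ideal_cutoff HG (s + m) JH.
have -> : hil J (s + m) = (qdim setT (idsum (cutoff J (s + m)) a) +
    qdim setT (colon (cutoff J (s + m)) a))%N.
  by apply: (qdim_colon a TI); exact: findim_cutoff.
apply: leq_trans (leq_addl _ _).
have CS : subspace (colon (cutoff J (s + m)) a) by apply/ideal_subspace/ideal_colon.
apply: qdimS => //; first exact: subspace_cutoff.
  move=> x tx i im; rewrite /colon /= -(comp_mul HG x i Ga).
  by apply: tx; rewrite ltn_add2l.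
apply: findimS (findim_cutoff (s + m) JH) => //; first exact: subspace_cutoff.
exact: (colon_sub a TI).
Qed.

Lemma upper_leq d d' J : (d <= d')%N -> upper d J -> upper d' J.
Proof.
move=> dd [C h]; exists C => m m0; apply: leq_trans (h m m0) _.
by rewrite leq_mul2l leq_pexp2l ?orbT.
Qed.

Lemma upperS d J J' : hom J -> hom J' -> J `<=` J' -> upper d J -> upper d J'.
Proof.
move=> JH JH' JJ [C h]; exists C => m m0; apply: leq_trans (h m m0); exact: hilS.
Qed.

Lemma lowerS d J J' : hom J -> hom J' -> J `<=` J' -> lower d J' -> lower d J.
Proof.
move=> JH JH' JJ [c h]; exists c => m m0; apply: leq_trans (h m m0) _.
by rewrite leq_mul2l hilS // orbT.
Qed.

Lemma upper_lower d e J : upper d J -> lower e J -> (e <= d)%N.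
Proof.
move=> [C hC] [c hc]; apply: (@expn_leq_exponent _ _ (c * C)) => m m0.
by apply: leq_trans (hc m m0) _; rewrite -mulnA leq_mul2l hC // orbT.
Qed.

Lemma upper_nonprime d J s a : G s a -> hom J ->
  upper d (idsum J a) -> upper d (colon J a) -> upper d J.
Proof.
move=> Ga JH [C hC] [D hD]; exists (C + D)%N => m m0.
apply: leq_trans (hil_nonprime m Ga JH) _.
by rewrite mulnDl leq_add ?hC ?hD.
Qed.

Lemma lower_colon d J s a : G s a -> hom J -> ~ J 1 -> lower d (colon J a) -> lower d J.
Proof.
(* For m > 2s, replacing m by m-s costs at most a factor 2, hence 2^d. For m <= 2s the constant
   (2s)^d suffices, because [J] is proper and [hil J m] is positive. *)
move=> Ga JH J1 [c hc]; exists (2 ^ d * c + (2 * s) ^ d)%N => m m0.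
have [ms|sm] := leqP m (2 * s)%N.
  apply: (@leq_trans ((2 * s) ^ d)%N).
    by case: (d) => // d'; rewrite leq_exp2r.
  rewrite mulnDl; apply: leq_trans (leq_addl _ _).
  by rewrite leq_pmulr // hil_gt0.
rewrite mulnDl; apply: leq_trans (leq_addr _ _).
have h : (m <= 2 * (m - s))%N by lia.
apply: (@leq_trans ((2 * (m - s)) ^ d)%N).
  by case: (d) => // d'; rewrite leq_exp2r.
rewrite expnMn -mulnA leq_mul2l; apply/orP; right.
apply: leq_trans (hc _ _) _; first by lia.
rewrite leq_mul2l; apply/orP; right.
by apply: leq_trans (hil_colon (m - s) Ga JH) _; rewrite subnKC //; lia.
Qed.

Definition hchain l J := exists P : nat -> set R,
  [/\ forall i, (i <= l)%N -> hprime (P i),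
      forall i, (i < l)%N -> P i `<` P i.+1 & J `<=` P 0%N].

(** All four conditions are carried through one noetherian induction. The chain bounds the Krull
    dimension from below; the last prime serves later as a component of top dimension. *)
Definition growth d J := [/\ lower d J, upper d J, hchain d J &
  exists P, [/\ hprime P, J `<=` P & lower d P]].

Lemma hchainS l J J' : J `<=` J' -> hchain l J' -> hchain l J.
Proof.
move=> JJ [P [h1 h2 h3]]; exists P; split=> //; exact: subset_trans h3.
Qed.

Lemma hil_prime_step P x m : hprime P -> G 1%N x -> ~ P x ->
  hil P m.+1 = (hil (idsum P x) m.+1 + hil P m)%N.
Proof.
move=> PP Gx nPx; have [PH _] := PP.
have tx : cutoff P 1 x by apply: ge_cutoff => //; apply: (G_ge HG Gx).
have ntx : ~ cutoff P 2 x by move=> h; apply: nPx; exact: (cutoff_homog HG Gx _ h).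
by rewrite -(hil_idsum _ Gx PH) -[in RHS]add1n (hil_prime_quot m PP tx ntx) add1n.
Qed.

Lemma hil_prime_sum P x m : hprime P -> G 1%N x -> ~ P x ->
  hil P m = (\sum_(i < m) hil (idsum P x) i.+1)%N.
Proof.
move=> PP Gx nPx; elim: m => [|m IH]; first by rewrite hil0 big_ord0.
by rewrite (hil_prime_step m PP Gx nPx) big_ord_recr /= IH addnC.
Qed.

Lemma idsum_not1 J s a : G s.+1 a -> hom J -> ~ J 1 -> ~ idsum J a 1.
Proof.
move=> Ga [JI JH] J1 [j [r [Jj e]]]; apply: J1.
have := comp_homog HG 0 (G1_one HG); rewrite eqxx => <-.
by rewrite e (compD HG) (comp_mul0 HG _ Ga) // addr0; apply: JH.
Qed.

(** The linear form [x] is a nonzerodivisor modulo [P], so [hil P] is the sum of the values of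
    [hil (idsum P x)] and its exponent is one larger; [P] itself goes below the chain. *)
Lemma growth_prime_quot P x d : hprime P -> G 1%N x -> ~ P x ->
  growth d (idsum P x) -> growth d.+1 P.
Proof.
move=> PP Gx nPx [[c hc] [C hC] hch _]; have [PH _] := PP.
have low : lower d.+1 P.
  exists (d.+1 * c)%N => m m0; apply: leq_trans (expn_sum_bound d m) _.
  rewrite -mulnA; apply: leq_mul => //.
  rewrite (hil_prime_sum m PP Gx nPx) big_distrr /=.
  by apply: leq_sum => i _; apply: hc.
split=> //.
- exists C => m m0; rewrite (hil_prime_sum m PP Gx nPx) expnS mulnCA.
  rewrite -[X in (_ <= X * _)%N]card_ord -sum_nat_const; apply: leq_sum => i _.
  apply: leq_trans (hC _ _) _ => //; rewrite leq_mul2l; apply/orP; right.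
  by case: (d) => // d'; rewrite leq_exp2r.
- case: hch => Q [h1 h2 h3]; exists (fun i => if i is j.+1 then Q j else P).
  split=> [[|i]|[|i]|] //; [exact: h1| |exact: h2].
  move=> _; apply: properset_subset_trans _ h3.
  by apply: idsum_proper => //; case: PH.
- by exists P; split=> // x.
Qed.

Lemma growth_irrelevant P : hprime P -> ge G 1 `<=` P -> growth 0 P.
Proof.
move=> PP gP; have [PH /is_primeP[PI P1 _]] := PP.
have low : lower 0 P by exists 1%N => m m0; rewrite expn0 mul1n; apply: hil_gt0.
split=> //; last by exists P; split=> // x.
  exists (qdim setT (ge G 1)) => m m0; rewrite expn0 muln1.
  apply: qdimS => //; [exact: subspace_ge|exact: subspace_cutoff| |exact: findim_ge].
  exact: subset_trans gP (@cutoff_sub _ _ _ _ m PH).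
by exists (fun=> P); split=> // x.
Qed.

Lemma prime_irrelevant_or P : hprime P ->
  ge G 1 `<=` P \/ exists x, G 1%N x /\ ~ P x.
Proof.
move=> [PH /is_primeP[PI P1 _]]; have [r [x gx]] := generators_exist HG.
have [h|] := pselect (forall i, P (x i)).
  left; have := @ge_pigeonhole _ _ _ HG _ _ gx P 1 PI; rewrite muln0; apply.
  by move=> j; rewrite expr1.
by move=> /existsNP[i nPx]; right; exists (x i); split=> //; apply: gx.1.
Qed.

Lemma growth_exists : noetherian R -> forall J, hom J -> ~ J 1 -> exists d, growth d J.
Proof.
move=> RN J JH; move: (JH); have := hom_ideal JH; move: J {JH}.
apply: (noetherian_ind RN) => J JI IH JH J1.
have [PP|nP] := pselect (hprime J).
  have [gP|[x [Gx nJx]]] := prime_irrelevant_or PP.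
    by exists 0%N; apply: growth_irrelevant.
  have [d hd] : exists d, growth d (idsum J x).
    apply: IH; [exact: ideal_idsum|exact: idsum_proper|exact: (hom_idsum HG Gx)|].
    exact: (@idsum_not1 J 0 x).
  by exists d.+1; apply: growth_prime_quot hd.
(* Both J+(a) and J:a are strictly larger than [J], the latter because it contains [b]. The exponent
   of [J] is the larger of theirs, and chain and prime are inherited from that ideal. *)
have [s [t [a [b [Ga Gb nJa nJb Jab]]]]] := not_hprime JH J1 nP.
have cH := hom_colon HG Ga JH; have aH := hom_idsum HG Ga JH.
have [d2 [l2 u2 h2 [P2 [P2P JP2 lP2]]]] : exists d, growth d (colon J a).
  apply: IH => //; first exact: hom_ideal cH.
    by split=> [|h]; [exact: colon_sub|apply: nJb; exact: h].
  by rewrite /colon /= mulr1.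
have Jc : J `<=` colon J a by exact: colon_sub.
have Ja : J `<=` idsum J a by exact: idsum_sub.
have l2J := lower_colon Ga JH J1 l2.
have h2J := hchainS Jc h2.
have P2J : J `<=` P2 by exact: subset_trans JP2.
have [a1|a1] := pselect (idsum J a 1).
  exists d2; split=> //; last by exists P2.
  apply: (upper_nonprime Ga JH) => //; exists 0%N => m m0.
  rewrite /hil qdim_sub0 //; first exact: subspace_cutoff.
  by rewrite (ideal1 _ a1) //; exact: hom_ideal aH.
have [d1 [l1 u1 h1 [P1 [P1P JP1 lP1]]]] : exists d, growth d (idsum J a).
  by apply: IH => //; [exact: hom_ideal aH|exact: idsum_proper].
have l1J := lowerS JH aH Ja l1.
have h1J := hchainS Ja h1.
have P1J : J `<=` P1 by exact: subset_trans JP1.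
have [d12|d21] := leqP d1 d2.
  exists d2; split=> //; last by exists P2.
  by apply: (upper_nonprime Ga JH) => //; apply: upper_leq u1.
exists d1; split=> //; last by exists P1.
by apply: (upper_nonprime Ga JH) => //; apply: upper_leq u2; apply: ltnW.
Qed.

(** * Chains of arbitrary primes, via the increasing filtration by degree *)

Definition fil n : set R := [set x | forall i, (n <= i)%N -> comp x i = 0].

Lemma subspace_fil n : subspace (fil n).
Proof.
split=> [i _|a x y fx fy i ni]; first exact: comp0.
by rewrite (comp_lin HG) fx // fy // scaler0 addr0.
Qed.

Lemma fil_exists x : exists n, fil n x.
Proof. by have [_ [N [cN _]]] := compP HG x; exists N. Qed.

Lemma fil_sum n x : fil n x -> x = \sum_(i < n) comp x i.
Proof.
move=> fx; have [N xE] := comp_sum HG x.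
by rewrite {1}(xE (maxn N n) (leq_maxl _ _)) -(sum_widen fx) // leq_maxr.
Qed.

Lemma fil_mul m n x y : fil m x -> fil n y -> fil (m + n) (x * y).
Proof.
move=> /fil_sum-> /fil_sum->; rewrite mulr_suml; apply: subspace_sum => [|i _]; first exact: subspace_fil.
rewrite mulr_sumr; apply: subspace_sum => [|j _]; first exact: subspace_fil.
move=> l mnl; have GG := graded_mul HG (compG HG x i) (compG HG y j).
rewrite (comp_homog HG _ GG); case: eqP => // le.
by move: mnl; rewrite le leqNgt -addSn leq_add // ltnW.
Qed.

Lemma fil_leq m n : (m <= n)%N -> fil m `<=` fil n.
Proof. by move=> mn x fx i ni; apply: fx; apply: leq_trans ni. Qed.

Lemma fil_ge n x : fil n x -> ge G n x -> x = 0.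
Proof.
by move=> fx gx; rewrite (fil_sum fx) big1 // => i _; apply: gx.
Qed.

(** Modulo [P'], which contains [x], only the terms with i = 0 of a relation survive, so their
    coefficients vanish. The rest is divisible by [x], which cancels modulo the prime [P]. *)
Lemma prime_powers_free P P' x (I : finType) (b : I -> R) n (l : nat -> I -> k) :
  is_prime_ideal P -> P `<=` P' -> is_ideal P' -> ~ P x -> P' x -> free_mod P' b ->
  P (\sum_(i < n) x ^+ i * \sum_j l i j *: b j) ->
  forall i j, (i < n)%N -> l i j = 0.
Proof.
move=> /is_primeP[PI P1 PP] PP' PI' nPx Px' fb.
elim: n l => [|n IH] l Ps i j //.
move: Ps; rewrite big_ord_recl expr0 mul1r.
rewrite [X in _ + X](_ : _ = x * \sum_(i < n) x ^+ i * \sum_j l i.+1 j *: b j); last first.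
  by rewrite mulr_sumr; apply: eq_bigr => t _; rewrite mulrA -exprS.
move=> Ps.
have l0 : forall j, l 0%N j = 0.
  apply: fb; rewrite -[X in P' X](addrK (x * \sum_(i < n) x ^+ i * (\sum_j l i.+1 j *: b j))).
  by apply: idealB => //; [apply: PP'|apply: idealMr].
case: i => [|i] // ; rewrite ltnS => i_n.
apply: (IH (fun i => l i.+1)) => //.
move: Ps; rewrite big1 => [|t _]; last by rewrite l0 scale0r.
by rewrite add0r => /PP[].
Qed.

(** Pick an element of each [P i.+1] outside [P i]. The products of their powers with exponents
    below [m] are m^l elements, independent modulo [P 0] and of degree linear in [m]. *)
Lemma chain_free (P : nat -> set R) l :
  (forall i, (i <= l)%N -> is_prime_ideal (P i)) ->
  (forall i, (i < l)%N -> P i `<` P i.+1) ->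
  exists K, forall m, (0 < m)%N -> exists (I : finType) (b : I -> R),
    [/\ #|I| = (m ^ l)%N, forall i, fil (K * m) (b i) & free_mod (P 0%N) b].
Proof.
elim: l P => [|l IH] P Pp Pi.
  exists 1%N => m m0; exists unit, (fun=> 1); rewrite card_unit; split=> // [_ i|c].
    by rewrite mul1n => mi; rewrite (comp_homog HG _ (G1_one HG)); case: i mi; case: m m0.
  have /is_primeP[PI P1 _] := Pp 0%N isT.
  have -> : \sum_i c i *: (1 : R) = (c tt)%:A.
    by rewrite (bigD1 tt) //= big1 ?addr0 // => -[].
  move=> Pc []; apply: contrapT => /eqP c0; apply: P1.
  rewrite -(scale1r 1) -(mulVf c0) -scalerA.
  by apply: subspaceZ Pc; apply: ideal_subspace.
have [K hK] := IH (fun i => P i.+1) (fun i => Pp i.+1) (fun i => Pi i.+1).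
have [P01 /nonsubset[x [P1x nP0x]]] := Pi 0%N isT.
have [A fx] := fil_exists x.
have fxn n : fil (A * n).+1 (x ^+ n).
  elim: n => [|n IHn].
    by move=> i; rewrite muln0 expr0 (comp_homog HG _ (G1_one HG)); case: i.
  by rewrite exprS mulnS -addnS; apply: fil_mul.
(* A power of [x] with exponent i < m has degree at most A i, which raises the slope from [K] to at
   most K+A+1. *)
exists (K + A.+1)%N => m m0; have [I [b [cI fb frb]]] := hK m m0.
have /is_primeP[P1I _ _] := Pp 1%N isT.
exists ('I_m * I)%type, (fun s : 'I_m * I => x ^+ s.1 * b s.2).
rewrite card_prod card_ord cI expnS; split=> // [[i j]|c] /=.
  apply: (@fil_leq ((A * i).+1 + K * m)); last exact: fil_mul.
  by have := ltn_ord i; nia.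
case: m m0 cI c fb => // m _ cI c fb Pc [i j].
pose l' (i : nat) (j : I) := c (inord i, j).
have -> : c (i, j) = l' i j by rewrite /l' inord_val.
apply: (@prime_powers_free (P 0%N) (P 1%N) x I b m.+1) => //; first exact: Pp.
move: Pc; congr (P 0%N _).
transitivity (\sum_(i < m.+1) \sum_j c (i, j) *: (x ^+ i * b j)).
  by rewrite pair_bigA; apply: eq_bigr => -[].
apply: eq_bigr => i' _; rewrite mulr_sumr; apply: eq_bigr => j' _.
by rewrite /l' inord_val scalerAr.
Qed.

(** An element of degree below Km that lies in R_(>=Km) is zero, so the family of [chain_free] stays
    independent in R/R_(>=Km). *)
Lemma prime_chain_lower (P : nat -> set R) l :
  (forall i, (i <= l)%N -> is_prime_ideal (P i)) ->
  (forall i, (i < l)%N -> P i `<` P i.+1) ->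
  exists K, forall m, (0 < m)%N -> (m ^ l <= hil [set 0%R] (K * m))%N.
Proof.
move=> Pp Pi; have [K hK] := chain_free Pp Pi; exists K => m m0.
have [I [b [<- fb frb]]] := hK m m0.
have /is_primeP[PI _ _] := Pp 0%N isT.
have H0 := hom0 HG.
apply: (free_qdim (c := b) (subspace_cutoff HG _ H0) (findim_cutoff _ H0)) => // c tc.
apply: frb; rewrite (_ : \sum_i c i *: b i = 0); first exact: ideal0.
apply: (@fil_ge (K * m)) => //.
by apply: subspace_sum => [|i _]; [exact: subspace_fil|apply: subspaceZ (fb i); exact: subspace_fil].
Qed.

Lemma krull_dimE d : growth d [set 0%R] -> krull_dim R = d.
Proof.
move=> [_ [C hC] [P [h1 h2 _]] _]; apply: supremum_max.
  by exists P; split=> // i il; have [] := h1 i il.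
move=> l [Q [Qp Qi]]; have [K hK] := prime_chain_lower Qp Qi.
apply: (@expn_leq_exponent _ _ (C * K ^ d)) => m m0.
apply: leq_trans (hK m m0) _; case: K hK => [|K] hK.
  by rewrite mul0n hil0.
by apply: leq_trans (hC _ _) _; rewrite ?muln_gt0 // expnMn mulnA.
Qed.

Lemma krull_dim_growth : noetherian R -> growth (krull_dim R) [set 0%R].
Proof.
move=> RN; have [|d hd] := growth_exists RN (hom0 HG); last by rewrite (krull_dimE hd).
by move=> /= /eqP; rewrite oner_eq0.
Qed.

End Growth.

(** * Length as dimension *)

Section Colength.
Variables (k : fieldType) (R : comAlgType k) (G : nat -> set R).
Hypothesis HG : standard_graded G.

Lemma sub_comp0_ge (r : R) : ge G 1 (r - comp G r 0).
Proof.
move=> [|i] // _; rewrite (compB HG) (comp_homog HG _ (compG HG r 0)) /=.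
by rewrite subrr.
Qed.

Lemma chain_length_le (J : set R) l : findim setT J ->
  quotient_chain_lengths J l -> (l <= qdim setT J)%N.
Proof.
move=> fJ [F [F0 Fl FI FS]].
have Fsub i : (i <= l)%N -> J `<=` F i.
  elim: i => [|i IH] il; first by rewrite F0.
  by apply: subset_trans (IH (ltnW il)) _; have [] := FS i il.
have SF i : (i <= l)%N -> subspace (F i) by move=> il; apply/ideal_subspace/FI.
have fF i : (i <= l)%N -> findim setT (F i).
  by move=> il; apply: findimS fJ; rewrite -?F0 //; [exact: SF|exact: SF|rewrite F0; exact: Fsub].
suff h i : (i <= l)%N -> (qdim setT (F i) + i <= qdim setT J)%N.
  by apply: leq_trans (h l (leqnn l)); apply: leq_addl.
elim: i => [|i IH] il; first by rewrite F0 addn0.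
apply: leq_trans (IH (ltnW il)); have [Fii nFii] := FS i il.
rewrite (@qdim_add _ _ setT (F i) (F i.+1)) //; [|exact: SF (ltnW il)|exact: SF|exact: fF (ltnW il)].
have fii : findim (F i.+1) (F i).
  by apply: findimS (fF _ (ltnW il)) => //; exact: SF (ltnW il).
have q0 : qdim (F i.+1) (F i) != 0%N.
  by apply/eqP => q0; apply: nFii; apply: (qdim0_sub (SF _ (ltnW il)) fii q0).
by lia.
Qed.

Lemma socle_element (J : set R) N : is_ideal J -> ge G N `<=` J -> ~ J 1 ->
  exists x, ~ J x /\ forall y, ge G 1 y -> J (x * y).
Proof.
move=> JI gJ nJ1.
have [m [nm gm]] : exists m, ~ (ge G m `<=` J) /\ ge G m.+1 `<=` J.
  elim: N gJ => [|N IH] gJ; first by case: nJ1; apply: gJ; rewrite ge0.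
  by have [/IH//|h] := pselect (ge G N `<=` J); exists N.
have [x [gx nJx]] := nonsubset nm.
by exists x; split=> // y gy; apply: gm; rewrite -addn1; apply: (ge_mul HG).
Qed.

(** A socle element [x] enlarges [J] by exactly one dimension: R_0 = k, and R_(>=1) multiplies [x]
    into [J]. Repeating this gives a chain as long as the dimension. *)
Lemma qdim_chain_length (J : set R) N : is_ideal J -> ge G N `<=` J ->
  quotient_chain_lengths J (qdim setT J).
Proof.
move=> JI gJ; move q: (qdim setT J) => l.
elim: l => [|l IH] in J JI gJ q *; have JS := ideal_subspace JI;
  have fJ := findim_sub_ge HG setT JS gJ.
  exists (fun=> J); split=> //; apply/seteqP; split=> //.
  exact: (qdim0_sub JS fJ q).
have nJ1 : ~ J 1.
  by move/(ideal1 JI) => JT; move: q; rewrite qdim_sub0 // JT.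
have [x [nJx xJ]] := socle_element JI gJ nJ1.
have J'I := ideal_idsum x JI; have J'S := ideal_subspace J'I.
have q1 : qdim (idsum J x) J = 1%N.
  rewrite -[RHS](card_ord 1); apply: (basis_qdim (b := fun=> x) JS); split=> [_|c|].
  - exact: idsum_gen.
  - rewrite big_ord1 => Jcx i; rewrite (ord1 i); apply: contrapT => /eqP c0; apply: nJx.
    by rewrite -[x]scale1r -(mulVf c0) -scalerA; apply: subspaceZ.
  - move=> _ [j [r [Jj ->]]].
    have : G 0%N (comp G r 0) by exact: compG.
    rewrite (graded_zero HG) => -[a _ ra].
    exists (fun=> a); rewrite big_ord1.
    have -> : j + x * r - a *: x = j + x * (r - comp G r 0).
      by rewrite -ra mulrBr mulr_algr addrA.
    by apply: idealD => //; apply: xJ; apply: sub_comp0_ge.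
have q' : qdim setT (idsum J x) = l.
  move: q; rewrite (@qdim_add _ _ setT J (idsum J x)) // ?q1 ?addn1; first by case.
  exact: idsum_sub.
have [F [F0 Fl FI FS]] := IH _ J'I (subset_trans gJ (@idsum_sub _ J x)) q'.
exists (fun i => if i is j.+1 then F j else J); split=> // [[|i]|[|i]] //.
- exact: FI.
- by move=> _; rewrite F0; apply: idsum_proper.
- exact: FS.
Qed.

Lemma colengthE (J : set R) N : is_ideal J -> ge G N `<=` J ->
  colength J = qdim setT J.
Proof.
move=> JI gJ; apply: supremum_max; first exact: qdim_chain_length gJ.
move=> l; apply: chain_length_le.
exact: (findim_sub_ge HG setT (ideal_subspace JI) gJ).
Qed.

Lemma finite_colength_ge (J : set R) : hom G J -> finite_colength J ->
  exists N, ge G N `<=` J.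
Proof.
move=> JH [u ubu]; apply: contrapT => /forallNP nN.
have JI := hom_ideal JH.
(* If two consecutive cutoffs agree, all [x j ^+ m] lie in [J], and the pigeonhole bound puts some
   R_(>=N) inside [J]. *)
have step m : cutoff G J m.+1 `<` cutoff G J m.
  split=> [|h]; first exact: cutoff_leq.
  have [r [x gx]] := generators_exist HG.
  apply: (nN (r * m.-1).+1); apply: (ge_pigeonhole HG gx JI) => j.
  have Gx := G_exp HG m (gx.1 j).
  apply: (cutoff_homog HG Gx (leqnn _)); apply: h.
  by apply: ge_cutoff => //; apply: (G_ge HG Gx).
suff /ubu : quotient_chain_lengths J u.+1 by rewrite leEnat ltnn.
(* [J], then its cutoffs in degrees u, u-1, ..., 0: one step more than the assumed bound [u]. *)
exists (fun i => if i is j.+1 then cutoff G J (u - j) else J); split=> //.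
- by rewrite subnn cutoff0.
- by case=> [|i] _ //; apply: ideal_cutoff.
- case=> [|i]; rewrite ltnS => iu; last first.
    have -> : (u - i = (u - i.+1).+1)%N by rewrite subnSK.
    exact: step.
  apply: subset_properset_trans (step _).
  by rewrite -subSn // subn0; apply: cutoff_sub.
Qed.

End Colength.

(** * Ideals of small dimension *)

Lemma sum_option (V : nmodType) (I : finType) (f : option I -> V) :
  \sum_o f o = f None + \sum_i f (Some i).
Proof.
rewrite (bigD1 None) //=; congr (_ + _).
rewrite (reindex_omap Some id) => [|[]//].
by apply: eq_bigl => i /=; rewrite eqxx.
Qed.

Section Dimension.
Variables (k : fieldType) (R : comAlgType k) (G : nat -> set R).
Hypothesis HG : standard_graded G.
Hypothesis RN : noetherian R.
Variable d : nat.
Hypothesis R_upper : upper G d.+1 [set 0].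
Implicit Types J P : set R.

Local Notation hom := (hom G).
Local Notation hprime := (hprime G).
Local Notation upper := (upper G).
Local Notation lower := (lower G).
Local Notation cutoff := (cutoff G).
Local Notation hil := (hil G).

Lemma hom_upper J : hom J -> upper d.+1 J.
Proof.
move=> JH; apply: (upperS HG (hom0 HG) JH) R_upper => x ->.
by apply: ideal0; case: JH.
Qed.

(** Consecutive values differ by a value of [hil (idsum P x)], whose exponent is at most [d]. The
    second alternative covers the irrelevant prime, where [hil P] is bounded. *)
Lemma hil_prime_growth P : hprime P ->
  exists C, forall m a, (hil P (m + a) <= hil P m + a * (C * (m + a) ^ d))%N \/ (hil P (m + a) <= C)%N.
Proof.
move=> PP; have [PH _] := PP.
have [gP|[x [Gx nPx]]] := prime_irrelevant_or HG PP.
  have [_ [C hC] _ _] := growth_irrelevant HG PP gP.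
  exists C => m a; right; case: (m + a)%N => [|n]; first by rewrite hil0.
  by have := hC n.+1 isT; rewrite expn0 muln1.
have P1 : ~ idsum P x 1.
  by apply: (idsum_not1 HG Gx PH); have [_ /is_primeP[]] := PP.
have [e ge] := growth_exists HG RN (hom_idsum HG Gx PH) P1.
have [le _ _ _] := growth_prime_quot HG PP Gx nPx ge.
have ed : (e <= d)%N by have := upper_lower (hom_upper PH) le.
have [_ ue _ _] := ge; have [C hC] := upper_leq ed ue.
exists C => m a; left; elim: a => [|a IH]; first by rewrite addn0 mul0n addn0.
rewrite addnS (hil_prime_step HG _ PP Gx nPx).
rewrite mulSn addnCA leq_add ?hC //; apply: leq_trans IH _.
rewrite leq_add2l leq_mul // leq_mul //; case: (d) => // d'.
by rewrite leq_exp2r.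
Qed.

(** [c] may be inhomogeneous. If its order modulo [P] is [a], the dimension is hil P m - hil P (m-a)
    for m > a, a sum of [a] increments of size O(m^d). *)
Lemma prime_quot_upper P c : hprime P -> ~ P c ->
  exists C, forall m, (0 < m)%N -> (qdim setT (idsum (cutoff P m) c) <= C * m ^ d)%N.
Proof.
move=> PP nPc; have [PH _] := PP.
have [C hC] := hil_prime_growth PP.
have [a [tc ntc]] := cutoff_order HG PH nPc.
have le_hil m : (qdim setT (idsum (cutoff P m) c) <= hil P m)%N.
  have I1 := ideal_cutoff HG m PH.
  apply: qdimS; [exact: ideal_subspace|exact/ideal_subspace/ideal_idsum|by []| |exact: findim_cutoff].
  exact: idsum_sub.
exists (hil P a + a * C + C)%N => m m0.
have md : (0 < m ^ d)%N by rewrite expn_gt0 m0.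
have [ma|am] := leqP m a.
  apply: leq_trans (le_hil m) _; apply: leq_trans (hil_leq HG PH ma) _.
  by rewrite -addnA mulnDl; apply: leq_trans (leq_addr _ _); rewrite leq_pmulr.
have := hil_prime_quot HG (m - a) PP tc ntc; rewrite subnKC ?(ltnW am) // => e.
have := hC (m - a)%N a; rewrite subnK ?(ltnW am) // -e => -[h|h].
  move: h; rewrite [X in (_ <= X)%N]addnC leq_add2r => h; apply: leq_trans h _.
  by rewrite mulnA leq_mul2r; apply/orP; right; rewrite addnAC leq_addl.
apply: leq_trans (leq_trans (leq_addr _ _) h) _; rewrite mulnDl; apply: leq_trans (leq_addl _ _).
by rewrite leq_pmulr.
Qed.

Lemma upper_idsum_prime P s c : hprime P -> G s c -> ~ P c -> upper d (idsum P c).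
Proof.
move=> PP Gc nPc; have [C hC] := prime_quot_upper PP nPc; have [PH _] := PP.
by exists C => m m0; rewrite -(hil_idsum HG _ Gc PH); apply: hC.
Qed.

Lemma upper_prime_proper P P' : hprime P -> hprime P' -> P `<` P' -> upper d P'.
Proof.
move=> PP PP' [sPP' /nonsubset[x [P'x nPx]]]; have [PH _] := PP; have [PH' _] := PP'.
have [i nPi] : exists i, ~ P (comp G x i).
  by apply: contrapT => /forallNP h; apply: nPx; apply: (hom_sub HG PH) => i; apply: contrapT.
have Gi := compG HG x i.
apply: (upperS HG (hom_idsum HG Gi PH) PH') (upper_idsum_prime PP Gi nPi).
by apply: idsum_min => //; [case: PH'|case: PH' => _; apply].
Qed.

Lemma upper_or_prime J : hom J ->
  upper d J \/ exists P, [/\ hprime P, J `<=` P & lower d.+1 P].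
Proof.
move=> JH; have [J1|nJ1] := pselect (J 1).
  left; exists 0%N => m m0; rewrite /hil qdim_sub0 //; first exact: subspace_cutoff.
  by rewrite (ideal1 (hom_ideal JH) J1) => x _ i _.
have [e [le ue _ [P [PP JP lP]]]] := growth_exists HG RN JH nJ1.
have := upper_lower (hom_upper JH) le; rewrite leq_eqVlt => /orP[/eqP ed|ed].
  by right; exists P; rewrite -ed.
by left; apply: upper_leq ue.
Qed.

Lemma lower_not_upper P : lower d.+1 P -> upper d P -> False.
Proof. by move=> lP uP; have := upper_lower uP lP; rewrite ltnn. Qed.

(** * Ideals near a prime of top dimension *)

Section Primary.
Variable p : nat.
Hypothesis pR : p \in [pchar R].

Lemma ideal_frob_leq J t x e e' : is_ideal J -> (e <= e')%N ->
  J (t * x ^+ (p ^ e)) -> J (t * x ^+ (p ^ e')).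
Proof.
move=> JI ee Jx; rewrite -(subnK ee) expnD mulnC exprM.
have := frob_gt0 pR (e' - e); case: (p ^ (e' - e))%N => // n _.
by rewrite exprS mulrA; apply: idealMr.
Qed.

(** [P] is minimal over [J], since its growth is the largest possible, so [J] becomes primary after
    localization at [P]. Here [t] clears the denominators, and a Frobenius power takes the place of
    an ordinary power of [P]. *)
Lemma primary_element P : hprime P -> lower d.+1 P -> forall J, hom J -> J `<=` P ->
  exists s t e, [/\ G s t, ~ P t & forall x, P x -> J (t * x ^+ (p ^ e))].
Proof.
move=> PP lP J JH; move: (JH); have := hom_ideal JH; move: J {JH}.
have [PH /is_primeP[PI P1 Pmul]] := PP.
apply: (noetherian_ind RN) => J JI IH JH JP.
have [PJ|nPJ] := pselect (P `<=` J).
  exists 0%N, 1, 0%N; split=> // [|x Px]; first exact: G1_one.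
  by rewrite mul1r expr1; apply: PJ.
have nJ1 : ~ J 1 by move/JP.
(* A homogeneous prime strictly below [P] would force smaller growth on [P]. *)
have nJP : ~ hprime J.
  by move=> JP'; apply: (lower_not_upper lP); apply: (upper_prime_proper JP' PP).
have [sa [sb [a [b [Ga Gb nJa nJb Jab]]]]] := not_hprime HG JH nJ1 nJP.
wlog Pa : sa sb a b Ga Gb nJa nJb Jab / P a.
  move=> W; have /Pmul[Pa|Pb] := JP _ Jab; first exact: (W sa sb a b).
  by apply: (W sb sa b a) => //; rewrite mulrC.
have sub x : G x.1 x.2 -> P x.2 -> idsum J x.2 `<=` P by move=> _ Px; apply: idsum_min.
have [s1 [t1 [e1 [G1 nP1 h1]]]] :=
  IH _ (ideal_idsum a JI) (idsum_proper JI nJa) (hom_idsum HG Ga JH) (sub (sa, a) Ga Pa).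
have [Pb|nPb] := pselect (P b); last first.
  (* With [b] outside [P], the factor [b] may be put into [t]: it multiplies J+(a) into [J]. *)
  exists (sb + s1)%N, (b * t1), e1; split; first exact: (graded_mul HG).
    by move=> /Pmul[].
  move=> x Px; have [j [r [Jj e]]] := h1 x Px.
  rewrite -mulrA e mulrDr mulrA [b * a]mulrC; apply: idealD => //; first exact: idealM.
  exact: idealMr.
have [s2 [t2 [e2 [G2 nP2 h2]]]] :=
  IH _ (ideal_idsum b JI) (idsum_proper JI nJb) (hom_idsum HG Gb JH) (sub (sb, b) Gb Pb).
(* The product of an element of J+(a) and one of J+(b) lies in [J]. It carries the exponent 2 p^e,
   which is at most p^(e+1). *)
exists (s1 + s2)%N, (t1 * t2), (maxn e1 e2).+1; split; first exact: (graded_mul HG).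
  by move=> /Pmul[].
move=> x Px; have p2 : (1 < p)%N by rewrite prime_gt1 // (pcharf_prime pR).
set e := maxn e1 e2.
have h1' : idsum J a (t1 * x ^+ (p ^ e)).
  by apply: (@ideal_frob_leq _ _ _ e1); [exact: ideal_idsum|exact: leq_maxl|exact: h1].
have h2' : idsum J b (t2 * x ^+ (p ^ e)).
  by apply: (@ideal_frob_leq _ _ _ e2); [exact: ideal_idsum|exact: leq_maxr|exact: h2].
have -> : t1 * t2 * x ^+ (p ^ e.+1) =
    x ^+ (p ^ e.+1 - 2 * p ^ e) * ((t1 * x ^+ (p ^ e)) * (t2 * x ^+ (p ^ e))).
  rewrite mulrACA -exprD addnn -mul2n mulrCA -exprD subnK //.
  by rewrite expnS leq_mul2r p2 orbT.
apply: idealM => //; have [j [r [Jj ->]]] := h1'; have [j' [r' [Jj' ->]]] := h2'.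
rewrite mulrDl [a * r * _]mulrDr; apply: (idealD JI); first exact: (idealMr _ JI).
by apply: (idealD JI); [apply: (idealM _ JI)|rewrite mulrACA; apply: (idealMr _ JI)].
Qed.

End Primary.

End Dimension.

(** * Comparison of a module with a free one over the Frobenius image of a domain *)

Section Rank.
Variables (k : fieldType) (R : comAlgType k) (p : nat).
Hypothesis k_perfect : perfect_field p k.
Implicit Types J P A B : set R.

Let pR : p \in [pchar R]. Proof. by apply: pchar_alg; case: k_perfect. Qed.

Lemma perfect_root e (x : k) : exists y, y ^+ (p ^ e) = x.
Proof.
elim: e x => [|e IH] x; first by exists x; rewrite expr1.
have [y <-] := IH x; have [z <-] := k_perfect.2 y.
by exists z; rewrite expnS exprM.
Qed.

Lemma perfect_roots e (I : finType) (l : I -> k) :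
  exists m : I -> k, forall i, m i ^+ (p ^ e) = l i.
Proof. by have [m hm] := choice (fun i => perfect_root e (l i)); exists m. Qed.

Section FrobeniusSpan.
Variables (G : nat -> set R) (r : nat) (x : 'I_r -> R).
Hypotheses (HG : standard_graded G) (gx : generators G x).

Definition small_mono e (b : {ffun 'I_r -> 'I_(p ^ e)}) : R := mono x (fun i => b i : nat).

(** Divide the exponents of a monomial by p^e with remainder; scalars have p^e-th roots because [k]
    is perfect. *)
Lemma frobenius_span e y : exists a : {ffun 'I_r -> 'I_(p ^ e)} -> R,
  y = \sum_b a b ^+ (p ^ e) * small_mono b.
Proof.
have [_ xW] := gx; move: y.
apply: (xW [set y | exists a : {ffun 'I_r -> 'I_(p ^ e)} -> R,
  y = \sum_b a b ^+ (p ^ e) * small_mono b]) => [|a].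
  split=> [|c _ _ [a ->] [a' ->]].
    by exists (fun=> 0); rewrite big1 // => b _; rewrite (frob0 pR) mul0r.
  have [c' <-] := perfect_root e c.
  exists (fun b => c' *: a b + a' b); rewrite scaler_sumr -big_split /=.
  by apply: eq_bigr => b _; rewrite (frobD pR) exprZn mulrDl scalerAl.
have q0 := frob_gt0 pR e.
pose b : {ffun 'I_r -> 'I_(p ^ e)} := [ffun i => Ordinal (ltn_pmod (a i) q0)].
exists (fun c => if c == b then mono x (fun i => a i %/ p ^ e)%N else 0).
rewrite (bigD1 b) //= eqxx big1 ?addr0 => [|c /negPf->]; last by rewrite (frob0 pR) mul0r.
rewrite /mono -prodrXl -big_split; apply: eq_bigr => i _ /=.
by rewrite ffunE /= -exprM -exprD -divn_eq.
Qed.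

End FrobeniusSpan.

(** * R/J as a module over the domain R/P through Frobenius *)

Section Independence.
Variables (P J : set R) (e : nat).
Hypotheses (P_prime : is_prime_ideal P) (J_ideal : is_ideal J).
Hypothesis PJ : forall x, P x -> J (x ^+ (p ^ e)).

Local Notation q0 := (p ^ e)%N.

Let P_ideal : is_ideal P. Proof. by have /is_primeP[] := P_prime. Qed.

(** By [PJ], R/P acts on R/J through q0-th powers. [comb u] is the map from a free module given by
    [u], and [frob_free u] makes the induced map from (R/P)^I to R/J injective. *)
Definition comb (I : finType) (u : I -> R) (a : I -> R) : R := \sum_i a i ^+ q0 * u i.

Definition frob_free (I : finType) (u : I -> R) : Prop :=
  forall a : I -> R, J (comb u a) -> forall i, P (a i).

Lemma combD (I : finType) (u a b : I -> R) :
  comb u (fun i => a i + b i) = comb u a + comb u b.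
Proof. by rewrite -big_split; apply: eq_bigr => i _ /=; rewrite (frobD pR) mulrDl. Qed.

Lemma combM (I : finType) (u a : I -> R) c :
  comb u (fun i => c * a i) = c ^+ q0 * comb u a.
Proof. by rewrite mulr_sumr; apply: eq_bigr => i _ /=; rewrite exprMn mulrA. Qed.

Lemma combN (I : finType) (u a : I -> R) : comb u (fun i => - a i) = - comb u a.
Proof. by rewrite -sumrN; apply: eq_bigr => i _ /=; rewrite (frobN pR) mulNr. Qed.

Lemma combZ (I : finType) (u a : I -> R) (c : k) :
  comb u (fun i => c *: a i) = c ^+ q0 *: comb u a.
Proof. by rewrite scaler_sumr; apply: eq_bigr => i _ /=; rewrite exprZn scalerAl. Qed.

Lemma comb0 (I : finType) (u : I -> R) : comb u (fun=> 0) = 0.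
Proof. by rewrite /comb big1 // => i _; rewrite (frob0 pR) mul0r. Qed.

Lemma comb_mem (I : finType) (u a : I -> R) B : is_ideal B ->
  (forall i, B (a i ^+ q0)) -> B (comb u a).
Proof. by move=> BI Ba; apply: ideal_sum => // i _; apply: idealMr. Qed.

(** Run through [w], adding [y] when the family stays free. Otherwise a relation expresses a
    multiple of [y] by the family; the product of these coefficients is the common denominator [c],
    outside [P] by primality. *)
Lemma frob_free_maximal (w : seq R) :
  exists (I : finType) (u : I -> R) (c : R), [/\ frob_free u, ~ P c &
    forall y, y \in w -> exists a, J (c ^+ q0 * y - comb u a)].
Proof.
have /is_primeP[_ P1 Pmul] := P_prime.
elim: w => [|y w [I [u [c [fu nPc hw]]]]].
  by exists void, (fun=> 0), 1; split=> // a _ [].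
pose u' (o : option I) := if o is Some i then u i else y.
have combE a : comb u' a = a None ^+ q0 * y + comb u (fun i => a (Some i)).
  exact: sum_option.
have [fu'|nfu'] := pselect (frob_free u').
  exists (option I), u', c; split=> // z; rewrite inE => /orP[/eqP->|/hw[a Ja]].
    exists (fun o => if o is None then c else 0).
    by rewrite combE /= comb0 addr0 subrr; apply: ideal0.
  exists (fun o => if o is Some i then a i else 0).
  by rewrite combE (frob0 pR) mul0r add0r.
have [a [Ja [o nPa]]] : exists a, J (comb u' a) /\ exists o, ~ P (a o).
  apply: contrapT => h; apply: nfu' => a Ja o; apply: contrapT => nPa.
  by apply: h; exists a; split=> //; exists o.
move: Ja; rewrite combE => Ja.
(* If the coefficient of [y] were in [P], its term would lie in [J], and freeness of [u] would put
   all other coefficients in [P]. *)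
have nPb : ~ P (a None).
  move=> Pb; have Jb : J (a None ^+ q0 * y) by apply: idealMr => //; apply: PJ.
  have : J (comb u (fun i => a (Some i))).
    by rewrite -[X in J X](addKr (a None ^+ q0 * y)); apply: idealD => //; apply: idealN.
  by move/fu => Pa; case: o nPa => [i|] //; apply.
exists I, u, (c * a None); split=> // [/Pmul[]//|z].
rewrite inE => /orP[/eqP->|/hw[b Jb]].
  exists (fun i => - (c * a (Some i))).
  rewrite combN combM opprK exprMn -mulrA -mulrDr.
  exact: idealM.
exists (fun i => a None * b i); rewrite combM exprMn [c ^+ _ * _]mulrC -mulrA -mulrBr.
exact: idealM.
Qed.

(** A denominator for finitely many generators serves all elements, so [#|I|] is the rank of R/J
    over R/P. *)
Lemma frob_free_spanning (T : finType) (v : T -> R) :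
  (forall y, exists a : T -> R, y = \sum_b a b ^+ q0 * v b) ->
  exists (I : finType) (u : I -> R) (c : R), [/\ frob_free u, ~ P c &
    forall y, exists a, J (c ^+ q0 * y - comb u a)].
Proof.
move=> v_span; have [I [u [c [fu nPc hw]]]] := frob_free_maximal (codom v).
exists I, u, c; split=> // y; have [a ->] := v_span y.
have [b hb] := choice (fun t => hw (v t) (codom_f v t)).
exists (fun i => \sum_t a t * b t i).
have -> : comb u (fun i => \sum_t a t * b t i) = \sum_t a t ^+ q0 * comb u (b t).
  rewrite /comb; under eq_bigr do rewrite (frob_sum pR) mulr_suml.
  rewrite exchange_big; apply: eq_bigr => t _; rewrite mulr_sumr.
  by apply: eq_bigr => i _; rewrite exprMn mulrA.
rewrite mulr_sumr -sumrB; apply: ideal_sum => // t _.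
by rewrite mulrCA -mulrBr; apply: idealM.
Qed.

Section Combinations.
Variables (I : finType) (u : I -> R).

(** The preimage in R of the image of A^I in R/J. In general it is no ideal, being stable only under
    q0-th powers; for an ideal [A] it is a k-subspace because scalars have q0-th roots. *)
Definition combset A : set R :=
  [set y | exists a, (forall i, A (a i)) /\ J (y - comb u a)].

Lemma subspace_combset A : is_ideal A -> subspace (combset A).
Proof.
move=> AI; split.
  exists (fun=> 0); split=> [i|]; first exact: ideal0.
  by rewrite comb0 subrr; apply: ideal0.
move=> l y z [a [Aa Ja]] [b [Ab Jb]]; have [l' ll'] := perfect_root e l.
exists (fun i => l' *: a i + b i); split=> [i|].
  by apply: (ideal_subspace AI).2.
rewrite (combD u (fun i => l' *: a i)) combZ ll' opprD addrACA -scalerBr.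
exact: (ideal_subspace J_ideal).2.
Qed.

Lemma combsetS A B : A `<=` B -> combset A `<=` combset B.
Proof. by move=> AB y [a [Aa Ja]]; exists a; split=> // i; apply: AB. Qed.

Lemma combset_J A : is_ideal A -> J `<=` combset A.
Proof.
move=> AI y Jy; exists (fun=> 0); split=> [i|]; first exact: ideal0.
by rewrite comb0 subr0.
Qed.

Lemma combset_frobM A z y : A z -> is_ideal A -> combset setT y ->
  combset A (z ^+ q0 * y).
Proof.
move=> Az AI [a [_ Ja]]; exists (fun i => z * a i); split=> [i|]; first exact: idealMr.
by rewrite combM -mulrBr; apply: idealM.
Qed.

Lemma span_combset B m (b : 'I_m -> R) : is_ideal B -> span_mod setT B b ->
  span_mod (combset setT) (combset B) (fun s : 'I_m * I => b s.1 ^+ q0 * u s.2).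
Proof.
move=> BI sb y [a [_ Ja]].
have [l hl] := choice (fun i => sb (a i) Logic.I).
exists (fun s => l s.2 s.1 ^+ q0).
exists (fun i => a i - \sum_j l i j *: b j); split=> //.
have -> : \sum_s l s.2 s.1 ^+ q0 *: (b s.1 ^+ q0 * u s.2) =
          comb u (fun i => \sum_j l i j *: b j).
  rewrite -(pair_bigA _ (fun j i => l i j ^+ q0 *: (b j ^+ q0 * u i))) exchange_big /=.
  apply: eq_bigr => i _; rewrite (frob_sum pR) mulr_suml; apply: eq_bigr => j _.
  by rewrite exprZn scalerAl.
rewrite (combD u a (fun i => - (\sum_j l i j *: b j))) combN opprB.
by rewrite addrA subrK.
Qed.

(** After taking q0-th roots of its scalars, a relation says that a [comb] lies in [J] up to
    coefficients from [B]. Freeness of [u] puts each coordinate in [B], where [b] is independent. *)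
Lemma free_combset B m (b : 'I_m -> R) : is_ideal B -> P `<=` B -> frob_free u ->
  free_mod B b ->
  free_mod (combset B) (fun s : 'I_m * I => b s.1 ^+ q0 * u s.2).
Proof.
move=> BI PB fu fb l [a [Ba Ja]] [j i].
have [l' hl] := perfect_roots e l.
have sumE : \sum_s l s *: (b s.1 ^+ q0 * u s.2) = comb u (fun i => \sum_j l' (j, i) *: b j).
  transitivity (\sum_j \sum_i l' (j, i) ^+ q0 *: (b j ^+ q0 * u i)).
    by rewrite pair_bigA; apply: eq_bigr => -[j' i'] _ /=; rewrite hl.
  rewrite exchange_big; apply: eq_bigr => i' _; rewrite (frob_sum pR) mulr_suml.
  by apply: eq_bigr => j' _; rewrite exprZn scalerAl.
move: Ja; rewrite sumE -combN -combD => /fu Pa.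
have Bl i' : B (\sum_j l' (j, i') *: b j).
  rewrite -[X in B X](subrK (a i')); apply: idealD => //; apply: PB; exact: Pa.
by rewrite -hl (fb (fun j => l' (j, i)) (Bl i)) (frob0 (R := k) k_perfect.1).
Qed.

Lemma qdim_combset_le B : is_ideal B -> findim setT B ->
  findim (combset setT) (combset B) /\
  (qdim (combset setT) (combset B) <= #|I| * qdim setT B)%N.
Proof.
move=> BI fB; have [b [_ _ sb]] := findim_basis fB.
have h := span_combset BI sb; have S := subspace_combset BI.
split; first exact: span_findim h.
by apply: leq_trans (span_qdim S h) _; rewrite card_prod card_ord mulnC.
Qed.

Lemma qdim_combset_ge B : is_ideal B -> P `<=` B -> frob_free u -> findim setT B ->
  (#|I| * qdim setT B <= qdim (combset setT) (combset B))%N.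
Proof.
move=> BI PB fu fB; have [b [_ fb sb]] := findim_basis fB.
have S := subspace_combset BI; have [fd _] := qdim_combset_le BI fB.
have h := free_combset BI PB fu fb.
have := free_qdim S fd _ h; rewrite card_prod card_ord mulnC; apply=> -[j i] /=.
exists (fun i' => if i' == i then b j else 0); split=> //.
rewrite /comb (bigD1 i) //= eqxx big1 ?addr0 ?subrr; first exact: ideal0.
by move=> i' /negPf->; rewrite (frob0 pR) mul0r.
Qed.

End Combinations.

(** * Comparison of R/(J+Q') with copies of R/(P+Q) *)

Section Comparison.
Variables (I : finType) (u : I -> R) (c : R).
Hypothesis u_free : frob_free u.
Hypothesis u_span : forall y, exists a, J (c ^+ q0 * y - comb u a).
Variables (T : finType) (v : T -> R).
Hypothesis v_span : forall y, exists a : T -> R, y = \sum_b a b ^+ q0 * v b.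
(* Q' is the Frobenius power Q^[q0] *)
Variables (Q Q' : set R).
Hypotheses (Q_ideal : is_ideal Q) (Q_ideal' : is_ideal Q').
Hypothesis QQ' : forall z, Q z -> Q' (z ^+ q0).
Hypothesis Q'_min : forall B, is_ideal B -> (forall z, Q z -> B (z ^+ q0)) -> Q' `<=` B.
Hypothesis Q_findim : findim setT Q.
Hypothesis Q_findim' : findim setT Q'.

Local Notation S := (idadd J Q').
Local Notation B := (idadd P Q).
Local Notation Bc := (idadd (idsum P c) Q).

Let S_ideal : is_ideal S. Proof. exact: ideal_idadd. Qed.
Let B_ideal : is_ideal B. Proof. exact: ideal_idadd. Qed.
Let Bc_ideal : is_ideal Bc. Proof. by apply: ideal_idadd => //; apply: ideal_idsum. Qed.

Let findim_sup A : is_ideal A -> Q `<=` A -> findim setT A.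
Proof. by move=> AI QA; apply: findimS Q_findim => //; apply: ideal_subspace. Qed.

Let findim_sup' A : subspace A -> Q' `<=` A -> findim setT A.
Proof. by move=> AI QA; apply: findimS Q_findim' => //; apply: ideal_subspace. Qed.

Let fB : findim setT B. Proof. by apply: findim_sup => //; apply: idadd_subr. Qed.
Let fBc : findim setT Bc.
Proof. by apply: findim_sup => //; apply: idadd_subr; apply: ideal_idsum. Qed.
Let fS : findim setT S.
Proof. by apply: findim_sup'; [exact: ideal_subspace|apply: idadd_subr]. Qed.

Lemma u_span_comb y : combset u setT (c ^+ q0 * y).
Proof. by have [a Ja] := u_span y; exists a. Qed.

Lemma combset_sub_S : combset u B `<=` S.
Proof.
move=> y [a [Ba Ja]]; rewrite -[y](subrK (comb u a)); apply: (idealD S_ideal).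
  exact: idadd_subl.
apply: comb_mem => // i; have [x [z [Px Qz ->]]] := Ba i.
by rewrite (frobD pR); exists (x ^+ q0), (z ^+ q0); split=> //; [apply: PJ|apply: QQ'].
Qed.

(** Makes multiplication by [c ^+ q0] a well-defined map from R/S to [combset u setT] modulo
    [combset u B]. *)
Lemma S_sub_combset y : S y -> combset u B (c ^+ q0 * y).
Proof.
have CS := subspace_combset u B_ideal.
move=> [j [z [Jj Qz ->]]]; rewrite mulrDr; apply: (subspaceD CS).
  by apply: combset_J => //; apply: idealM.
(* Quantifying over all multiples [r * z] yields an ideal, as [Q'_min] requires. *)
suff : [set z | forall r, combset u B (c ^+ q0 * (r * z))] z by move/(_ 1); rewrite mul1r.
apply: Q'_min Qz.
  apply/is_idealP; split=> [r|a x y' hx hy r]; first by rewrite !mulr0; apply: subspace0.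
  by rewrite [r * _]mulrDr mulrDr [r * (a * x)]mulrA; apply: (subspaceD CS); [exact: hx|exact: hy].
move=> x Qx r /=; rewrite [r * _]mulrC mulrCA; apply: combset_frobM => //.
  by apply: idadd_subr.
exact: u_span_comb.
Qed.

(** With M = [combset u setT], the part (M+S)/S is a quotient of M by [combset u B]. The rest
    R/(M+S) is killed by the q0-th powers of P+(c)+Q, so the generators [v] span it over R/Bc. *)
Lemma rank_upper :
  (qdim setT S <= #|I| * qdim setT B + #|T| * qdim setT Bc)%N.
Proof.
have SS := ideal_subspace S_ideal; have MS := subspace_combset u (@is_idealT R).
have SMS : subspace (sumsp (combset u setT) S) by exact: subspace_sumsp.
have SM : S `<=` sumsp (combset u setT) S by apply: sumsp_subr; apply: subspace0.
rewrite (@qdim_add _ _ setT S (sumsp (combset u setT) S)) // addnC; apply: leq_add.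
  have fMS : findim (combset u setT) S by apply: findimS fS.
  rewrite qdim_sumsp //; have [fd le] := qdim_combset_le u B_ideal fB.
  by apply: leq_trans le; apply: qdimS => //; [apply: subspace_combset|exact: combset_sub_S].
have [b [_ _ sb]] := findim_basis fBc.
rewrite mulnC -[X in (X * _)%N]card_ord -card_prod.
apply: (span_qdim (c := fun s : 'I__ * T => b s.1 ^+ q0 * v s.2) SMS) => y _.
have [a yE] := v_span y.
have [l hl] := choice (fun t => sb (a t) Logic.I).
exists (fun s => l s.2 s.1 ^+ q0).
have -> : y - \sum_s l s.2 s.1 ^+ q0 *: (b s.1 ^+ q0 * v s.2) =
          \sum_t (a t - \sum_j l t j *: b j) ^+ q0 * v t.
  rewrite -(pair_bigA _ (fun j i => l i j ^+ q0 *: (b j ^+ q0 * v i))) exchange_big /=.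
  rewrite {1}yE -sumrB; apply: eq_bigr => t _.
  rewrite (frobD pR) (frobN pR) mulrBl (frob_sum pR) mulr_suml; congr (_ - _).
  by apply: eq_bigr => j _; rewrite exprZn scalerAl.
apply: subspace_sum => // t _; have [_ [z [[x [r [Px ->]]] Qz ->]]] := hl t.
rewrite !(frobD pR) exprMn mulrDl mulrDl; apply: (subspaceD SMS); last first.
  by apply: SM; apply: idadd_subr => //; apply: idealMr => //; apply: QQ'.
apply: (subspaceD SMS).
  by apply: SM; apply: idadd_subl => //; apply: idealMr => //; apply: PJ.
rewrite -mulrA; apply: sumsp_subl; first exact: subspace0.
exact: u_span_comb.
Qed.

(** W = c^q0 R + [combset u B] is inserted between [combset u B] and M = [combset u setT].
    Multiplication by c^q0 maps R/S onto the lower step; the upper step M/W is a quotient of M by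
    [combset u Bc]. *)
Lemma rank_lower :
  (#|I| * qdim setT B <= qdim setT S + #|I| * qdim setT Bc)%N.
Proof.
have SS := ideal_subspace S_ideal; have MT := subspace_combset u (@is_idealT R).
have MB := subspace_combset u B_ideal; have MBc := subspace_combset u Bc_ideal.
have [fd _] := qdim_combset_le u B_ideal fB.
have [fdc lec] := qdim_combset_le u Bc_ideal fBc.
pose f := *%R (c ^+ q0); have fl : linear f by exact: mulr_linear.
have US : subspace (f @` setT) by exact: subspace_image.
pose W := sumsp (f @` setT) (combset u B).
have WS : subspace W by exact: subspace_sumsp.
have BW : combset u B `<=` W by apply: sumsp_subr; apply: subspace0.
apply: leq_trans (qdim_combset_ge B_ideal (idadd_subl Q_ideal) u_free fB) _.
rewrite (@qdim_add _ _ (combset u setT) (combset u B) W) //; last first.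
  apply: sumsp_sub => //; first by move=> _ [y _ <-]; exact: u_span_comb.
  exact: combsetS.
rewrite addnC; apply: leq_add; last first.
  apply: leq_trans lec; apply: qdimS => //.
  move=> y [a [Ba Ja]]; rewrite -[y](subrK (comb u a)); apply: (subspaceD WS).
    by apply: BW; apply: combset_J.
  apply: subspace_sum => // i _; have [_ [z [[x [r [Px ->]]] Qz ->]]] := Ba i.
  rewrite addrAC (frobD pR) exprMn mulrDl -mulrA; apply: (subspaceD WS); last first.
    by apply: sumsp_subl; [exact: subspace0|exists (r ^+ q0 * u i)].
  apply: BW; apply: combset_frobM => //; first by exists x, z.
  exists (fun j => if j == i then 1 else 0); split=> //.
  rewrite /comb (bigD1 i) //= eqxx big1 ?addr0 => [|j /negPf->]; last by rewrite (frob0 pR) mul0r.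
  by rewrite expr1n mul1r subrr; apply: ideal0.
have pS : subspace (f @^-1` (combset u B)) by exact: subspace_preimage.
have fp : findim setT (f @^-1` (combset u B)).
  by apply: findimS fS => // y; exact: S_sub_combset.
have fi := findim_image fl fp.
rewrite (qdim_sumsp MB fi) (qdim_image fl MB fp).
by apply: qdimS => // y; exact: S_sub_combset.
Qed.

End Comparison.

End Independence.

End Rank.

(** * Limits of numerical sequences *)

Section Sequences.
Variables (K : realType) (p d : nat).
Hypothesis p_gt1 : (1 < p)%N.
Implicit Types u v w : nat -> nat.

Definition hkseq u : nat -> K := fun n => (u n)%:R / (p ^ n)%:R ^+ d.+1.

Let q_gt0 n : (0 < p ^ n)%N. Proof. by rewrite expn_gt0 (ltnW p_gt1). Qed.

Let qK_gt0 n : 0 < ((p ^ n)%:R : K). Proof. by rewrite ltr0n. Qed.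

Lemma cvg_inv_pow (C : K) : (fun n => C / (p ^ n)%:R : K) @ \oo --> (0 : K).
Proof.
have h : (fun n => ((p ^ n)%:R : K)^-1) @ \oo --> (0 : K).
  under eq_fun do rewrite natrX -exprVn.
  apply: cvg_expr; rewrite ger0_norm ?invr_ge0 ?ler0n // invf_lt1 ?ltr1n // ltr0n.
  exact: ltnW.
by rewrite -(mulr0 C); apply: cvgM h; exact: cvg_cst.
Qed.

Lemma hkseq_err C n : (C * (p ^ n) ^ d)%:R / (p ^ n)%:R ^+ d.+1 = C%:R / (p ^ n)%:R :> K.
Proof.
rewrite natrM natrX exprS invfM mulrA [_ / _ ^+ d]mulrAC mulfK //.
by rewrite expf_neq0 // gt_eqF.
Qed.

Lemma hkseq_le u v C n : (u n <= v n + C * (p ^ n) ^ d)%N ->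
  hkseq u n <= hkseq v n + C%:R / (p ^ n)%:R.
Proof.
move=> h; rewrite -hkseq_err /hkseq -mulrDl -natrD.
by rewrite ler_pM2r ?ler_nat // invr_gt0 exprn_gt0.
Qed.

Lemma hkseq_near u v C (l : K) : (forall n, v n <= u n + C * (p ^ n) ^ d)%N ->
  (forall n, u n <= v n + C * (p ^ n) ^ d)%N ->
  hkseq u @ \oo --> l -> hkseq v @ \oo --> l.
Proof.
move=> vu uv ul; have cI := cvg_inv_pow C%:R.
apply: (@squeeze_cvgr _ _ _ _ (fun n => hkseq u n - C%:R / (p ^ n)%:R)
                              (fun n => hkseq u n + C%:R / (p ^ n)%:R)).
- by apply: nearW => n; rewrite lerBlDr !hkseq_le.
- by rewrite -[l]subr0; apply: cvgB.
- by rewrite -[l]addr0; apply: cvgD.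
Qed.

Lemma hkseq_small u C : (forall n, u n <= C * (p ^ n) ^ d)%N ->
  hkseq u @ \oo --> (0 : K).
Proof.
move=> h; apply: (@hkseq_near (fun=> 0%N) u C) => //.
have -> : hkseq (fun=> 0%N) = fun=> 0 by apply/funext => n; rewrite /hkseq mul0r.
exact: cvg_cst.
Qed.

Lemma hkseqD u v (l m : K) : hkseq u @ \oo --> l -> hkseq v @ \oo --> m ->
  hkseq (fun n => u n + v n)%N @ \oo --> l + m.
Proof.
move=> ul vm.
have -> : hkseq (fun n => u n + v n)%N = (fun n => hkseq u n + hkseq v n).
  by apply/funext => n; rewrite /hkseq natrD mulrDl.
exact: cvgD.
Qed.

Lemma hkseq_shift u e (l : K) : hkseq (fun n => u (n + e)%N) @ \oo --> l ->
  cvgn (hkseq u).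
Proof.
move=> ul; apply/cvg_ex; exists (l / (p ^ e)%:R ^+ d.+1).
rewrite -(cvg_shiftn e) /=.
have -> : (fun n => hkseq u (n + e)%N) =
    (fun n => hkseq (fun n => u (n + e)%N) n / (p ^ e)%:R ^+ d.+1).
  by apply/funext => n; rewrite /hkseq expnD natrM exprMn invfM mulrA.
by apply: cvgM ul _; exact: cvg_cst.
Qed.

Lemma bernoulli_bound X m : (X ^ m * (X + m) <= X.+1 ^ m * X)%N.
Proof.
elim: m => [|m IH]; first by rewrite addn0.
rewrite [(X.+1 ^ m.+1)%N]expnSr mulnAC.
apply: leq_trans (_ : X ^ m * (X + m) * X.+1 <= _)%N; last by rewrite leq_mul2r IH orbT.
rewrite expnSr -!mulnA leq_mul2l; apply/orP; right; nia.
Qed.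

(* If r were larger than p^(d+1), then u would outgrow (p^n)^(d+1). *)
Lemma rank_le u r C c : (0 < c)%N ->
  (forall n, u n <= C * (p ^ n) ^ d.+1)%N -> (forall n, (p ^ n) ^ d.+1 <= c * u n)%N ->
  (forall n, r * u n <= u n.+1 + C * (p ^ n) ^ d)%N -> (r <= p ^ d.+1)%N.
Proof.
move=> c0 uC uc ur; rewrite leqNgt; apply/negP => rp.
(* From n = N on, the error C q^d is at most half of [u n]. Then r > p^(d+1) makes [u] grow at least
   by the factor p^(d+1) + 1/2 = (X+1)/X times p^(d+1) at each step. *)
pose N := (2 * C * c)%N; pose X := (2 * p ^ d.+1)%N.
have N_lt : (N <= p ^ N)%N by apply/ltnW/ltn_expl.
have step n : (N <= n)%N -> (X.+1 * u n <= 2 * u n.+1)%N.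
  move=> Nn.
  have qN : (N <= p ^ n)%N by apply: leq_trans N_lt _; rewrite leq_exp2l.
  have h1 := uc n; have h2 := ur n; rewrite expnS in h1.
  set q := (p ^ n)%N in qN h1 h2; set Z := (q ^ d)%N in h1 h2.
  have h3 : ((p ^ d.+1).+1 * u n <= u n.+1 + C * Z)%N by apply: leq_trans h2; rewrite leq_mul2r rp orbT.
  have h4 : (2 * C * c * Z <= c * u n)%N by apply: leq_trans h1; rewrite leq_mul2r qN orbT.
  have h5 : (2 * C * Z <= u n)%N.
    by rewrite -(leq_pmul2l c0); apply: leq_trans h4; rewrite [leqRHS]mulnAC [leqRHS]mulnC.
  by rewrite /X; nia.
have grow m : (X.+1 ^ m * u N <= 2 ^ m * u (N + m))%N.
  elim: m => [|m IH]; first by rewrite addn0.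
  have := step (N + m)%N (leq_addr _ _); rewrite -addnS !expnS => h.
  by rewrite -mulnA; nia.
have uN : (0 < u N)%N.
  by rewrite lt0n; apply/eqP => u0; have := uc N; rewrite u0 muln0 leqn0 expn_eq0 /= gtn_eqF.
pose C' := (C * (p ^ N) ^ d.+1)%N.
have bound m : (X.+1 ^ m <= C' * X ^ m)%N.
  apply: (@leq_trans (X.+1 ^ m * u N)); first by rewrite leq_pmulr.
  apply: leq_trans (grow m) _.
  apply: (@leq_trans (2 ^ m * (C * (p ^ (N + m)) ^ d.+1))%N); first by rewrite leq_mul2l uC orbT.
  have -> : ((p ^ (N + m)) ^ d.+1 = (p ^ N) ^ d.+1 * (p ^ d.+1) ^ m)%N.
    by rewrite expnD expnMn -!expnM [(m * _)%N]mulnC.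
  by rewrite /C' /X expnMn mulnCA [(2 ^ m * _)%N]mulnCA mulnA.
have X0 : (0 < X)%N by rewrite muln_gt0 expn_gt0 (ltnW p_gt1).
(* For this [m], Bernoulli gives (1+1/X)^m >= 1 + m/X = 1 + C', against the bound C'. *)
pose m := (C' * X)%N.
have := bernoulli_bound X m.
have : (X.+1 ^ m * X <= C' * X ^ m * X)%N by rewrite leq_mul2r bound orbT.
move=> h1 /leq_trans /(_ h1); rewrite [(C' * _)%N]mulnC -mulnA leq_pmul2l ?expn_gt0 ?X0 //.
by rewrite /m; nia.
Qed.

Lemma hkseq_upper_cvg u C : (forall n, u n.+1 <= p ^ d.+1 * u n + C * (p ^ n) ^ d)%N ->
  cvgn (hkseq u).
Proof.
move=> uS.
(* The correction absorbs the error: C/q + 2C/(pq) <= 2C/q because p >= 2, so [z] is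
   nonincreasing. *)
pose z n : K := hkseq u n + (2 * C)%:R / (p ^ n)%:R.
have zS n : z n.+1 <= z n.
  have h : hkseq u n.+1 <= hkseq u n + C%:R / (p ^ n)%:R.
    have h0 := uS n.
    have : (u n.+1)%:R <= (p ^ d.+1)%:R * (u n)%:R + (C * (p ^ n) ^ d)%:R :> K.
      by rewrite -natrM -natrD ler_nat.
    rewrite -(ler_pM2r (x := ((p ^ n.+1)%:R ^+ d.+1)^-1)); last by rewrite invr_gt0 exprn_gt0.
    move/le_trans; apply.
    have -> : (p ^ n.+1)%:R = p%:R * (p ^ n)%:R :> K by rewrite expnS natrM.
    rewrite exprMn invfM mulrDl.
    have pd : ((p%:R : K) ^+ d.+1) != 0 by rewrite expf_neq0 // pnatr_eq0 -lt0n ltnW.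
    apply: lerD; first by rewrite natrX mulrACA mulfV // mul1r.
    rewrite mulrCA hkseq_err ler_piMl ?divr_ge0 ?ler0n // invf_le1 ?exprn_ege1 ?exprn_gt0 //.
      by rewrite ler1n ltnW.
    by rewrite ltr0n ltnW.
  apply: le_trans (_ : hkseq u n + C%:R / (p ^ n)%:R + (2 * C)%:R / (p ^ n.+1)%:R <= _).
    by rewrite lerD2r.
  rewrite /z -addrA lerD2l.
  have -> : (2 * C)%:R / (p ^ n)%:R = C%:R / (p ^ n)%:R + C%:R / (p ^ n)%:R :> K.
    by rewrite mul2n -addnn natrD mulrDl.
  have -> : (p ^ n.+1)%:R = p%:R * (p ^ n)%:R :> K by rewrite expnS natrM.
  rewrite lerD2l invfM mulrA ler_pM2r ?invr_gt0 //.
  have p0 : 0 < p%:R :> K by rewrite ltr0n ltnW.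
  by rewrite ler_pdivrMr // -natrM ler_nat mulnC leq_mul2l p_gt1 orbT.
have cz : cvgn z.
  apply: nonincreasing_is_cvgn.
    by apply/nonincreasing_seqP.
  exists 0 => _ [n _ <-]; apply: addr_ge0; rewrite divr_ge0 ?ler0n //.
  by rewrite exprn_ge0.
have -> : hkseq u = (fun n => z n - (2 * C)%:R / (p ^ n)%:R).
  by apply/funext => n; rewrite /z addrK.
apply: is_cvgB => //; apply/cvg_ex; exists 0; exact: cvg_inv_pow.
Qed.

End Sequences.

(** * Existence of the Hilbert-Kunz multiplicity *)

Section HilbertKunz.
Variables (k : fieldType) (R : comAlgType k) (G : nat -> set R) (p : nat).
Hypothesis HG : standard_graded G.
Hypothesis RN : noetherian R.
Hypothesis k_perfect : perfect_field p k.
Variable d : nat.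
Hypothesis R_upper : upper G d.+1 [set 0].
Variable I : set R.
Hypothesis I_hom : hom G I.
Variable N : nat.
Hypothesis I_ge : ge G N `<=` I.
Implicit Types J P : set R.

Local Notation hom := (hom G).
Local Notation hprime := (hprime G).
Local Notation upper := (upper G).
Local Notation lower := (lower G).
Local Notation cutoff := (cutoff G).
Local Notation hil := (hil G).

Let pR : p \in [pchar R]. Proof. by apply: pchar_alg; case: k_perfect. Qed.

Let p_gt1 : (1 < p)%N. Proof. exact/prime_gt1/(pcharf_prime pR). Qed.

Definition fpow n : set R := frobenius_power I (p ^ n).

Definition hk_dim J n := qdim setT (idadd J (fpow n)).

Lemma ideal_fpow n : is_ideal (fpow n). Proof. exact: ideal_frobenius_power. Qed.

Lemma fpow_ge : exists A, (0 < A)%N /\ forall n, ge G (A * p ^ n) `<=` fpow n.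
Proof.
have [r [x gx]] := generators_exist HG.
(* x_j^N lies in I, hence x_j^(Nq) in I^[q]. The pigeonhole degree is at most r(Nq-1)+1 for N > 0
   and 1 for N = 0, in both cases at most (rN+1)q. *)
exists (r * N).+1; split=> // n.
apply: (@subset_trans _ (ge G (r * (N * p ^ n).-1).+1)).
  apply: ge_leq; have := frob_gt0 pR n; case: (p ^ n)%N => // q _.
  by rewrite mulSn -mulnA; have := leq_pred (N * q.+1); nia.
apply: (ge_pigeonhole HG gx (ideal_fpow n)) => j; rewrite exprM.
apply: frobenius_power_mem; apply: I_ge.
exact: (G_ge HG (G_exp HG N (gx.1 j)) (leqnn N)).
Qed.

Lemma ideal_hk J n : is_ideal J -> is_ideal (idadd J (fpow n)).
Proof. by move=> JI; apply: ideal_idadd => //; apply: ideal_fpow. Qed.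

Lemma subspace_hk J n : is_ideal J -> subspace (idadd J (fpow n)).
Proof. by move=> JI; apply/ideal_subspace/ideal_hk. Qed.

Lemma findim_fpow n V : subspace V -> fpow n `<=` V -> findim setT V.
Proof.
move=> VS fV; have [A [_ gA]] := fpow_ge.
exact: (findim_sub_ge HG setT VS (subset_trans (gA n) fV)).
Qed.

Lemma findim_hk J n : is_ideal J -> findim setT (idadd J (fpow n)).
Proof. by move=> JI; apply: (@findim_fpow n); [exact: subspace_hk|exact: idadd_subr]. Qed.

Lemma hk_dim_upper e J : hom J -> upper e J ->
  exists C, forall n, (hk_dim J n <= C * (p ^ n) ^ e)%N.
Proof.
move=> JH [C hC]; have [A [A0 gA]] := fpow_ge; have JI := hom_ideal JH.
exists (C * A ^ e)%N => n; rewrite -mulnA -expnMn.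
have m0 : (0 < A * p ^ n)%N by rewrite muln_gt0 A0 (frob_gt0 pR).
apply: leq_trans (hC _ m0); apply: qdimS => //.
- exact: subspace_cutoff.
- exact: subspace_hk.
- rewrite cutoffEset // => _ [j [z [Jj gz ->]]].
  by exists j, z; split=> //; apply: gA.
- exact: findim_cutoff.
Qed.

Lemma hk_dim_prime_quot P c : hprime P -> ~ P c ->
  exists C, forall n, (hk_dim (idsum P c) n <= C * (p ^ n) ^ d)%N.
Proof.
move=> PP nPc; have [PH _] := PP; have PI := hom_ideal PH.
have [C hC] := prime_quot_upper HG RN R_upper PP nPc.
have [A [A0 gA]] := fpow_ge.
exists (C * A ^ d)%N => n; rewrite -mulnA -expnMn.
have m0 : (0 < A * p ^ n)%N by rewrite muln_gt0 A0 (frob_gt0 pR).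
have cI := ideal_idsum c PI.
apply: leq_trans (hC _ m0).
have cutI := ideal_cutoff HG (A * p ^ n) PH.
have sI : is_ideal (idsum (cutoff P (A * p ^ n)) c) by exact: ideal_idsum.
apply: qdimS => //; [exact: ideal_subspace|exact: subspace_hk| |].
  apply: idsum_min; first exact: ideal_hk.
    rewrite cutoffEset // => _ [j [z [Pj gz ->]]].
    by exists j, z; split=> //; [exact: idsum_sub|apply: gA].
  by apply: idadd_subl; [exact: ideal_fpow|exact: idsum_gen].
apply: (findim_sub_ge HG setT (ideal_subspace sI)).
exact: subset_trans (ge_cutoff PH) (@idsum_sub _ _ _).
Qed.

(** A proper homogeneous ideal lies in R_(>=1), as R_0 is a field. This turns lower growth bounds
    into lower bounds for [hk_dim]. *)
Lemma fpow_sub_ge n : ~ I 1 -> fpow n `<=` ge G (p ^ n).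
Proof.
move=> I1; apply: gen_min; first exact: ideal_ge.
move=> _ [y Iy <-].
suff gy : ge G 1 y.
  elim: (p ^ n)%N => [|q IH]; first by rewrite ge0.
  by rewrite exprS -add1n; apply: ge_mul.
move=> [|i] // _; have Ic := I_hom.2 _ 0%N Iy.
have : G 0%N (comp G y 0) by exact: compG.
rewrite (graded_zero HG) => -[a _ ya]; rewrite -ya in Ic *.
have [->|a0] := eqVneq a 0; first by rewrite scale0r.
case: I1; rewrite -(scale1r 1) -(mulVf a0) -scalerA.
by apply: subspaceZ Ic; apply/ideal_subspace/hom_ideal/I_hom.
Qed.

Lemma hk_dim_lower P : hprime P -> lower d.+1 P -> ~ I 1 ->
  exists c, forall n, ((p ^ n) ^ d.+1 <= c * hk_dim P n)%N.
Proof.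
move=> [PH _] [c hc] I1; exists c => n.
apply: leq_trans (hc _ (frob_gt0 pR n)) _; rewrite leq_mul2l; apply/orP; right.
have PI := hom_ideal PH.
apply: qdimS => //; [exact: subspace_hk|exact: subspace_cutoff| |exact: findim_hk].
rewrite cutoffEset // => _ [j [z [Jj gz ->]]].
by exists j, z; split=> //; apply: fpow_sub_ge.
Qed.

(** [r] is the rank of R/J over R/P through the e-th Frobenius. Both errors are multiples of dim
    R/(P+(c)+I^[q]) with [c] outside [P]. *)
Lemma hk_dim_rank P J e : hprime P -> is_ideal J ->
  (forall x, P x -> J (x ^+ (p ^ e))) ->
  exists r C, forall n,
    (hk_dim J (n + e) <= r * hk_dim P n + C * (p ^ n) ^ d)%N /\
    (r * hk_dim P n <= hk_dim J (n + e) + C * (p ^ n) ^ d)%N.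
Proof.
move=> PP JI PJ; have [PH Pp] := PP; have PI := hom_ideal PH.
have [s [x gx]] := generators_exist HG.
have v_span := frobenius_span k_perfect gx e.
have [T [u [c [fu nPc u_span]]]] := frob_free_spanning k_perfect Pp JI PJ v_span.
have [C hC] := hk_dim_prime_quot PP nPc.
exists #|T|, (#|{ffun 'I_s -> 'I_(p ^ e)}| * C + #|T| * C)%N => n.
have QQ z : fpow n z -> fpow (n + e) (z ^+ (p ^ e)).
  by move=> /(frobenius_power_exp pR (e := e)); rewrite /fpow expnD.
have Qmin B : is_ideal B -> (forall z, fpow n z -> B (z ^+ (p ^ e))) -> fpow (n + e) `<=` B.
  move=> BI QB; apply: gen_min => // _ [y Iy <-]; rewrite expnD exprM.
  by apply: QB; apply: frobenius_power_mem.
have fn m : findim setT (fpow m).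
  by apply: (@findim_fpow m) => //; apply/ideal_subspace/ideal_fpow.
split.
  apply: leq_trans (rank_upper k_perfect Pp JI PJ u_span v_span
    (ideal_fpow n) (ideal_fpow (n + e)) QQ (fn n) (fn (n + e)%N)) _.
  rewrite leq_add2l mulnDl; apply: leq_trans (leq_addr _ _).
  by rewrite -mulnA leq_mul2l hC orbT.
apply: leq_trans (rank_lower k_perfect Pp JI fu u_span
    (ideal_fpow n) (ideal_fpow (n + e)) Qmin (fn n) (fn (n + e)%N)) _.
rewrite leq_add2l mulnDl; apply: leq_trans (leq_addl _ _).
by rewrite -mulnA leq_mul2l hC orbT.
Qed.

(** The first bound comes from multiplication by [t] on R/(J+I^[q]). For the second, with A and B
    the sums of J:t and J+(t) with I^[q], dim R/A + dim R/B is the sum of the dimensions of R modulo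
    the intersection, which contains J+I^[q], and modulo A+B. *)
Lemma hk_dim_colon J t n : is_ideal J ->
  (hk_dim J n <= hk_dim (colon J t) n + hk_dim (idsum J t) n)%N /\
  (hk_dim (colon J t) n + hk_dim (idsum J t) n <=
     hk_dim J n + hk_dim (idsum (colon J t) t) n)%N.
Proof.
move=> JI; have cI := ideal_colon t JI; have tI := ideal_idsum t JI.
have FI := ideal_fpow n.
set S := idadd J (fpow n); set A := idadd (colon J t) (fpow n).
set B := idadd (idsum J t) (fpow n).
have SI : is_ideal S by exact: ideal_hk.
have AI : is_ideal A by exact: ideal_hk.
have BI : is_ideal B by exact: ideal_hk.
have SS := ideal_subspace SI; have AS := ideal_subspace AI; have BS := ideal_subspace BI.
have SA : S `<=` A.
  by apply: idadd_min => //; [apply: subset_trans (colon_sub t JI) _; exact: idadd_subl|exact: idadd_subr].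
have SB : S `<=` B.
  by apply: idadd_min => //; [apply: subset_trans (@idsum_sub _ J t) _; exact: idadd_subl|exact: idadd_subr].
have fSI := findim_hk n JI.
have csI := ideal_colon t SI; have isI := ideal_idsum t SI.
rewrite /hk_dim -/S -/A -/B; split.
  have e : qdim setT S = (qdim setT (idsum S t) + qdim setT (colon S t))%N.
    exact: qdim_colon.
  have l1 : (qdim setT (colon S t) <= qdim setT A)%N.
    apply: qdimS => //; [exact: ideal_subspace| |exact: findim_hk].
    apply: idadd_min => // [x Jx|]; first by apply: idadd_subl.
    by apply: subset_trans (colon_sub t SI); apply: idadd_subr.
  have l2 : (qdim setT (idsum S t) <= qdim setT B)%N.
    apply: qdimS => //; [exact: ideal_subspace| |exact: findim_hk].
    apply: idadd_min => //.
      apply: idsum_min => //; last exact: idsum_gen.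
      by apply: subset_trans (@idsum_sub _ _ _); apply: idadd_subl.
    by apply: subset_trans (@idsum_sub _ _ _); apply: idadd_subr.
  by rewrite e addnC; apply: leq_add.
pose AB := A `&` B; pose D := sumsp B A.
have ABS : subspace AB.
  split=> [|a x y [Ax Bx] [Ay By]]; first by split; apply: subspace0.
  by split; [apply: AS.2|apply: BS.2].
have DS : subspace D by exact: subspace_sumsp.
have SAB : S `<=` AB by move=> x Sx; split; [apply: SA|apply: SB].
have fAB : findim setT AB by apply: findimS fSI.
have fA := findim_hk n cI.
have fBA : findim B A by apply: findimS fA.
have fBAB : findim B AB by apply: findimS fAB.
have e1 : qdim setT A = (qdim setT D + qdim D A)%N.
  by apply: qdim_add => //; apply: sumsp_subr; apply: subspace0.
have e2 : qdim D A = qdim B A by exact: qdim_sumsp.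
have e3 : (qdim B A <= qdim B AB)%N by apply: qdimS => // x [].
have e4 : qdim setT AB = (qdim setT B + qdim B AB)%N by apply: qdim_add => // x [].
have e5 : (qdim setT AB <= qdim setT S)%N by exact: qdimS.
have e6 : (qdim setT D <= qdim setT (idadd (idsum (colon J t) t) (fpow n)))%N.
  have ctI := ideal_idsum t cI.
  apply: qdimS => //; [exact: subspace_hk| |exact: findim_hk].
  move=> _ [_ [z [[x [r [Jx ->]]] fz ->]]].
  rewrite -addrA addrC; exists (t * r + z), x; split=> //; last exact: idadd_subl.
  by exists (t * r), z; split=> //; apply: idsum_mem.
by rewrite e1 e2; lia.
Qed.

Variable K : realType.

Definition hk_cvg J := cvgn (@hkseq K p d (hk_dim J)).

Lemma hk_cvg_small J : hom J -> upper d J ->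
  @hkseq K p d (hk_dim J) @ \oo --> (0 : K).
Proof.
by move=> JH /(hk_dim_upper JH)[C hC]; apply: (@hkseq_small K p d p_gt1 (hk_dim J) C hC).
Qed.

Lemma hk_cvg_prime P : hprime P -> lower d.+1 P -> hk_cvg P.
Proof.
move=> PP lP; have [PH Pp] := PP; have PI := hom_ideal PH.
have [I1|nI1] := pselect (I 1).
  have h0 n : hk_dim P n = 0%N.
    rewrite /hk_dim qdim_sub0 //; first exact: subspace_hk.
    move=> x _; apply: idadd_subr => //; suff -> : fpow n = setT by [].
    apply: ideal1 (ideal_fpow n) _; rewrite -(expr1n _ (p ^ n)).
    exact: frobenius_power_mem.
  apply/cvg_ex; exists 0; apply: (@hkseq_small _ _ _ p_gt1 _ 0) => n.
  by rewrite h0.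
have [r [C hr]] := @hk_dim_rank P P 1 PP PI (fun x Px => idealX PI (frob_gt0 pR 1) Px).
have [D hD] := hk_dim_upper PH (hom_upper HG R_upper PH).
have [c hc] := hk_dim_lower PP lP nI1.
have rp : (r <= p ^ d.+1)%N.
  apply: (@rank_le p d p_gt1 (hk_dim P) r (maxn C D) c.+1) => // n.
  - by apply: leq_trans (hD n) _; rewrite leq_mul2r leq_maxr orbT.
  - by apply: leq_trans (hc n) _; rewrite leq_mul2r leqnSn orbT.
  - have [_] := hr n; rewrite addn1 => h; apply: leq_trans h _.
    by rewrite leq_add2l leq_mul2r leq_maxl orbT.
apply: (@hkseq_upper_cvg _ _ _ p_gt1 _ C) => n.
have [h _] := hr n; rewrite addn1 in h; apply: leq_trans h _.
by rewrite leq_add2r leq_mul2r rp orbT.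
Qed.

Theorem hk_cvg_hom J : hom J -> hk_cvg J.
Proof.
move=> JH; move: (JH); have := hom_ideal JH; move: J {JH}.
apply: (noetherian_ind RN) => J JI IH JH.
have [uJ|[P [PP JP lP]]] := upper_or_prime HG RN R_upper JH.
  by apply/cvg_ex; exists 0; apply: hk_cvg_small.
have [PH Pp] := PP.
have [[e PJ]|nPJ] := pselect (exists e, forall x, P x -> J (x ^+ (p ^ e))).
  have [r [C hr]] := hk_dim_rank PP JI PJ.
  have [l hl] := (cvg_ex _).1 (hk_cvg_prime PP lP).
  apply: (@hkseq_shift _ _ _ _ e (r%:R * l)).
  apply: (@hkseq_near _ _ _ p_gt1 (fun n => r * hk_dim P n)%N _ C); [by move=> n; case: (hr n)..|].
  have -> : hkseq K p d (fun n => r * hk_dim P n)%N = fun n => r%:R * hkseq K p d (hk_dim P) n.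
    by apply/funext => n; rewrite /hkseq natrM mulrA.
  by apply: cvgM hl; exact: cvg_cst.
have [s [t [e [Gt nPt tP]]]] := primary_element HG RN R_upper pR PP lP JH JP.
have cH := hom_colon HG Gt JH; have tH := hom_idsum HG Gt JH.
have nJt : ~ J t by move/JP.
have [l1 h1] : exists l, hkseq K p d (hk_dim (colon J t)) @ \oo --> (l : K).
  apply/cvg_ex/IH => //; first exact: hom_ideal cH.
  split; first exact: colon_sub.
  (* If J:t were equal to [J], then t x^(p^e) in [J] would give x^(p^e) in [J] for all x in [P], the
     case already treated. *)
  by move=> cJ; apply: nPJ; exists e => x Px; apply: cJ; apply: tP.
have [l2 h2] : exists l, hkseq K p d (hk_dim (idsum J t)) @ \oo --> (l : K).
  by apply/cvg_ex/IH => //; [exact: hom_ideal tH|exact: idsum_proper].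
have ctH := hom_idsum HG Gt cH.
have [u|[P' [PP' ctP' lP']]] := upper_or_prime HG RN R_upper ctH; last first.
  (* A prime over (J:t)+(t) contains [P], because x^(p^e) lies in J:t for x in [P], and contains
     [t], which is not in [P]. Being strictly larger than [P], it has smaller growth. *)
  exfalso; apply: (lower_not_upper lP').
  apply: (upper_prime_proper HG RN R_upper PP PP'); split=> [x Px|].
    have [_ Pp'] := PP'; apply: (prime_exp (n := p ^ e) Pp').
    by apply/ctP'/idsum_sub/tP.
  by move=> P'P; apply/nPt/P'P/ctP'/idsum_gen/hom_ideal/cH.
have [C hC] := hk_dim_upper ctH u.
apply/cvg_ex; exists (l1 + l2).
apply: (@hkseq_near _ _ _ p_gt1 (fun n => hk_dim (colon J t) n + hk_dim (idsum J t) n)%N _ C).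
- move=> n; have [h _] := hk_dim_colon t n JI; apply: leq_trans h _; exact: leq_addr.
- by move=> n; have [_ h] := hk_dim_colon t n JI; apply: leq_trans h _; rewrite leq_add2l.
- exact: hkseqD.
Qed.

End HilbertKunz.

(** * Hilbert's basis theorem *)

Section HilbertBasis.
Variable R : comNzRingType.
Implicit Types (A I L : set R) (t : R).

(** Rings are subsets of the fixed ring [R], so that generators can be adjoined without polynomial
    rings and quotients. *)
Definition subring A : Prop := [/\ A 1, forall x y, A x -> A y -> A (x - y) &
  forall x y, A x -> A y -> A (x * y)].

Definition ideal_of A I : Prop := [/\ I `<=` A, I 0 &
  forall a x y, A a -> I x -> I y -> I (a * x + y)].

Definition noetherian_ring A : Prop := forall I, ideal_of A I ->
  exists s : seq R, [set` s] `<=` I /\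
    forall L, ideal_of A L -> [set` s] `<=` L -> I `<=` L.

Lemma subring0 A : subring A -> A 0.
Proof. by case=> A1 AB _; rewrite -(subrr 1); apply: AB. Qed.

Lemma subringN A x : subring A -> A x -> A (- x).
Proof. by move=> AS Ax; have [_ AB _] := AS; rewrite -[- x]add0r; apply: AB => //; apply: subring0. Qed.

Lemma subringD A x y : subring A -> A x -> A y -> A (x + y).
Proof. by move=> AS Ax Ay; have [_ AB _] := AS; rewrite -[y]opprK; apply: AB => //; apply: subringN. Qed.

Lemma ideal_of_sub A I x y : subring A -> ideal_of A I -> I x -> I y -> I (x - y).
Proof.
move=> AS [_ _ IL] Ix Iy; rewrite addrC -mulN1r; apply: IL => //.
by apply: subringN => //; case: AS.
Qed.

Lemma ideal_ofM A I a x : ideal_of A I -> A a -> I x -> I (a * x).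
Proof. by move=> [_ I0 IL] Aa Ix; rewrite -[_ * _]addr0; apply: IL. Qed.

Section Adjoin.
Variables (A : set R) (t : R).
Hypothesis A_subring : subring A.

(** Values at [t] of polynomials of degree below [n] over [A]. Such expressions need not be unique,
    and [lead] collects the leading coefficients of all of them. *)
Fixpoint polys n : set R :=
  if n is m.+1 then [set y | exists a g, [/\ A a, polys m g & y = a * t ^+ m + g]]
  else [set 0].

Definition adjoin : set R := [set y | exists n, polys n y].

Lemma polys0 n : polys n 0.
Proof.
elim: n => [|n IH] //; exists 0, 0; rewrite mul0r addr0; split=> //.
exact: subring0.
Qed.

Lemma polysS n : polys n `<=` polys n.+1.
Proof. by move=> y py; exists 0, y; rewrite mul0r add0r; split=> //; apply: subring0. Qed.

Lemma polys_leq m n : (m <= n)%N -> polys m `<=` polys n.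
Proof.
move/subnK <-; elim: (n - m)%N => // d IH; apply: subset_trans IH _.
exact: polysS.
Qed.

Lemma polysB n x y : polys n x -> polys n y -> polys n (x - y).
Proof.
have [_ AB _] := A_subring.
elim: n x y => [|n IH] x y /=; first by move=> -> ->; rewrite subrr.
move=> [a [g [Aa pg ->]]] [b [h [Ab ph ->]]].
exists (a - b), (g - h); split; [exact: AB|exact: IH|].
by rewrite mulrBl opprD addrACA.
Qed.

Lemma polysD n x y : polys n x -> polys n y -> polys n (x + y).
Proof.
move=> px py; rewrite -[y]opprK -[- y]add0r; apply: polysB => //.
by apply: polysB => //; apply: polys0.
Qed.

Lemma polysM n a y : A a -> polys n y -> polys n (a * y).
Proof.
have [_ _ AM] := A_subring.
elim: n y => [|n IH] y Aa /=; first by move=> ->; rewrite mulr0.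
move=> [b [g [Ab pg ->]]]; exists (a * b), (a * g).
by rewrite mulrDr mulrA; split=> //; [apply: AM|apply: IH].
Qed.

Lemma polysX n m y : polys n y -> polys (n + m) (t ^+ m * y).
Proof.
elim: n y => [|n IH] y /=; first by move=> ->; rewrite mulr0; apply: polys0.
move=> [b [g [Ab pg ->]]]; exists b, (t ^+ m * g).
by rewrite mulrDr mulrCA -exprD [(m + n)%N]addnC; split=> //; apply: IH.
Qed.

Lemma polys_mul n m x y : polys n x -> polys m y -> polys (n + m) (x * y).
Proof.
elim: n x => [|n IH] x; first by move=> /= -> _; rewrite mul0r; apply: polys0.
move=> [a [g [Aa pg ->]]] py; rewrite mulrDl -mulrA addSn; apply: polysD; last first.
  by apply: polysS; apply: IH.
by apply: polysS; rewrite addnC; apply: polysM => //; apply: polysX.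
Qed.

Lemma polys_coef a : A a -> polys 1 a.
Proof. by move=> Aa; exists a, 0; rewrite expr0 mulr1 addr0. Qed.

Lemma adjoin_sub : A `<=` adjoin.
Proof. by move=> a Aa; exists 1%N; apply: polys_coef. Qed.

Lemma adjoin_exp n : adjoin (t ^+ n).
Proof.
exists n.+1, 1, 0; rewrite mul1r addr0; split=> //; first by case: A_subring.
exact: polys0.
Qed.

Lemma subring_adjoin : subring adjoin.
Proof.
split; first by apply: adjoin_sub; case: A_subring.
  move=> x y [n px] [m py]; exists (maxn n m); apply: polysB.
    exact: polys_leq (leq_maxl _ _) _ px.
  exact: polys_leq (leq_maxr _ _) _ py.
by move=> x y [n px] [m py]; exists (n + m)%N; apply: polys_mul.
Qed.

Definition lead I n : set R :=
  [set a | A a /\ exists f g, [/\ I f, polys n g & f = a * t ^+ n + g]].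

Lemma ideal_lead I n : ideal_of adjoin I -> ideal_of A (lead I n).
Proof.
move=> [IA I0 IL]; have [_ _ AM] := A_subring; split=> [a []//||].
  split; first exact: subring0.
  by exists 0, 0; rewrite mul0r addr0; split=> //; apply: polys0.
move=> a x y Aa [Ax [f [g [If pg fE]]]] [Ay [f' [g' [If' pg' fE']]]].
split; first by apply: subringD => //; apply: AM.
exists (a * f + f'), (a * g + g'); split.
- by apply: IL => //; apply: adjoin_sub.
- by apply: polysD => //; apply: polysM.
- by rewrite fE fE' mulrDr mulrDl mulrA addrACA.
Qed.

Lemma leadX I n m : ideal_of adjoin I -> lead I n `<=` lead I (n + m).
Proof.
move=> II a [Aa [f [g [If pg fE]]]]; split=> //.
exists (t ^+ m * f), (t ^+ m * g); split; last by rewrite fE mulrDr mulrCA -exprD addnC.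
  by apply: ideal_ofM II _ If; apply: adjoin_exp.
exact: polysX.
Qed.

(** Hilbert's argument: the ideals [lead I n] increase, their union is reached at some [N], and
    lifts of generators of [lead I j] for j <= N generate [I]. *)
Lemma noetherian_adjoin : noetherian_ring A -> noetherian_ring adjoin.
Proof.
move=> NA I II; have [IA I0 IL] := II.
pose U : set R := [set a | exists n, lead I n a].
have lead_leq n m : (n <= m)%N -> lead I n `<=` lead I m.
  by move/subnKC <-; apply: leadX.
have UI : ideal_of A U.
  split=> [a [n []]//||a x y Aa [n lx] [m ly]].
    by exists 0%N; have [] := ideal_lead 0 II.
  exists (maxn n m); have [_ _ h] := ideal_lead (maxn n m) II.
  apply: h => //; first exact: lead_leq (leq_maxl _ _) _ lx.
  exact: lead_leq (leq_maxr _ _) _ ly.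
have [s [sU sgen]] := NA _ UI.
have [N sN] : exists N, [set` s] `<=` lead I N.
  elim: s sU {sgen} => [|y s IH] sU; first by exists 0%N.
  have [N sN] : exists N, [set` s] `<=` lead I N.
    by apply: IH => x xs; apply: sU; rewrite /= inE; apply/orP; right.
  have [i yi] : U y by apply: sU; rewrite /= mem_head.
  exists (maxn i N) => x; rewrite /= inE => /orP[/eqP->|xs].
    exact: lead_leq (leq_maxl _ _) _ yi.
  exact: lead_leq (leq_maxr _ _) _ (sN x xs).
have UN : U `<=` lead I N by apply: sgen => //; apply: ideal_lead.
have [gen hgen] := choice (fun j => NA _ (ideal_lead j II)).
have [F hF] : exists F : nat -> R -> R, forall j x, lead I j x ->
    I (F j x) /\ exists g, polys j g /\ F j x = x * t ^+ j + g.
  have h (jx : nat * R) : exists f, lead I jx.1 jx.2 ->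
      I f /\ exists g, polys jx.1 g /\ f = jx.2 * t ^+ jx.1 + g.
    have [[_ [f [g [If pg fE]]]]|nl] := pselect (lead I jx.1 jx.2); last by exists 0.
    by exists f => _; split=> //; exists g.
  have [F hF] := choice h; exists (fun j x => F (j, x)) => j x.
  exact: (hF (j, x)).
exists [seq F j x | j <- iota 0 N.+1, x <- gen j]; split.
  move=> y; rewrite /mkset => /allpairsPdep[j [x [_ xg ->]]].
  by have [] := hF j x ((hgen j).1 x xg).
move=> I' II' SI'.
have FI' j x : (j <= N)%N -> x \in gen j -> I' (F j x).
  move=> jN xg; apply: SI'; rewrite /mkset; apply/allpairsPdep; exists j, x.
  by rewrite mem_iota.
have IS := subring_adjoin.
have key n a : lead I n a -> exists f g, [/\ I f, I' f, polys n g & f = a * t ^+ n + g].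
  have smallkey m b : (m <= N)%N -> lead I m b ->
      exists f g, [/\ I f, I' f, polys m g & f = b * t ^+ m + g].
    move=> mN lb.
    (* The generators of [lead I m] are leading coefficients of lifts that lie in both ideals, so
       every element of [lead I m] is a leading coefficient from [I2]. *)
    pose I2 := I `&` I'.
    have II2 : ideal_of adjoin I2.
      have [_ I'0 I'L] := II'; split=> [x [/IA]//||a' x y Aa' [Ix I'x] [Iy I'y]].
        by split.
      by split; [apply: IL|apply: I'L].
    have : lead I2 m b.
      apply: ((hgen m).2 _ (ideal_lead m II2)) lb => x xg.
      have lx := (hgen m).1 x xg; have [IF [g [pg Fe]]] := hF m x lx.
      split; first by case: lx.
      by exists (F m x), g; split=> //; split=> //; apply: FI'.
    by move=> [_ [f [g [[If I'f] pg fE]]]]; exists f, g.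
  move=> la; have [nN|Nn] := leqP n N; first exact: smallkey.
  have [f [g [If I'f pg fE]]] := smallkey N a (leqnn N) (UN _ (ex_intro _ n la)).
  rewrite -(subnKC (ltnW Nn)); exists (t ^+ (n - N) * f), (t ^+ (n - N) * g); split.
  - by apply: ideal_ofM II _ If; apply: adjoin_exp.
  - by apply: ideal_ofM II' _ I'f; apply: adjoin_exp.
  - exact: polysX.
  - by rewrite fE mulrDr mulrCA -exprD addnC.
have II'n n f : polys n f -> I f -> I' f.
  elim: n f => [|n IH] f; first by move=> -> _; case: II'.
  move=> [a [g [Aa pg fE]]] If.
  have [f' [g' [If' I'f' pg' fE']]] : exists f g, [/\ I f, I' f, polys n g & f = a * t ^+ n + g].
    by apply: key; split=> //; exists f, g.
  have -> : f = 1 * (f - f') + f' by rewrite mul1r subrK.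
  have [_ _ I'L] := II'; apply: I'L => //; first by case: IS.
  apply: IH; last exact: ideal_of_sub IS II If If'.
  rewrite fE fE' opprD addrACA subrr add0r; exact: polysB.
by move=> f If; have [n pf] := IA _ If; exact: II'n pf If.
Qed.

End Adjoin.

End HilbertBasis.

Lemma hilbert_basis (k : fieldType) (R : comAlgType k) (s : seq R) :
  smallest (fun S : set R => GRing.subalg_closed (mem S)) [set` s] = setT ->
  noetherian R.
Proof.
move=> sT.
pose A0 : set R := range (fun a : k => a%:A).
have A0S : subring A0.
  split; first by exists 1; rewrite ?scale1r.
    by move=> _ _ [a _ <-] [b _ <-]; exists (a - b); rewrite ?scalerBl.
  by move=> _ _ [a _ <-] [b _ <-]; exists (a * b); rewrite // mulr_algl scalerA.
have A0N : noetherian_ring A0.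
  move=> I [IA I0 IL].
  have [[x [Ix x0]]|h] := pselect (exists x, I x /\ x != 0); last first.
    exists [::]; split=> // L [_ L0 _] _ x Ix.
    suff -> : x = 0 by [].
    by apply: contrapT => /eqP x0; apply: h; exists x.
  have [a _ xE] := IA _ Ix.
  have a0 : a != 0 by apply: contraNneq x0 => a0; rewrite -xE a0 scale0r.
  have I1 : I 1.
    rewrite -[1]addr0 -[1](scale1r 1) -(mulVf a0) -scalerA xE -[x]mul1r scalerAl.
    by apply: IL => //; exists a^-1.
  exists [:: 1]; split=> [y|L [LA L0 LL] sL y Iy]; first by rewrite /= inE => /eqP->.
  rewrite -[y]mulr1 -[_ * _]addr0; apply: LL => //; first exact: IA.
  by apply: sL; rewrite /= inE.
have [A [AS NA A0A sA]] : exists A, [/\ subring A, noetherian_ring A, A0 `<=` A & [set` s] `<=` A].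
  elim: s {sT} => [|t s [A [AS NA A0A sA]]]; first by exists A0; split.
  exists (adjoin A t); split; [exact: subring_adjoin|exact: noetherian_adjoin| |].
    by apply: subset_trans A0A _; apply: adjoin_sub.
  move=> x; rewrite /= inE => /orP[/eqP->|/sA]; last exact: adjoin_sub.
  by rewrite -[t]expr1; apply: adjoin_exp.
have AT : A = setT.
  apply/seteqP; split=> // x _.
  have : (smallest (fun S : set R => GRing.subalg_closed (mem S)) [set` s]) x by rewrite sT.
  have [A1 _ AM] := AS; apply; split=> //; split=> [|a u v|u v]; rewrite !in_setE //.
    move=> Au Av; apply: (subringD AS) => //; rewrite -mulr_algl; apply: AM => //.
    by apply: A0A; exists a.
  exact: AM.
move=> I II.
have [|s' [sI sgen]] := NA I; first split.
- by rewrite AT.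
- exact: ideal0.
- by move=> a x y _ Ix Iy; apply: idealD => //; apply: idealM.
exists s'; apply/seteqP; split; last exact: gen_min.
apply: sgen; last exact: gen_sub.
have GI := ideal_gen [set` s']; split; [by rewrite AT|exact: ideal0|].
by move=> a x y _ Ix Iy; apply: (idealD GI) => //; apply: (idealM _ GI).
Qed.

(** * Tensor products *)

Lemma funext_dep (A : Type) (B : A -> Type) (f g : forall x, B x) :
  (forall x, f x = g x) -> f = g.
Proof. exact: functional_extensionality_dep. Qed.

Lemma prod_sum_fprod (S : comPzSemiRingType) (I : finType) (J : I -> finType)
    (F : forall i, J i -> S) :
  \prod_i \sum_j F i j = \sum_(g : fprod J) \prod_i F i (g i).
Proof.
pose P i : {ffun J i -> S} := [ffun j => F i j].
transitivity (\prod_i \sum_j P i j).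
  by apply: eq_bigr => i _; apply: eq_bigr => j _; rewrite ffunE.
transitivity (\sum_(g : fprod J) \prod_i P i (g i)); last first.
  by apply: eq_bigr => g _; apply: eq_bigr => i _; rewrite ffunE.
rewrite (big_fprod _ _ P).
under eq_bigr do rewrite (big_tag (fun i => P i)).
exact: bigA_distr_big_dep.
Qed.

(** * A subspace as a module, to serve as target of the universal property *)

Section SubspaceModule.
Variables (k : fieldType) (T : lmodType k) (W : set T).
Hypothesis W_subspace : subspace W.

Let Wp : pred T := mem W.

Let Wp_closed : GRing.subsemimod_closed Wp.
Proof. exact/GRing.submod_closed_semi/submod_closedP. Qed.

Record subspace_type := SubspaceElt { subspace_val : T; _ : Wp subspace_val }.

HB.instance Definition _ := [isSub for subspace_val].
HB.instance Definition _ := [Choice of subspace_type by <:].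
HB.instance Definition _ :=
  GRing.SubChoice_isSubLmodule.Build k T Wp subspace_type Wp_closed.

Lemma subspace_module : exists (V : lmodType k) (f : V -> T),
  [/\ linear f, injective f, forall v, W (f v) & forall x, W x -> exists v, f v = x].
Proof.
exists subspace_type, (@subspace_val); split.
- by move=> a x y; rewrite -[subspace_val]/(val : subspace_type -> T) linearP.
- exact: (@val_inj _ _ subspace_type).
- by case=> x Wx; move: Wx; rewrite /Wp /= in_setE.
- by move=> x Wx; have Wx' : Wp x by [rewrite /Wp /= in_setE]; exists (SubspaceElt Wx').
Qed.

End SubspaceModule.

Section TensorProduct.
Variables (k : fieldType) (n : nat) (R : 'I_n -> comAlgType k).
Variables (T : comAlgType k) (tens : (forall i, R i) -> T).
Hypothesis T_tensor : is_tensor_product tens.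

Let tlin : multilinear tens := tensor_multilinear T_tensor.

Lemma linear_pack (U V : lmodType k) (f : U -> V) : linear f ->
  exists g : {linear U -> V}, g =1 f.
Proof.
move=> fl; pose m := GRing.isLinear.Build _ _ _ _ f fl.
pose g : {linear U -> V} := HB.pack f m.
by exists g.
Qed.

Lemma tensor_functional (V : lmodType k) (phi : (forall i, R i) -> V) :
  multilinear phi -> exists g : T -> V, linear g /\ forall f, g (tens f) = phi f.
Proof.
move=> hphi; have [g [gE _]] := tensor_universal T_tensor hphi.
by exists g; split=> // a x y; rewrite linearP.
Qed.

Lemma tensor_ext (V : lmodType k) (g h : T -> V) : linear g -> linear h ->
  (forall f, g (tens f) = h (tens f)) -> g =1 h.
Proof.
move=> gl hl gh.
have phi_ml : multilinear (g \o tens) by move=> i f a x y; rewrite /= tlin gl.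
have [g0 [_ g0u]] := tensor_universal T_tensor phi_ml.
have [g' g'E] := linear_pack gl; have [h' h'E] := linear_pack hl.
have e1 : g' =1 g0 by apply: g0u => f; rewrite g'E.
have e2 : h' =1 g0 by apply: g0u => f; rewrite h'E -gh.
by move=> x; rewrite -g'E -h'E e1 e2.
Qed.

(** The universal property gives a linear map from T to [W] that fixes pure tensors; followed by the
    inclusion it is the identity, by uniqueness. *)
Lemma tens_span (W : set T) : subspace W -> (forall f, W (tens f)) -> forall y, W y.
Proof.
move=> WS Wt y; have [V [f [fl finj fW Wf]]] := subspace_module WS.
have [phi hphi] := choice (fun g => Wf (tens g) (Wt g)).
have phi_ml : multilinear phi.
  by move=> i g a x z; apply: finj; rewrite fl !hphi tlin.
have [h [hl hE]] := tensor_functional phi_ml.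
have -> : y = f (h y); last exact: fW.
apply: (tensor_ext (g := id) (h := f \o h)) => // [a x z|g] /=.
  by rewrite hl fl.
by rewrite hE hphi.
Qed.

Definition unit_with i (x : R i) : forall j, R j :=
  eqtype.dfwith (fun j => 1 : R j) x.

Definition iota i (x : R i) : T := tens (unit_with x).

Lemma iota_lin i : linear (@iota i).
Proof. by move=> a x y; apply: tlin. Qed.

Lemma tens_big (J : Type) (r : seq J) (F : J -> forall i, R i) :
  tens (fun i => \prod_(j <- r) F j i) = \prod_(j <- r) tens (F j).
Proof.
elim: r => [|j r IH].
  rewrite big_nil -(tensor_one T_tensor); congr tens.
  by apply: funext_dep => i; rewrite big_nil.
rewrite big_cons -IH -(tensor_mul T_tensor); congr tens.
by apply: funext_dep => i; rewrite big_cons.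
Qed.

Lemma tensE f : tens f = \prod_i iota (f i).
Proof.
rewrite /iota -tens_big; congr tens; apply: funext_dep => i.
rewrite (bigD1 i) //= big1 => [|j ji]; first by rewrite mulr1 /unit_with eqtype.dfwith_in.
by rewrite /unit_with eqtype.dfwith_out.
Qed.

Lemma iota1 i : iota (1 : R i) = 1.
Proof.
rewrite -(tensor_one T_tensor); congr tens; apply: funext_dep => j.
by rewrite /unit_with; case: eqtype.dfwithP.
Qed.

Lemma iotaM i (x y : R i) : iota (x * y) = iota x * iota y.
Proof.
rewrite -(tensor_mul T_tensor); congr tens; apply: funext_dep => j.
rewrite /unit_with; have [<-|ji] := eqVneq i j; first by rewrite !eqtype.dfwith_in.
by rewrite !eqtype.dfwith_out // mulr1.
Qed.

Lemma iota0 i : iota (0 : R i) = 0.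
Proof. exact: linear0X (@iota_lin i). Qed.

Lemma iotaX i (x : R i) m : iota (x ^+ m) = iota x ^+ m.
Proof. by elim: m => [|m IH]; rewrite ?expr0 ?iota1 // !exprS iotaM IH. Qed.

Lemma iotaZ i a (x : R i) : iota (a *: x) = a *: iota x.
Proof. by rewrite -[a *: x]addr0 iota_lin iota0 addr0. Qed.

Lemma iotaD i (x y : R i) : iota (x + y) = iota x + iota y.
Proof. by rewrite -[x]scale1r iota_lin !scale1r. Qed.

Lemma iota_sum i (J : Type) (r : seq J) (P : pred J) (F : J -> R i) :
  iota (\sum_(j <- r | P j) F j) = \sum_(j <- r | P j) iota (F j).
Proof. by elim/big_rec2: _ => [|j y x _ <-]; rewrite ?iota0 ?iotaD. Qed.

Lemma tens0 f i : f i = 0 -> tens f = 0.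
Proof. by move=> f0; rewrite tensE (bigD1 i) //= f0 iota0 mul0r. Qed.

(** * The box ideal and the dimension of its quotient *)

Section Box.
Variable A : forall i, set (R i).
Hypothesis A_ideal : forall i, is_ideal (@A i).

Local Notation box := (box_ideal tens A).

Lemma tensor_factor_subspace i : subspace (tensor_factor tens A i).
Proof.
split=> [S [/submod_closedP SS _]|a x y tx ty S SP]; first exact: subspace0.
have [/submod_closedP SS _] := SP.
by apply: SS.2; [exact: tx|exact: ty].
Qed.

Lemma tensor_factor_tens i f : A (f i) -> tensor_factor tens A i (tens f).
Proof. by move=> Af S [_]; apply; exists f. Qed.

Lemma tensor_factor_min i (W : set T) : subspace W ->
  (forall f, A (f i) -> W (tens f)) -> tensor_factor tens A i `<=` W.
Proof.
move=> WS Wt x; apply; split; first exact/submod_closedP.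
by move=> _ [f Af <-]; apply: Wt.
Qed.

Lemma tensor_factor_mul i x y :
  tensor_factor tens A i x -> tensor_factor tens A i (y * x).
Proof.
have FS := tensor_factor_subspace i; move=> Fx; move: y.
apply: tens_span => [|g].
  split=> /= [|a u v Fu Fv]; first by rewrite mul0r; apply: subspace0.
  by rewrite mulrDl -scalerAl; apply: FS.2.
apply: (tensor_factor_min (W := [set x | tensor_factor tens A i (tens g * x)])) Fx.
  split=> /= [|a u v Fu Fv]; first by rewrite mulr0; apply: subspace0.
  by rewrite mulrDr -scalerAr; apply: FS.2.
move=> f Af /=; rewrite -(tensor_mul T_tensor); apply: tensor_factor_tens.
exact: idealM.
Qed.

Lemma box_ideal_ideal : is_ideal box.
Proof.
apply/is_idealP; split.
  exists (fun=> 0); split=> [i|]; last by rewrite big1.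
  exact: subspace0 (tensor_factor_subspace i).
move=> a _ _ [s [Fs ->]] [s' [Fs' ->]]; exists (fun i => a * s i + s' i); split.
  move=> i; apply: (subspaceD (tensor_factor_subspace i)) => //.
  exact: tensor_factor_mul.
by rewrite big_split /= mulr_sumr.
Qed.

Lemma box_factor i x : tensor_factor tens A i x -> box x.
Proof.
move=> Fx; exists (fun j => if j == i then x else 0); split.
  by move=> j; case: eqP => [->|_] //; apply: subspace0 (tensor_factor_subspace j).
by rewrite (bigD1 i) //= eqxx big1 ?addr0 // => j /negPf->.
Qed.

Lemma box_tens i f : A (f i) -> box (tens f).
Proof. by move=> Af; apply: (@box_factor i); apply: tensor_factor_tens. Qed.

Lemma box_iota i (x : R i) : A x -> box (iota x).
Proof. by move=> Ax; apply: (@box_tens i); rewrite /unit_with eqtype.dfwith_in. Qed.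

Lemma box_sub_subspace (W : set T) : subspace W ->
  (forall i f, A (f i) -> W (tens f)) -> box `<=` W.
Proof.
move=> WS Wt _ [s [Fs ->]]; apply: subspace_sum => // i _.
by apply: (tensor_factor_min WS) (Fs i) => f; apply: Wt.
Qed.

Lemma box_min (B : set T) : is_ideal B ->
  (forall i (x : R i), A x -> B (iota x)) -> box `<=` B.
Proof.
move=> BI BA; apply: box_sub_subspace => [|i f Af]; first exact: ideal_subspace.
by rewrite tensE (bigD1 i) //=; apply: idealMr => //; apply: BA.
Qed.

Lemma prod_congr_ideal (B : set T) (J : finType) (x y : J -> T) : is_ideal B ->
  (forall j, B (x j - y j)) -> B (\prod_j x j - \prod_j y j).
Proof.
move=> BI Bxy.
have eqM (u u' v v' : T) : u * v - u' * v' = v * (u - u') + u' * (v - v').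
  by rewrite !mulrBr [v * u]mulrC [v * u']mulrC addrA subrK.
apply: (big_ind2 (fun u v : T => B (u - v))) => [|u u' v v' Bu Bv|j _]; last exact: Bxy.
  by rewrite subrr; apply: ideal0.
by rewrite eqM; apply: idealD => //; apply: idealM.
Qed.

Section BoxDimension.
Variable b : forall i, 'I_(qdim setT (@A i)) -> R i.
Hypothesis b_basis : forall i, basis_mod setT (@A i) (@b i).

Local Notation J := (fprod (fun i => 'I_(qdim setT (@A i)))).

Let e (g : J) : T := tens (fun i => b (g i)).

Lemma box_basis_span : span_mod setT box e.
Proof.
have BI := box_ideal_ideal; have BS := ideal_subspace BI.
suff h y : [set y | exists l : J -> k, box (y - \sum_g l g *: e g)] y.
  by move=> y _; exact: h.
move: y; apply: tens_span => [|f /=].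
  split=> [|c u v [l lu] [l' lv]] /=.
    by exists (fun=> 0); rewrite big1 ?subr0 => [|i _]; [exact: subspace0|rewrite scale0r].
  exists (fun g => c * l g + l' g).
  under eq_bigr do rewrite scalerDl -scalerA.
  rewrite big_split /= -scaler_sumr opprD addrACA -scalerBr.
  exact: BS.2.
have h i : exists l : 'I_(qdim setT (@A i)) -> k, A (f i - \sum_j l j *: b j).
  by have [_ _ sb] := b_basis i; exact: sb.
pose l i := sval (cid (h i)).
have hl i : A (f i - \sum_j l i j *: b j) by exact: svalP (cid (h i)).
exists (fun g => \prod_i l i (g i)).
have -> : \sum_(g : J) (\prod_i l i (g i)) *: e g =
    \prod_i \sum_j l i j *: iota (b j).
  rewrite (@prod_sum_fprod _ _ _ (fun i j => l i j *: iota (b j))).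
  by apply: eq_bigr => g _; rewrite scaler_prod /e tensE.
rewrite tensE; apply: prod_congr_ideal => // i.
have -> : \sum_j l i j *: iota (b j) = iota (\sum_j l i j *: b j).
  by rewrite iota_sum; apply: eq_bigr => j _; rewrite iotaZ.
by rewrite -(linearBX (@iota_lin i)); apply: box_iota.
Qed.

(** The dual basis of R_i/A_i, lifted to functionals on [R i]. *)
Lemma coordinate_exists i : exists l : R i -> 'I_(qdim setT (@A i)) -> k,
  [/\ forall j, linear (fun x => (l x j : k^o)), forall x, A x -> forall j, l x j = 0 &
      forall j j', l (b j) j' = (j == j')%:R].
Proof.
have [_ fb sb] := b_basis i; have AS := ideal_subspace (A_ideal i).
have [l hl] := choice (fun x => sb x Logic.I).
have uniq x m : A (x - \sum_j m j *: b j) -> forall j, l x j = m j.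
  move=> Am j; apply/eqP; rewrite -subr_eq0; apply/eqP.
  apply: (fb (fun j => l x j - m j)).
  under eq_bigr do rewrite scalerBl.
  rewrite sumrB; set L := \sum_j l x j *: _; set M := \sum_j m j *: _.
  have -> : L - M = (x - M) - (x - L) by rewrite opprB [RHS]addrC addrA subrK.
  exact: subspaceB.
exists l; split.
- move=> j a x y; apply: (uniq _ (fun j => a *: (l x j : k^o) + l y j)).
  under eq_bigr do rewrite scalerDl -scalerA.
  by rewrite big_split /= -scaler_sumr opprD addrACA -scalerBr; apply: AS.2.
- move=> x Ax j; apply: (uniq _ (fun=> 0)).
  by rewrite big1 ?subr0 // => j' _; rewrite scale0r.
- move=> j j'; apply: (uniq _ (fun j' => (j == j')%:R)).
  rewrite (bigD1 j) //= eqxx scale1r big1 ?addr0 ?subrr; first exact: subspace0.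
  by move=> i' /negPf; rewrite eq_sym => ->; rewrite scale0r.
Qed.

(** A product of dual coordinates is multilinear. The functional it induces on T vanishes on the box
    ideal and picks out one coefficient of a relation. *)
Lemma box_basis_free : free_mod box e.
Proof.
have hl i := coordinate_exists i.
pose l i := sval (cid (hl i)).
have lin i j : linear (fun x => (l i x j : k^o)).
  by have [h _ _] := svalP (cid (hl i)); exact: h.
have lA i x j : A x -> l i x j = 0.
  by have [_ h _] := svalP (cid (hl i)) => Ax; exact: h.
have lb i j j' : l i (b j) j' = (j == j')%:R.
  by have [_ _ h] := svalP (cid (hl i)); exact: h.
move=> c Bc g.
pose phi f : k^o := \prod_i l i (f i) (g i).
have phi_ml : multilinear phi.
  move=> i f a x y; rewrite /phi !(bigD1 i (P := predT)) //= !eqtype.dfwith_in.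
  have -> : l i (a *: x + y) (g i) = a * l i x (g i) + l i y (g i) := lin i (g i) a x y.
  rewrite /GRing.scale /= mulrDl -mulrA; congr (a * (_ * _) + _ * _).
    by apply: eq_bigr => j ji; rewrite !eqtype.dfwith_out // eq_sym.
  by apply: eq_bigr => j ji; rewrite !eqtype.dfwith_out // eq_sym.
have [G [Gl GE]] := tensor_functional phi_ml.
have GB : box `<=` [set x | G x = 0].
  apply: box_sub_subspace => [|i f Af] /=.
    by split=> /= [|a u v Gu Gv]; [exact: (linear0X Gl)|rewrite Gl Gu Gv scaler0 addr0].
  by rewrite GE /phi (bigD1 i) //= lA // mul0r.
have Ge g' : G (e g') = (g' == g)%:R.
  rewrite GE /phi; have [->|] := eqVneq g' g; first by apply: big1 => i _; rewrite lb eqxx.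
  move=> gg; have [i gi] : exists i, g' i != g i.
    apply: contrapT => h; move/eqP: gg; apply; apply/fprodP => i.
    by apply: contrapT => /eqP gi; apply: h; exists i.
  by rewrite (bigD1 i) //= lb (negPf gi) mul0r.
have := GB _ Bc; rewrite /= (linearX Gl) (bigD1 g) //= Ge eqxx big1 => [|g' gg].
  by rewrite addr0 => <-; rewrite /GRing.scale /= mulr1.
by rewrite Ge (negPf gg) scaler0.
Qed.

End BoxDimension.

Hypothesis A_findim : forall i, findim setT (@A i).

Lemma box_dimension : findim setT box /\
  qdim setT box = (\prod_i qdim setT (@A i))%N.
Proof.
have BS := ideal_subspace box_ideal_ideal.
have hb i := findim_basis (A_findim i).
pose b i := sval (cid (hb i)).
have b_basis i : basis_mod setT (@A i) (b i) by exact: svalP (cid (hb i)).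
have h : basis_mod setT box (fun g : fprod (fun i => 'I_(qdim setT (@A i))) => tens (fun i => b i (g i))).
  by split=> //; [exact: box_basis_free|exact: box_basis_span].
split; first exact: basis_findim h.
by rewrite (basis_qdim BS h) card_fprod; apply: eq_bigr => i _; rewrite card_ord.
Qed.

End Box.

End TensorProduct.

(** * The total grading on the tensor product *)

Section TensorGrading.
Variables (k : fieldType) (n : nat) (R : 'I_n -> comAlgType k).
Variables (T : comAlgType k) (tens : (forall i, R i) -> T).
Hypothesis T_tensor : is_tensor_product tens.
Variable G : forall i, nat -> set (R i).
Hypothesis HG : forall i, standard_graded (@G i).

Local Notation iota := (iota tens).

Definition tgrade m : set T := [set x | forall W : set T, subspace W ->
  (forall (a : 'I_n -> nat) f, (\sum_i a i)%N = m ->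
     (forall i, @G i (a i) (f i)) -> W (tens f)) -> W x].

Lemma tgrade_subspace m : subspace (tgrade m).
Proof.
split=> [W WS _|a x y tx ty W WS Wt]; first exact: subspace0.
by apply: WS.2; [exact: tx|exact: ty].
Qed.

Lemma tgrade_tens (a : 'I_n -> nat) f :
  (forall i, @G i (a i) (f i)) -> tgrade (\sum_i a i) (tens f).
Proof. by move=> Gf W _; apply. Qed.

Lemma multilinear_tens_map (c : forall i, R i -> R i) : (forall i, linear (c i)) ->
  multilinear (fun f => tens (fun i => c i (f i))).
Proof.
move=> cl i f a x y.
have cE z : (fun j => c j (eqtype.dfwith f z j)) =
    eqtype.dfwith (fun j => c j (f j)) (c i z).
  apply: funext_dep => j; have [<-|ij] := eqVneq i j; first by rewrite !eqtype.dfwith_in.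
  by rewrite !eqtype.dfwith_out.
by rewrite !cE cl; apply: (tensor_multilinear T_tensor).
Qed.

Lemma multilinear_sum (V : lmodType k) (J : Type) (r : seq J) (P : pred J)
    (phi : J -> (forall i, R i) -> V) : (forall j, multilinear (phi j)) ->
  multilinear (fun f => \sum_(j <- r | P j) phi j f).
Proof.
move=> ml i f a x y; rewrite scaler_sumr -big_split; apply: eq_bigr => j _.
exact: ml.
Qed.

(** Directness of the grading needs linear projections on T, and these come from the universal
    property: sum the tensors of components over all multidegrees of total degree [m]. *)
Lemma tgrade_projection m : exists pr : T -> T, linear pr /\
  forall m' x, tgrade m' x -> pr x = if m' == m then x else 0.
Proof.
pose phi f := \sum_(a : {ffun 'I_n -> 'I_m.+1} | (\sum_i a i)%N == m)
  tens (fun i => comp (@G i) (f i) (a i)).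
have phi_ml : multilinear phi.
  apply: multilinear_sum => a; apply: (multilinear_tens_map (c := fun i x => comp (@G i) x (a i))) => i.
  exact: comp_linear.
have [pr [prl prE]] := tensor_functional T_tensor phi_ml.
exists pr; split=> // m' x tx.
pose W := [set x | pr x = if m' == m then x else 0].
suff : W x by [].
apply: tx.
  split=> [|a u v]; rewrite /W /=; first by rewrite (linear0X prl); case: ifP.
  by move=> pu pv; rewrite prl pu pv; case: ifP => // _; rewrite scaler0 addr0.
move=> a f am Gf; rewrite /W /= prE /phi.
have tE (b : {ffun 'I_n -> 'I_m.+1}) :
    tens (fun i => comp (@G i) (f i) (b i)) =
    if [forall i, b i == a i :> nat] then tens f else 0.
  case: ifP => [/forallP ba|/negbT].
    congr tens; apply: funext_dep => i.
    by rewrite (comp_homog (HG i) _ (Gf i)) ba.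
  rewrite negb_forall => /existsP[i bi]; apply: (tens0 T_tensor (i := i)).
  by rewrite (comp_homog (HG i) _ (Gf i)) (negPf bi).
under eq_bigr do rewrite tE.
case: ifP => [/eqP mm|mm].
  have am' i : (a i < m.+1)%N by rewrite ltnS -mm -am (bigD1 i) //= leq_addr.
  pose b : {ffun 'I_n -> 'I_m.+1} := [ffun i => Ordinal (am' i)].
  have bE : [forall i, b i == a i :> nat] by apply/forallP => i; rewrite ffunE.
  rewrite (bigD1 b) /=; last first.
    apply/eqP; transitivity m'; last exact: mm.
    by rewrite -[RHS]am; apply: eq_bigr => i _; rewrite ffunE.
  rewrite bE big1 ?addr0 // => c /andP[_ cb]; case: ifP => // /forallP ca.
  case/negP: cb; apply/eqP/ffunP => i; apply/val_inj; rewrite ffunE /=; exact/eqP.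
apply: big1 => b /eqP bm; case: ifP => // /forallP ba.
case/negP: mm; apply/eqP; transitivity (\sum_i b i)%N; last exact: bm.
by rewrite -[LHS]am; apply: eq_bigr => i _; apply/esym/eqP; exact: ba.
Qed.

Lemma tens_decomposition f : exists N : nat,
  tens f = \sum_(a : {ffun 'I_n -> 'I_N}) tens (fun i => comp (@G i) (f i) (a i)).
Proof.
have h i : exists N, forall M, (N <= M)%N -> f i = \sum_(j < M) comp (@G i) (f i) j.
  exact: comp_sum.
have [N hN] := choice h.
exists (\max_i N i); rewrite (tensE T_tensor).
transitivity (\prod_i \sum_(j < \max_i N i) iota (comp (@G i) (f i) j)).
  apply: eq_bigr => i _; rewrite -(iota_sum T_tensor) -hN //.
  exact: (leq_bigmax i).
rewrite bigA_distr_bigA; apply: eq_bigr => a _.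
by rewrite (tensE T_tensor).
Qed.

Lemma tgrade_one : tgrade 0 1.
Proof.
have := @tgrade_tens (fun=> 0%N) (fun i => 1) (fun i => G1_one (HG i)).
by rewrite big1 // (tensor_one T_tensor).
Qed.

Lemma tgrade_mul a b x y : tgrade a x -> tgrade b y -> tgrade (a + b) (x * y).
Proof.
have TS := tgrade_subspace (a + b).
move=> tx ty; apply: (tx [set x | tgrade (a + b) (x * y)]).
  split=> /= [|c u v tu tv]; first by rewrite mul0r; apply: subspace0.
  by rewrite mulrDl -scalerAl; apply: TS.2.
move=> a' f fa Gf; apply: (ty [set y | tgrade (a + b) (tens f * y)]).
  split=> /= [|c u v tu tv]; first by rewrite mulr0; apply: subspace0.
  by rewrite mulrDr -scalerAr; apply: TS.2.
move=> b' g gb Gg /=; rewrite -(tensor_mul T_tensor) -fa -gb -big_split /=.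
by apply: tgrade_tens => i; apply: (graded_mul (HG i)).
Qed.

Lemma tgrade_iota i m (x : R i) : @G i m x -> tgrade m (iota x).
Proof.
move=> Gx; have <- : (\sum_j (if j == i then m else 0))%N = m.
  by rewrite (bigD1 i) //= eqxx big1 ?addn0 // => j /negPf->.
apply: tgrade_tens => j; rewrite /unit_with.
have [->|ji] := eqVneq j i; first by rewrite eqtype.dfwith_in.
by rewrite eqtype.dfwith_out 1?eq_sym //; apply: G1_one.
Qed.

Lemma tgrade_generated : exists s : seq T, [set` s] `<=` tgrade 1 /\
  smallest (fun S : set T => GRing.subalg_closed (mem S)) [set` s] = setT.
Proof.
have hs i := graded_generated (HG i).
pose s i := sval (cid (hs i)).
have sG i : [set` s i] `<=` @G i 1%N by have [] := svalP (cid (hs i)).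
have sT i : smallest (fun S : set (R i) => GRing.subalg_closed (mem S)) [set` s i] = setT.
  by have [] := svalP (cid (hs i)).
exists [seq iota x | i <- enum 'I_n, x <- s i]; split.
  move=> y; rewrite /mkset => /allpairsPdep[i [x [_ xs ->]]].
  by apply: tgrade_iota; apply: sG.
apply/seteqP; split=> // y _ S [[S1 SL SM] sS].
have SS : subspace S.
  split; first by have := SL (-1) 1 1 S1 S1; rewrite scaleN1r addNr in_setE.
  by move=> a u v Su Sv; move: (SL a u v); rewrite !in_setE; apply.
have SI i (x : R i) : S (iota x).
  have : (smallest (fun S : set (R i) => GRing.subalg_closed (mem S)) [set` s i]) x by rewrite sT.
  move/(_ [set x | S (iota x)]); apply; split.
    split=> [|a u v|u v]; rewrite !in_setE /=.
    - by rewrite (iota1 T_tensor); move: S1; rewrite in_setE.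
    - by move=> Su Sv; rewrite (iota_lin T_tensor); apply: SS.2.
    - by move=> Su Sv; rewrite (iotaM T_tensor); move: (SM (iota u) (iota v)); rewrite !in_setE; apply.
  move=> z zs; apply: sS; rewrite /mkset; apply/allpairsPdep; exists i, z.
  by rewrite mem_enum.
apply: (tens_span T_tensor) y => // f; rewrite (tensE T_tensor).
elim/big_rec: _ => [|i x _ Sx]; first by move: S1; rewrite in_setE.
by have := SM (iota (f i)) x; rewrite !in_setE; apply.
Qed.

Lemma tensor_graded : standard_graded tgrade.
Proof.
split.
- by move=> m; apply/submod_closedP/tgrade_subspace.
- move=> x.
  pose W : set T := [set x | exists c, (forall m, tgrade m (c m)) /\
    exists N, (forall m, (N <= m)%N -> c m = 0) /\ x = \sum_(m < N) c m].
  suff [c [tc [N [_ xE]]]] : W x by exists N, c.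
  have WS : subspace W.
    split.
      exists (fun=> 0); split=> [m|]; first exact: subspace0 (tgrade_subspace m).
      by exists 0%N; rewrite big_ord0.
    move=> a u v [c [tc [N [cN uE]]]] [c' [tc' [N' [cN' vE]]]].
    exists (fun m => a *: c m + c' m); split; first by move=> m; apply: (tgrade_subspace m).2.
    exists (maxn N N'); split=> [m|].
      by rewrite geq_max => /andP[/cN-> /cN'->]; rewrite scaler0 addr0.
    rewrite big_split /= -scaler_sumr -(sum_widen cN (leq_maxl N N')).
    by rewrite -(sum_widen cN' (leq_maxr N N')) -uE -vE.
  have Wh m y : tgrade m y -> W y.
    move=> ty; exists (fun j => if j == m then y else 0); split.
      by move=> j; case: eqP => [->|_] //; apply: subspace0 (tgrade_subspace j).
    exists m.+1; split=> [j|]; first by rewrite ltnNge leq_eqVlt negb_or eq_sym => /andP[/negPf->].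
    rewrite (bigD1 ord_max) //= eqxx big1 ?addr0 // => i.
    by rewrite -val_eqE /= => /negPf->.
  move: x; apply: (tens_span T_tensor) => // f; have [N ->] := tens_decomposition f.
  apply: subspace_sum => // a _; apply: Wh; apply: tgrade_tens => i.
  exact: (compG (HG i)).
- move=> N c tc c0 m mN; have [pr [prl prE]] := tgrade_projection m.
  have := linear0X prl; rewrite -{1}c0.
  have -> : pr (\sum_(i < N) c i) = \sum_(i < N) pr (c i).
    have := linearX prl (fun=> 1) (fun i : 'I_N => c i).
    by under eq_bigr do rewrite scale1r; under [RHS]eq_bigr do rewrite scale1r.
  rewrite (bigD1 (Ordinal mN)) //= (prE m) // eqxx big1 ?addr0 // => i im.
  by rewrite (prE i) // ifF //; apply/negbTE; move: im; rewrite -val_eqE.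
- exact: tgrade_mul.
- apply/seteqP; split=> [x tx|_ [a _ <-]]; last first.
    by apply: subspaceZ tgrade_one; apply: tgrade_subspace.
  apply: tx.
    split; first by exists 0; rewrite ?scale0r.
    move=> c _ _ [a _ <-] [b _ <-]; exists (c * a + b) => //.
    by rewrite scalerDl scalerA.
  move=> a f a0 Gf.
  have h i : exists c : k, f i = c%:A.
    have := Gf i; suff -> : a i = 0%N by rewrite (graded_zero (HG i)) => -[c _ <-]; exists c.
    by move/eqP: a0; rewrite sum_nat_eq0 => /forallP/(_ i)/eqP.
  have [c hc] := choice h; exists (\prod_i c i) => //.
  rewrite (tensE T_tensor).
  have -> : \prod_i iota (f i) = \prod_i (c i)%:A.
    by apply: eq_bigr => i _; rewrite hc (iotaZ T_tensor) (iota1 T_tensor).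
  by rewrite scaler_prod big1_eq.
- exact: tgrade_generated.
Qed.

Lemma iota_ge i m (x : R i) : ge (@G i) m x -> ge tgrade m (iota x).
Proof.
move=> gx; have [N xE] := comp_sum (HG i) x.
rewrite (xE N) // (iota_sum T_tensor).
apply: subspace_sum => [|j _]; first exact: (subspace_ge tensor_graded).
have [jm|mj] := ltnP j m.
  by rewrite gx // (iota0 T_tensor); apply: subspace0 (subspace_ge tensor_graded _).
apply: (G_ge tensor_graded _ mj); apply: tgrade_iota; exact: (compG (HG i)).
Qed.

Lemma box_ge_sub m : box_ideal tens (fun i => ge (@G i) m) `<=` ge tgrade m.
Proof.
apply: (box_min T_tensor); first exact: (ideal_ge tensor_graded).
by move=> i x; apply: iota_ge.
Qed.

(** A pure tensor of homogeneous elements of total degree above nm has a factor of degree at least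
    [m]. *)
Lemma ge_sub_box m (A : forall i, set (R i)) : (forall i, is_ideal (@A i)) ->
  (forall i, ge (@G i) m `<=` @A i) -> ge tgrade (n * m).+1 `<=` box_ideal tens A.
Proof.
move=> AI gA x gx; have BI := box_ideal_ideal T_tensor AI.
have [N xE] := comp_sum tensor_graded x; rewrite (xE N) //.
apply: ideal_sum => // j _; have [jm|mj] := leqP j (n * m)%N.
  by rewrite gx //; apply: ideal0.
apply: (compG tensor_graded x j); first exact: ideal_subspace.
move=> a f aj Gf.
have [i mi] : exists i, (m <= a i)%N.
  apply: contrapT => h; move: mj; rewrite ltnNge -aj => /negP; apply.
  rewrite -[X in (X * _)%N]card_ord -sum_nat_const; apply: leq_sum => i _.
  by rewrite leqNgt; apply/negP => /ltnW mi; apply: h; exists i.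
by apply: (@box_tens _ _ _ _ _ _ i); apply: gA; apply: (G_ge (HG i) (Gf i)).
Qed.

End TensorGrading.

Section FrobeniusBox.
Variables (k : fieldType) (n : nat) (R : 'I_n -> comAlgType k).
Variables (T : comAlgType k) (tens : (forall i, R i) -> T).
Hypothesis T_tensor : is_tensor_product tens.
Variable p : nat.
Hypothesis pk : p \in [pchar k].
Variable A : forall i, set (R i).

(** Both inclusions are tested on generators, since the p^e-th power is additive on T and commutes
    with [iota]. *)
Lemma frobenius_box e : frobenius_power (box_ideal tens A) (p ^ e) =
  box_ideal tens (fun i => frobenius_power (@A i) (p ^ e)).
Proof.
have pT : p \in [pchar T] by apply: pchar_alg.
have FI i : is_ideal (frobenius_power (@A i) (p ^ e)) by exact: ideal_frobenius_power.
have BI := box_ideal_ideal T_tensor FI.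
apply/seteqP; split.
  apply: gen_min => // _ [x Bx <-].
  suff : box_ideal tens A `<=`
      [set x | box_ideal tens (fun i => frobenius_power (@A i) (p ^ e)) (x ^+ (p ^ e))] by apply.
  apply: (box_min T_tensor); first exact: (ideal_frob_preimage pT).
  move=> i y Ay /=; rewrite -(iotaX T_tensor).
  by apply: (@box_iota _ _ _ _ _ _ i); apply: frobenius_power_mem.
have FB := ideal_frobenius_power (box_ideal tens A) (p ^ e).
apply: (box_min T_tensor) => // i x.
suff : frobenius_power (@A i) (p ^ e) `<=`
    [set x | frobenius_power (box_ideal tens A) (p ^ e) (iota tens x)] by apply.
apply: gen_min => [|_ [y Ay <-] /=].
  apply/is_idealP; split=> /= [|a u v Fu Fv]; first by rewrite (iota0 T_tensor); apply: ideal0.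
  by rewrite (iotaD T_tensor) (iotaM T_tensor); apply: (idealD FB) => //; apply: (idealM _ FB).
by rewrite (iotaX T_tensor); apply: frobenius_power_mem; apply: box_iota.
Qed.

End FrobeniusBox.

(** * The Hilbert-Kunz multiplicity of a tensor product *)

Section HilbertKunzLimit.
Variables (k : fieldType) (R : comAlgType k) (G : nat -> set R) (p : nat).
Hypothesis HG : standard_graded G.
Hypothesis RN : noetherian R.
Hypothesis k_perfect : perfect_field p k.
Hypothesis R_dim : (0 < krull_dim R)%N.
Variable I : set R.
Hypothesis I_hom : hom G I.
Hypothesis I_colength : finite_colength I.

Lemma frobenius_power_ge : exists N, forall m, ge G (N * p ^ m) `<=` frobenius_power I (p ^ m).
Proof.
have [N gN] := finite_colength_ge HG I_hom I_colength.
by have [A [_ gA]] := fpow_ge HG k_perfect gN; exists A.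
Qed.

Lemma colength_frobenius_power m :
  findim setT (frobenius_power I (p ^ m)) /\
  colength (frobenius_power I (p ^ m)) = qdim setT (frobenius_power I (p ^ m)).
Proof.
have [N gN] := frobenius_power_ge; have FI := ideal_frobenius_power I (p ^ m).
split; last exact: (colengthE HG FI (gN m)).
exact: (findim_sub_ge HG setT (ideal_subspace FI) (gN m)).
Qed.

(* Monsky's theorem for homogeneous ideals of standard graded rings. *)
Lemma hilbert_kunz_cvg (K : realType) :
  (fun m => (colength (frobenius_power I (p ^ m)))%:R / (p ^ m)%:R ^+ krull_dim R : K)
    @ \oo --> hilbert_kunz K p I.
Proof.
have [_ uR _ _] := krull_dim_growth HG RN.
have [N gN] := finite_colength_ge HG I_hom I_colength.
(* The convergence theorem counts errors in exponent [d], so the dimension is written as [d.+1]; it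
   is applied to the zero ideal. *)
move: R_dim uR; case dE: (krull_dim R) => [|d] // _ uR.
have := hk_cvg_hom HG RN k_perfect uR I_hom gN (K := K) (hom0 HG).
rewrite /hk_cvg /hilbert_kunz dE.
have -> : hkseq K p d (hk_dim p I [set 0]) =
    (fun m => (colength (frobenius_power I (p ^ m)))%:R / (p ^ m)%:R ^+ d.+1).
  apply/funext => m; rewrite /hkseq /hk_dim; have [_ ->] := colength_frobenius_power m.
  suff -> : idadd [set 0] (fpow p I m) = frobenius_power I (p ^ m) by [].
  apply/seteqP; split=> [_ [_ [z [-> Fz ->]]]|z Fz]; first by rewrite add0r.
  by exists 0, z; rewrite add0r.
by [].
Qed.

End HilbertKunzLimit.

(** * Growth and Krull dimension of the tensor product *)

Section TensorDimension.
Variables (k : fieldType) (n : nat) (R : 'I_n -> comAlgType k).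
Variables (T : comAlgType k) (tens : (forall i, R i) -> T).
Hypothesis T_tensor : is_tensor_product tens.
Variable G : forall i, nat -> set (R i).
Hypothesis HG : forall i, standard_graded (@G i).
Hypothesis RN : forall i, noetherian (R i).

Local Notation TG := (tgrade tens G).
Let HT : standard_graded TG := tensor_graded T_tensor HG.

Lemma tensor_noetherian : noetherian T.
Proof. by have [s [_ sT]] := graded_generated HT; exact: hilbert_basis sT. Qed.

Lemma box_ge_dimension m :
  findim setT (box_ideal tens (fun i => ge (@G i) m)) /\
  qdim setT (box_ideal tens (fun i => ge (@G i) m)) =
    (\prod_i hil (@G i) [set 0%R] m)%N.
Proof.
apply: (box_dimension T_tensor) => i; first exact: (ideal_ge (HG i)).
exact: (findim_ge (HG i)).
Qed.

Lemma hil_tensor_le m : (hil TG [set 0%R] m <= \prod_i hil (@G i) [set 0%R] m)%N.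
Proof.
have [fd <-] := box_ge_dimension m.
have BI : is_ideal (box_ideal tens (fun i => ge (@G i) m)).
  by apply: (box_ideal_ideal T_tensor) => i; exact: (ideal_ge (HG i)).
apply: qdimS => //; [exact: ideal_subspace|exact: (subspace_ge HT m)|].
exact: (box_ge_sub T_tensor HG).
Qed.

Lemma hil_tensor_ge m :
  (\prod_i hil (@G i) [set 0%R] m <= hil TG [set 0%R] (n * m).+1)%N.
Proof.
have [fd <-] := box_ge_dimension m.
have gI i : is_ideal (ge (@G i) m) by exact: (ideal_ge (HG i)).
have BI := box_ideal_ideal T_tensor gI.
apply: qdimS => //; [exact: (subspace_ge HT)|exact: ideal_subspace| |exact: (findim_ge HT)].
exact: (ge_sub_box T_tensor HG gI (fun i => @subset_refl _ _)).
Qed.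

(** The box ideal of the R(i)_(>=m) lies between T_(>=nm+1) and T_(>=m), so the product of the [hil]
    of the factors at m lies between the [hil] of T at m and at nm+1. *)
Lemma krull_dim_tensor : krull_dim T = (\sum_i krull_dim (R i))%N.
Proof.
have [loT [D uT] _ _] := krull_dim_growth HT tensor_noetherian.
have hgr i := krull_dim_growth (HG i) (@RN i).
have hlo i : lower (@G i) (krull_dim (R i)) [set 0] by have [] := hgr i.
have hup i : upper (@G i) (krull_dim (R i)) [set 0] by have [] := hgr i.
have [c hc] := choice hlo; have [C hC] := choice hup.
apply/eqP; rewrite eqn_leq; apply/andP; split.
  apply: upper_lower loT; exists (\prod_i C i)%N => m m0.
  apply: leq_trans (hil_tensor_le m) _.
  by rewrite expn_sum -big_split; apply: leq_prod => i _; apply: hC.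
apply: (@expn_leq_exponent _ _ ((\prod_i c i) * (D * n.+1 ^ krull_dim T))) => m m0.
rewrite expn_sum; apply: (@leq_trans (\prod_i (c i * hil (@G i) [set 0%R] m))%N).
  by apply: leq_prod => i _; apply: hc.
rewrite big_split -!mulnA leq_mul2l; apply/orP; right.
apply: leq_trans (hil_tensor_ge m) _; apply: leq_trans (uT _ _) _ => //.
rewrite leq_mul2l -expnMn; apply/orP; right.
have h : ((n * m).+1 <= n.+1 * m)%N by nia.
by case: (krull_dim T) => // e; rewrite leq_exp2r.
Qed.

End TensorDimension.


Theorem corollary2p5 (K : realType) (p : nat) (k : fieldType)
  (k_perfect : perfect_field p k)
  (n : nat) (n_gt0 : (0 < n)%N)
  (R : 'I_n -> comAlgType k) (G : forall i, nat -> set (R i))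
  (R_graded : forall i, standard_graded (G i))
  (R_noetherian : forall i, noetherian (R i))
  (R_dim : forall i, (2 <= krull_dim (R i))%N)
  (I : forall i, set (R i))
  (I_homogeneous : forall i, homogeneous_ideal (G i) (I i))
  (I_colength : forall i, finite_colength (I i))
  (T : comAlgType k) (tens : (forall i, R i) -> T)
  (T_tensor : is_tensor_product tens) :
  hilbert_kunz K p (box_ideal tens I) = \prod_(i < n) hilbert_kunz K p (I i).
Proof.
have pk : p \in [pchar k] by case: k_perfect.
have IH i : hom (G i) (I i) := homI (R_graded i) (I_homogeneous i).
have II i : is_ideal (I i) := hom_ideal (IH i).
have R_dim0 i : (0 < krull_dim (R i))%N by apply: leq_trans (R_dim i).
have HT := tensor_graded T_tensor R_graded.
have hge i := frobenius_power_ge (R_graded i) k_perfect (IH i) (I_colength i).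
have [A hA] := choice hge.
have hcol i m := colength_frobenius_power (R_graded i) k_perfect (IH i) (I_colength i) m.
have colT m : colength (frobenius_power (box_ideal tens I) (p ^ m)) =
    (\prod_i colength (frobenius_power (I i) (p ^ m)))%N.
  have FI i : is_ideal (frobenius_power (I i) (p ^ m)) by exact: ideal_frobenius_power.
  (* A degree bound common to all factors is needed to find some T_(>=N) inside the box ideal. *)
  pose M := (\max_i (A i * p ^ m))%N.
  have gM i : ge (G i) M `<=` frobenius_power (I i) (p ^ m).
    by apply: subset_trans (hA i m); apply: ge_leq; apply: (leq_bigmax i).
  rewrite (frobenius_box T_tensor pk).
  have BI := box_ideal_ideal T_tensor FI.
  rewrite (colengthE HT BI (ge_sub_box T_tensor R_graded FI gM)).
  have [_ ->] := box_dimension T_tensor FI (fun i => (hcol i m).1).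
  by apply: eq_bigr => i _; rewrite (hcol i m).2.
rewrite {1}/hilbert_kunz (krull_dim_tensor T_tensor R_graded R_noetherian).
pose u i m : K := (colength (frobenius_power (I i) (p ^ m)))%:R /
  (p ^ m)%:R ^+ krull_dim (R i).
have -> : (fun m => (colength (frobenius_power (box_ideal tens I) (p ^ m)))%:R /
    (p ^ m)%:R ^+ (\sum_i krull_dim (R i))%N : K) = (fun m => \prod_i u i m).
  apply/funext => m; rewrite colT natr_prod prodf_div; congr (_ / _).
  by rewrite prodrXr.
(* Every factor converges to its own multiplicity, so the product converges, and its limit is
   unique. *)
apply: cvg_lim; first exact: norm_hausdorff.
apply: (@cvg_big K 'I_n *%R 1 predT (@mul_continuous K) nat \oo (index_enum _) u
  (fun i => hilbert_kunz K p (I i)) _) => i _.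
exact: (hilbert_kunz_cvg (R_graded i) (R_noetherian i) k_perfect (R_dim0 i) (IH i) (I_colength i)).
Qed.
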